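(* Let $n\ge 2$. The noncrossing hypertree complex $C$ on $n+1$ vertices is naturally homeomorphic to the noncrossing partition link $L$ on $n+1$ vertices: there is a homeomorphism $C\to L$ which, for every noncrossing hypertree $\tau$ on $n+1$ vertices, carries the closed simplex of $C$ labeled $\tau$ onto the subcomplex $\mathrm{Simplex}(\tau)$ of $L$. As a consequence, the piecewise spherical metric on $L$ induces a piecewise spherical metric on $C$ (that is, pulling back the metric of $L$ makes each closed simplex of $C$ a spherical simplex).
   Context: Hypergraphs. A hypergraph on a finite vertex set is a set of subsets of the vertices (hyperedges), each with at least $2$ elements. A simple cycle consists of $k\ge 2$ distinct vertices $v_1,\dots,v_k$ and distinct hyperedges $e_1,\dots,e_k$ with $v_i,v_{i+1}\in e_i$ (indices mod $k$). A hyperforest is a hypergraph with no simple cycle; a hypertree is a connected hyperforest; a tree is a hypertree all of whose hyperedges have size $2$. Noncrossing. Fix a convex $(n+1)$-gon in the plane with vertices labeled $1,\dots,n+1$ clockwise. A hypergraph on these vertices is noncrossing if the convex hulls of any two distinct hyperedges meet in at most one vertex and in no other point. Hypergraphs are ordered by $\sigma\le\tau$ iff each hyperedge of $\sigma$ is contained in a hyperedge of $\tau$. Hyperedge poset. If $v$ is a vertex of a noncrossing hyperforest $\tau$, the hyperedges containing $v$ are linearly ordered from left to right as seen from $v$ looking into the polygon (so $e<e'$ at $v$ iff, going clockwise around the boundary from $v$, the other vertices of $e$ precede the other vertices of $e'$). The hyperedge poset of $\tau$ is the set of hyperedges with the partial order generated (by transitivity) by all these local linear orders. A proper ordering of $\tau$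 is a linear ordering of its hyperedges that is a linear extension of its hyperedge poset. Noncrossing hypertree complex $C$. The dual of the poset of noncrossing hypertrees on $n+1$ vertices is the face poset of a simplicial complex $C$ (the empty simplex corresponds to the hypertree with a single hyperedge). A noncrossing hypertree with $k$ hyperedges labels a $(k-2)$-dimensional simplex, and the simplex labeled $\tau'$ is a face of the simplex labeled $\tau$ iff $\tau\le\tau'$. Noncrossing partition link $L$. Noncrossing partitions of $\{1,\dots,n+1\}$ (distinct blocks have disjoint convex hulls), ordered by refinement, form a bounded graded lattice with rank $n+1-\#\text{blocks}$. Its orthoscheme complex is the order complex with each simplex given the euclidean metric in which the edge joining $x<y$ has length $\sqrt{\mathrm{rank}(y)-\mathrm{rank}(x)}$. $L$ is the link, in this complex, of the edge joining the minimum and maximum elements: a piecewise spherical simplicial complex, whose simplices correspond to chains of noncrossing partitions containing both bounding elements; as a simplicial complex it is the order complex of the lattice with its bounding elements removed. $\mathrm{Simplex}(\tau)$. To a proper ordering $e_1,\dots,e_k$ of a noncrossing hypertree $\tau$ associate the chain $\pi_0<\pi_1<\dots<\pi_k$, where $\pi_j$ is the (noncrossing) partition of the vertex set into connected components of the hyperforest with hyperedges $e_1,\dots,e_j$; this gives a $(k-2)$-simplex of $L$. $\mathrm{Simplex}(\tau)$ is the union of the closed simplices of $L$ so obtained from all proper orderings of $\tau$. *)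

(* Defs.v *)
From HB Require Import structures.
From mathcomp Require Import all_boot all_order all_algebra.
From mathcomp Require Import all_classical all_reals all_analysis.
Set Implicit Arguments.
Unset Strict Implicit.
Unset Printing Implicit Defensive.
Import Order.TTheory GRing.Theory Num.Theory.
Import numFieldNormedType.Exports.
Local Open Scope classical_set_scope.
Local Open Scope ring_scope.

(* The vertex labelled i + 1 in the usual numbering 1, ..., n + 1 is i : 'I_n.+1.
   Set partitions of the vertex set are elements of the same type. *)
Definition hypergraph (n : nat) := {set {set 'I_n.+1}}.

Section Combinatorics.
Variable n : nat.
Implicit Types (sigma tau : hypergraph n) (e f : {set 'I_n.+1}).

Definition is_hypergraph tau : Prop := forall e, e \in tau -> (2 <= #|e|)%N.

Definition has_simple_cycle tau : Prop :=
  exists (k : nat) (v : 'I_k -> 'I_n.+1) (e : 'I_k -> {set 'I_n.+1}),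
    [/\ (2 <= k)%N, injective v, injective e &
        forall i, [/\ e i \in tau, v i \in e i & v (ordS i) \in e i]].

Definition adjacent tau : rel 'I_n.+1 :=
  fun u v => [exists e in tau, (u \in e) && (v \in e)].

Definition connected_hypergraph tau : Prop :=
  forall u v, connect (adjacent tau) u v.

Definition hypertree tau : Prop :=
  [/\ is_hypergraph tau, connected_hypergraph tau & ~ has_simple_cycle tau].

(* Used both for the order on hypergraphs and for refinement of partitions. *)
Definition refines sigma tau : bool :=
  [forall e in sigma, exists f in tau, e \subset f].

Definition components tau : hypergraph n :=
  equivalence_partition (connect (adjacent tau)) [set: 'I_n.+1]%SET.

(* Number of clockwise steps along the boundary from v to u. *)
Definition clockwise_steps (v u : 'I_n.+1) : nat := (u + n.+1 - v) %% n.+1.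

Definition local_lt tau : rel {set 'I_n.+1} := fun e f =>
  [&& e \in tau, f \in tau, e != f &
    [exists v : 'I_n.+1, [&& v \in e, v \in f &
      [forall x in e :\ v, forall y in f :\ v,
         (clockwise_steps v x < clockwise_steps v y)%N]]]].

Definition hyperedge_le tau : rel {set 'I_n.+1} := connect (local_lt tau).

Definition proper_ordering tau (s : seq {set 'I_n.+1}) : Prop :=
  perm_eq s (enum tau) /\
  forall e f, e \in tau -> f \in tau -> hyperedge_le tau e f ->
    (index e s <= index f s)%N.

(* The chain pi_1 < ... < pi_(k-1) of a sequence e_1, ..., e_k; the bounding
   partitions pi_0 and pi_k do not give vertices of the link. *)
Definition ordering_chain (s : seq {set 'I_n.+1}) : seq (hypergraph n) :=
  [seq components [set e in take j s]%SET | j <- iota 1 (size s).-1].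

Definition discrete_partition : hypergraph n :=
  [set [set v] | v : 'I_n.+1]%SET.

Definition one_block_partition : hypergraph n := [set [set: 'I_n.+1]]%SET.

Definition rank (P : hypergraph n) : nat := (n.+1 - #|P|)%N.

End Combinatorics.

Section PlaneGeometry.
Variables (R : realType) (n : nat) (p : 'I_n.+1 -> 'rV[R]_2).

Definition orient (a b c : 'rV[R]_2) : R :=
  (b 0 0 - a 0 0) * (c 0 1 - a 0 1) - (b 0 1 - a 0 1) * (c 0 0 - a 0 0).

(* p lists, in clockwise order, the vertices of a (strictly) convex polygon. *)
Definition clockwise_convex_polygon : Prop :=
  forall i j k : 'I_n.+1, (i < j)%N -> (j < k)%N -> orient (p i) (p j) (p k) < 0.

Definition hull (e : {set 'I_n.+1}) : set 'rV[R]_2 :=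
  [set z | exists a : 'I_n.+1 -> R,
    [/\ forall i, 0 <= a i, \sum_(i in e) a i = 1
      & z = \sum_(i in e) a i *: p i]].

Definition noncrossing (tau : hypergraph n) : Prop :=
  forall e f, e \in tau -> f \in tau -> e != f ->
    hull e `&` hull f = set0 \/ exists v, hull e `&` hull f = [set p v].

Definition noncrossing_hypertree (tau : hypergraph n) : Prop :=
  hypertree tau /\ noncrossing tau.

Definition noncrossing_partition (P : hypergraph n) : Prop :=
  finset.partition P [set: 'I_n.+1]%SET /\
  forall A B, A \in P -> B \in P -> A != B -> hull A `&` hull B = set0.

Definition proper_noncrossing_partition (P : hypergraph n) : Prop :=
  [/\ noncrossing_partition P, P <> discrete_partition n
    & P <> one_block_partition n].

End PlaneGeometry.

(* Points of both complexes are given by coordinates indexed by the vertices of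
   the complex (extended by zero); all topologies are induced from the product
   topology of this finite-dimensional space. *)
Definition coords (R : realType) (n : nat) := {ptws hypergraph n -> R}.

Section HypertreeComplex.
Variables (R : realType) (n : nat) (p : 'I_n.+1 -> 'rV[R]_2).

(* Since a hypertree with k hyperedges labels a (k-2)-simplex and faces
   correspond to coarser hypertrees, the vertices of the simplex labelled tau
   are the hypertrees above tau with two hyperedges. *)
Definition simplex_vertices (tau : hypergraph n) : set (hypergraph n) :=
  [set sigma | [/\ noncrossing_hypertree p sigma, #|sigma| = 2%N
                 & refines tau sigma]].

Definition closed_simplex (tau : hypergraph n) : set (coords R n) :=
  [set x | [/\ forall sigma, 0 <= x sigma,
               forall sigma, ~ simplex_vertices tau sigma -> x sigma = 0
             & \sum_sigma x sigma = 1]].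

Definition hypertree_complex : set (coords R n) :=
  [set x | exists2 tau, noncrossing_hypertree p tau & closed_simplex tau x].

End HypertreeComplex.

Section PartitionLink.
Variables (R : realType) (n : nat) (p : 'I_n.+1 -> 'rV[R]_2).
Implicit Types P Q : hypergraph n.

(* Length of the edge of the orthoscheme complex joining comparable P and Q. *)
Definition orthoscheme_edge P Q : R :=
  Num.sqrt `|(rank Q)%:R - (rank P)%:R|.

(* Euclidean inner product of the vectors from the minimum vertex to P and to Q,
   recovered from the edge lengths by polarization.  It is only meaningful when
   P and Q are comparable, i.e. lie in a common simplex. *)
Definition orthoscheme_dot P Q : R :=
  let O := discrete_partition n in
  (orthoscheme_edge O P ^+ 2 + orthoscheme_edge O Q ^+ 2
   - orthoscheme_edge P Q ^+ 2) / 2.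

(* Inner product of the components of these vectors orthogonal to the edge from
   the minimum to the maximum. *)
Definition link_vertex_dot P Q : R :=
  let I := one_block_partition n in
  orthoscheme_dot P Q
  - orthoscheme_dot P I * orthoscheme_dot Q I / orthoscheme_dot I I.

(* x stands for the vector \sum_P x P * (orthogonal component of the vector from
   the minimum to P), with x supported on a chain. *)
Definition link_dot (x y : coords R n) : R :=
  \sum_P \sum_Q x P * y Q * link_vertex_dot P Q.

Definition is_proper_chain (c : seq (hypergraph n)) : Prop :=
  (forall P, P \in c -> proper_noncrossing_partition p P) /\
  (forall P Q, P \in c -> Q \in c -> refines P Q || refines Q P).

(* The link of an edge consists of the unit vectors orthogonal to the edge and
   pointing into a simplex; c lists the vertices of the closed link simplex. *)
Definition link_simplex (c : seq (hypergraph n)) : set (coords R n) :=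
  [set x | [/\ forall P, 0 <= x P, forall P, P \notin c -> x P = 0
             & link_dot x x = 1]].

Definition partition_link : set (coords R n) :=
  [set x | exists2 c, is_proper_chain c & link_simplex c x].

Definition Simplex (tau : hypergraph n) : set (coords R n) :=
  [set x | exists2 s, proper_ordering tau s & link_simplex (ordering_chain s) x].

(* The piecewise spherical metric: infimum of the lengths of strings of points,
   consecutive ones lying in a common closed simplex, where one uses the
   spherical distance.  It is +oo between distinct path components. *)
Definition link_step (x y : coords R n) : Prop :=
  exists2 c, is_proper_chain c & link_simplex c x /\ link_simplex c y.

Fixpoint is_string (x : coords R n) (s : seq (coords R n)) (y : coords R n) :=
  if s is z :: s' then link_step x z /\ is_string z s' y else x = y.

Fixpoint string_length (x : coords R n) (s : seq (coords R n)) : R :=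
  if s is z :: s' then acos (link_dot x z) + string_length z s' else 0.

Definition link_dist (x y : coords R n) : \bar R :=
  ereal_inf [set (string_length x s)%:E | s in [set s | is_string x s y]].

End PartitionLink.

Section SphericalSimplices.
Variables (R : realType) (n : nat) (p : 'I_n.+1 -> 'rV[R]_2).

Definition dotv (m : nat) (u v : 'rV[R]_m) : R := \sum_i u 0 i * v 0 i.

Definition linearly_independent_on (m : nat) (V : set (hypergraph n))
    (u : hypergraph n -> 'rV[R]_m) : Prop :=
  forall a : hypergraph n -> R, (forall sigma, ~ V sigma -> a sigma = 0) ->
    \sum_sigma a sigma *: u sigma = 0 -> forall sigma, a sigma = 0.

(* The spherical convex hull of the unit vectors u sigma, sigma in V. *)
Definition spherical_simplex (m : nat) (V : set (hypergraph n))
    (u : hypergraph n -> 'rV[R]_m) : set 'rV[R]_m :=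
  [set z | dotv z z = 1 /\ exists a : hypergraph n -> R,
    [/\ forall sigma, 0 <= a sigma, forall sigma, ~ V sigma -> a sigma = 0
      & z = \sum_sigma a sigma *: u sigma]].

(* With the distance d, the closed simplex labelled tau is isometric to a
   spherical simplex on the same vertices, faces corresponding to faces. *)
Definition is_spherical_simplex (d : coords R n -> coords R n -> \bar R)
    (tau : hypergraph n) : Prop :=
  exists (m : nat) (u : hypergraph n -> 'rV[R]_m) (g : coords R n -> 'rV[R]_m),
    [/\ (forall sigma, simplex_vertices p tau sigma ->
           dotv (u sigma) (u sigma) = 1)
        /\ linearly_independent_on (simplex_vertices p tau) u,
        set_bij (closed_simplex p tau)
          (spherical_simplex (simplex_vertices p tau) u) g,
        forall tau', noncrossing_hypertree p tau' -> refines tau tau' ->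
          g @` closed_simplex p tau' =
          spherical_simplex (simplex_vertices p tau') u
      & forall x y, closed_simplex p tau x -> closed_simplex p tau y ->
          d x y = (acos (dotv (g x) (g y)))%:E].

End SphericalSimplices.

Definition homeomorphism_between (X Y : topologicalType) (A : set X) (B : set Y)
    (h : X -> Y) : Prop :=
  [/\ set_bij A B h, {within A, continuous h} &
      exists g : Y -> X, {within B, continuous g} /\
        forall x, A x -> g (h x) = x].

(* Main.v *)
Require Import Defs.
From HB Require Import structures.
From mathcomp Require Import all_boot all_order all_algebra.
From mathcomp Require Import zify.
Set Implicit Arguments.
Unset Strict Implicit.
Unset Printing Implicit Defensive.

(** The vertices of the hypertree complex are the noncrossing hypertrees with two
    hyperedges.  Such a hypertree cuts the polygon into two arcs that share a
    vertex v; if m is the last vertex of the first arc, going clockwise from v,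
    it is written [halves v m].

    The inverse of the homeomorphism is linear up to normalisation.  Send a point
    y of the link, with coordinate y P at the partition P, to the point whose
    coordinate at [halves v m] is the sum of y P over the partitions P in which m
    is the predecessor of v in its block ([simplex_map]).  If the chain carrying
    y comes from a proper ordering of a hypertree tau, then no hyperedge of tau
    can run across such a cut ([predecessor_splits]), so that the image lies in
    the simplex of tau.  Conversely, a point x of this simplex gives each
    hyperedge e a height, the sum of the coordinates of x at the cuts whose first
    arc contains e.  Heights decrease along the hyperedge poset; sorting the
    hyperedges by height gives a proper ordering, and the gaps between successive
    heights are the coordinates of a preimage of x: the sum that computes a
    predecessor weight telescopes to a difference of heights, which is the
    coordinate of x ([vertex_weight_chain_point]).

    Two facts remain.  The simplices of all hypertrees cover the link, because a
    chain of noncrossing partitions can be refined by adding one edge at a time,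
    from the successor of a vertex in its block to its next successor
    ([merging_edge_exists]).  And the map is injective on the whole link
    ([vertex_weight_inj]): a sum of permutation matrices has equal row and column
    sums, so that the entries lost by omitting the two bounding partitions are
    determined up to these partitions; then the smallest partition of the chain
    can be read off and peeled away.  A continuous bijection from a compact space
    to a Hausdorff space is a homeomorphism.

    For the metric, fix a hypertree tau and replace its hyperedges by stars, which
    form a tree with n edges, the spokes.  Adding the spokes one by one to a
    partition P, the redundant ones are those whose ends are joined already.
    Their number is the rank of P and they increase with P, so that sending P to
    its set of redundant spokes extends to a map from the link to a sphere that
    is isometric on every simplex.  Hence distances in the link are at least the
    spherical distances of the images ([string_length_ge]).  On the part of the
    link that belongs to tau this map is injective; its image is the convex cone
    of the heights that decrease along the hyperedge poset, so that a great arc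
    between two image points lifts to a string of the same length
    ([geodesic_string]).  As heights are linear in the coordinates of the simplex
    of tau and determine them ([heights_inj]), the cone is simplicial, with one
    generator for each vertex of the simplex. *)

(** * The cyclic order of the vertices *)

Section ClockwiseSteps.
Variable n : nat.
Notation V := 'I_n.+1.
Notation d := (@clockwise_steps n).
Implicit Types (u v a : V).

Lemma clockwise_stepsE v u :
  (d v u = if v <= u then u - v else u + n.+1 - v)%N.
Proof.
have hu := ltn_ord u; have hv := ltn_ord v.
rewrite /clockwise_steps; case: (leqP v u) => h.
  have -> : (u + n.+1 - v = (u - v) + n.+1)%N by lia.
  by rewrite modnDr modn_small //; move=> *; lia.
by rewrite modn_small //; move=> *; lia.
Qed.

Lemma steps_le a u : (d a u <= n)%N.
Proof. by rewrite clockwise_stepsE; have := ltn_ord u; case: (leqP a u); move=> *; lia. Qed.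

Lemma stepsvv v : d v v = 0%N.
Proof. by rewrite clockwise_stepsE leqnn subnn. Qed.

(** Distances from two base points differ by a rotation, so that every
    statement about the cyclic order can be read off a single base point. *)
Lemma steps_ge a v u : (d a v <= d a u)%N -> (d v u = d a u - d a v)%N.
Proof.
have := ltn_ord u; have := ltn_ord a; have := ltn_ord v.
rewrite !clockwise_stepsE.
by case: (leqP v u); case: (leqP a v); case: (leqP a u); move=> *; lia.
Qed.

Lemma steps_lt a v u : (d a u < d a v)%N -> (d v u = d a u + n.+1 - d a v)%N.
Proof.
have := ltn_ord u; have := ltn_ord a; have := ltn_ord v.
rewrite !clockwise_stepsE.
by case: (leqP v u); case: (leqP a v); case: (leqP a u); move=> *; lia.
Qed.

Lemma steps_inj a : injective (d a).
Proof.
move=> x y h; apply/val_inj => /=; move: h.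
have := ltn_ord x; have := ltn_ord a; have := ltn_ord y.
by rewrite !clockwise_stepsE; case: (leqP a x); case: (leqP a y); move=> *; lia.
Qed.

Lemma eq_steps a u v : (u == v) = (d a u == d a v).
Proof. by rewrite (inj_eq (@steps_inj a)). Qed.

Lemma steps_gt0 v u : (0 < d v u)%N = (u != v).
Proof. by rewrite (eq_steps v) stepsvv lt0n. Qed.

(** [cross a b c z] holds when a, b, c, z are met in this order clockwise, so
    that the chords ac and bz cross. *)
Definition cross a b c z : bool := (0 < d a b < d a c)%N && (d a c < d a z)%N.
End ClockwiseSteps.

(* [cyc a] decides a statement on the cyclic order by expressing every
   distance and every equality through the distances from [a]. *)
Ltac cyc_steps a :=
  repeat match goal with
  | |- context [@clockwise_steps ?n ?v ?u] =>
    lazymatch v with a => fail | _ => idtac end;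
    lazymatch u with
    | v => rewrite (stepsvv v)
    | _ => case: (leqP (@clockwise_steps n a v) (@clockwise_steps n a u)) =>
             [/[dup] /steps_ge -> | /[dup] /steps_lt ->]
    end
  end.
Ltac cyc_bound a :=
  repeat match goal with
  | |- context [@clockwise_steps ?n a ?u] =>
    lazymatch u with
    | a => rewrite (stepsvv a)
    | _ => have := steps_le a u; move: (@clockwise_steps n a u) => ?
    end
  end.
Ltac cyc a :=
  unfold cross in *;
  repeat match goal with
  | H : is_true _ |- _ => move: H
  | H : @eq bool _ _ |- _ => move: H
  | H : @eq _ ?x ?y |- _ => change (@eq nat x y) in H; move: H
  end;
  repeat match goal with
  | |- context [@eq_op _ ?x ?y] =>
    lazymatch type of x with nat => fail | _ => rewrite (eq_steps a x y) end
  end;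
  cyc_steps a; cyc_bound a; move=> *; lia.

Section CyclicOrder.
Variable n : nat.
Notation V := 'I_n.+1.
Notation d := (@clockwise_steps n).
Implicit Types (u v x y z a b c : V) (e f : {set V}).

Lemma cross_rot a b c z : cross a b c z -> cross b c z a.
Proof. by move=> h; cyc a. Qed.

End CyclicOrder.

(** * Connectivity and cycles in hypergraphs *)

Section Connectivity.
Variable n : nat.
Notation V := 'I_n.+1.
Notation d := (@clockwise_steps n).
Implicit Types (u v x y z a b c : V) (e f : {set V}) (S T tau : hypergraph n).

Definition conn S : rel V := connect (adjacent S).

Lemma adjacentP S u v :
  reflect (exists e, [/\ e \in S, u \in e & v \in e]) (adjacent S u v).
Proof.
apply: (iffP 'exists_andP) => -[e]; first by case=> eS /andP[]; exists e.
by case=> eS ue ve; exists e; rewrite eS ue ve.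
Qed.

Lemma adjacent_sym S : symmetric (adjacent S).
Proof. by move=> u v; apply/adjacentP/adjacentP => -[e []]; exists e. Qed.

Lemma conn_sym S : symmetric (conn S).
Proof. exact: sym_connect_sym (@adjacent_sym S). Qed.

Lemma conn_refl S u : conn S u u. Proof. exact: connect0. Qed.

Lemma conn_trans S : transitive (conn S). Proof. exact: connect_trans. Qed.

Lemma conn_edge S e u v : e \in S -> u \in e -> v \in e -> conn S u v.
Proof. by move=> eS ue ve; apply/connect1/adjacentP; exists e. Qed.

Lemma conn_ind S a (p : pred V) : p a ->
  (forall e u v, e \in S -> u \in e -> v \in e -> conn S a u -> p u -> p v) ->
  forall b, conn S a b -> p b.
Proof.
move=> pa step b /connectP[s]; elim/last_ind: s b => [|s w IH] b /=.
  by move=> _ ->.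
rewrite rcons_path last_rcons => /andP[sp /adjacentP[e [eS le we]]] ->.
apply: (step e (last a s)) => //; last exact: IH.
by apply/connectP; exists s.
Qed.

Lemma conn_const S a (p : pred V) :
  (forall e u v, e \in S -> u \in e -> v \in e -> conn S a u -> p u = p v) ->
  forall b, conn S a b -> p a = p b.
Proof.
move=> h b ab; apply/(@eqP bool); move: b ab.
apply: (@conn_ind S a (fun b => p a == p b)) => // e u v eS ue ve au /eqP ->.
by apply/(@eqP bool)/(h e).
Qed.

Lemma conn_sub S (r : rel V) : reflexive r -> transitive r ->
  (forall e u v, e \in S -> u \in e -> v \in e -> r u v) ->
  forall a b, conn S a b -> r a b.
Proof.
move=> rr rt h a; apply: conn_ind => // e u v eS ue ve _ au.
exact: rt au (h e u v eS ue ve).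
Qed.

Lemma connS S T u v : S \subset T -> conn S u v -> conn T u v.
Proof.
move=> /subsetP ST; apply: conn_sub; [exact: conn_refl|exact: conn_trans|].
by move=> e x y /ST; apply: conn_edge.
Qed.

Lemma conn0 u v : conn set0 u v -> u = v.
Proof.
move=> uv; apply/eqP; move: u v uv.
by apply: (conn_sub (r := eq_op)) => [u|v u w /eqP->|e u w]; rewrite ?inE.
Qed.

(** A hyperedge e closes a cycle when two of its vertices are connected by other
    hyperedges.  This form of acyclicity spares the bookkeeping of distinct
    vertices and hyperedges. *)
Definition forest tau : Prop :=
  forall e u v, e \in tau -> u \in e -> v \in e -> conn (tau :\ e) u v -> u = v.

Lemma val_iter_ordS k (i : 'I_k) t : val (iter t (@ordS k) i) = (i + t) %% k.
Proof.
elim: t => [|t IHt] /=; first by rewrite addn0 modn_small.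
by rewrite [nat_of_ord _]IHt -addn1 modnDml addn1 addnS.
Qed.

(** Going around the cycle the other way avoids the hyperedge e i. *)
Lemma cycle_conn (k : nat) (v : 'I_k -> V) (e : 'I_k -> {set V}) S (i : 'I_k) :
  (forall j, v j \in e j /\ v (ordS j) \in e j) ->
  (forall j, j != i -> e j \in S) -> conn S (v (ordS i)) (v i).
Proof.
move=> ve eS.
have walk t : (t < k)%N -> conn S (v (ordS i)) (v (iter t.+1 (@ordS k) i)).
  elim: t => [|t IH] tk; first exact: conn_refl.
  apply: (conn_trans (IH (ltnW tk))).
  set j := iter t.+1 (@ordS k) i.
  have [vj vSj] := ve j.
  apply: conn_edge vj vSj; apply: eS; apply/eqP => /(congr1 val).
  rewrite val_iter_ordS.
  move=> /= h; have /= := ltn_ord i; move: h.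
  have [h|h] := ltnP (i + t.+1) k; first by rewrite modn_small //; lia.
  have -> : (i + t.+1 = (i + t.+1 - k) + k)%N by lia.
  by rewrite modnDr modn_small; have := ltn_ord i; lia.
have k0 : (0 < k)%N by apply: leq_ltn_trans (ltn_ord i).
have := walk k.-1; rewrite prednK // => /(_ (leqnn _)).
suff -> : iter k (@ordS k) i = i by [].
by apply/val_inj; rewrite val_iter_ordS modnDr modn_small.
Qed.

Lemma forest_no_cycle tau : forest tau -> ~ has_simple_cycle tau.
Proof.
move=> ft [k [v [e [k2 vi ei h]]]].
have k0 : (0 < k)%N by lia.
pose i := Ordinal k0.
have [eit vie vSie] := h i.
have := @cycle_conn k v e (tau :\ e i) i.
move=> /(_ (fun j => let: And3 _ p q := h j in conj p q)) hc.
have : v (ordS i) = v i.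
  apply: ft eit vSie vie (hc _) => j ji; rewrite !inE (inj_eq ei) ji.
  by case: (h j).
move=> /vi /(congr1 val) /=; rewrite modn_small //; lia.
Qed.

(** A shortest walk between two vertices of a hyperedge that avoids this
    hyperedge never repeats a vertex nor a hyperedge, so that it closes up
    into a simple cycle. *)
Lemma no_cycle_forest tau : ~ has_simple_cycle tau -> forest tau.
Proof.
move=> nc e0 u v e0t ue ve uv; apply/eqP/negPn/negP => neq; apply: nc.
set S := tau :\ e0 in uv.
pose P l := [exists s : l.-tuple V, path (adjacent S) u s && (last u s == v)].
have exP : exists l, P l.
  case/connectP: uv => s sp ls; exists (size s).
  by apply/existsP; exists (in_tuple s); rewrite sp /= ls eqxx.
case: (ex_minnP exP) => l /existsP[[s /= /eqP sl] /andP[sp /eqP ls]] lmin.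
have {}lmin s' : path (adjacent S) u s' -> last u s' = v -> (l <= size s')%N.
  move=> p1 p2; apply: lmin; apply/existsP; exists (in_tuple s').
  by rewrite p1 /= p2 eqxx.
pose g i := nth u (u :: s) i.
have gadj i : (i < l)%N -> adjacent S (g i) (g i.+1).
  by move=> il; move/(pathP u): sp => /(_ i); rewrite sl; apply.
have gl : g l = v by rewrite /g -sl nth_last.
pose E i := odflt set0 [pick f in S | (g i \in f) && (g i.+1 \in f)].
have EP i : (i < l)%N -> [/\ E i \in S, g i \in E i & g i.+1 \in E i].
  move=> il; rewrite /E; case: pickP => [f /andP[fS /andP[]]//|h].
  by case/adjacentP: (gadj i il) => f [fS gf gf']; have := h f; rewrite fS gf gf'.
(* a shortcut from position i to position j contradicts minimality *)
have short i j : (i < l)%N -> (i < j <= l)%N -> adjacent S (g i) (g j) -> j = i.+1.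
  move=> il /andP[ij jl] adj; apply/eqP; rewrite eqn_leq ij andbT leqNgt.
  apply/negP; case: j ij jl adj => // j _ jl adj; rewrite ltnS => ij.
  pose s' := take i s ++ drop j s.
  have ds : drop j s = g j.+1 :: drop j.+1 s by rewrite (drop_nth u) ?sl.
  have lti : last u (take i s) = g i.
    case: (i) il => [|i'] il' /=; first by rewrite take0.
    by rewrite (take_nth u) ?sl 1?ltnW // last_rcons.
  have pp : path (adjacent S) u s'.
    rewrite cat_path lti ds /= adj take_path //=.
    by have := sp; rewrite -{1}(cat_take_drop j s) cat_path ds => /andP[_ /andP[]].
  have lp : last u s' = v.
    by rewrite last_cat lti -ls -{2}(cat_take_drop j s) last_cat ds.
  by have := lmin s' pp lp; rewrite size_cat size_take size_drop sl il; lia.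
have ginj i j : (i < j <= l)%N -> g i != g j.
  move=> /andP[ij jl]; apply/eqP => gij.
  have [jl' | jl'] := ltnP j l.
    have := short i j.+1 (ltn_trans ij jl'); rewrite gij gadj // jl' (leq_trans ij) //.
    by move=> /(_ isT isT); lia.
  have jE : j = l by lia.
  case: i ij gij => [|i] ij gij; first by move: neq; rewrite -gl -jE -gij eqxx.
  have := short i j; have := gadj i; rewrite gij; have -> : (i < l)%N by lia.
  by move=> /(_ isT) -> /(_ isT); rewrite jl andbT => /(_ _ isT); lia.
have Einj i j : (i < j)%N -> (j < l)%N -> E i != E j.
  move=> ij jl; apply/eqP => Eij.
  have [ES gi _] := EP i (ltn_trans ij jl); have [_ _ gj] := EP j jl.
  have : adjacent S (g i) (g j.+1) by apply/adjacentP; exists (E i); rewrite {3}Eij.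
  by move/(short i j.+1 (ltn_trans ij jl)); rewrite jl (leq_trans ij) // => /(_ isT); lia.
have l0 : (0 < l)%N.
  by case: (l) gl => // g0; move: neq; rewrite -g0 eqxx.
exists l.+1, (fun i => g i), (fun i => if i < l then E i else e0); split=> //.
- move=> i j gij; apply/val_inj => /=; case: (ltngtP i j) => // h.
    by have := ginj i j; rewrite h gij eqxx -ltnS ltn_ord => /(_ isT).
  by have := ginj j i; rewrite h gij eqxx -ltnS ltn_ord => /(_ isT).
- have E0 i : (i < l)%N -> E i != e0.
    by move=> /EP[]; rewrite !inE => /andP[].
  move=> i j Eij; apply/val_inj => /=; move: Eij.
  case: ifP => il; case: ifP => jl.
  + move=> /eqP; case: (ltngtP i j) => // h.
      by rewrite (negbTE (Einj _ _ h jl)).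
    by rewrite eq_sym (negbTE (Einj _ _ h il)).
  + by move=> /eqP; rewrite (negbTE (E0 _ il)).
  + by move=> /esym/eqP; rewrite (negbTE (E0 _ jl)).
  + by have := ltn_ord i; have := ltn_ord j; lia.
- move=> i /=; have := ltn_ord i; case: ifP => il iL.
    have [ES g1 g2] := EP i il.
    rewrite g1 modn_small; last by lia.
    by rewrite g2; split=> //; move: ES; rewrite inE => /andP[].
  have -> : (i : nat) = l by lia.
  by rewrite modnn gl.
Qed.
End Connectivity.

(** * Noncrossing hypertrees *)

Section Noncrossing.
Variable n : nat.
Notation V := 'I_n.+1.
Notation d := (@clockwise_steps n).
Implicit Types (u v w x y z a b c m : V) (e f : {set V}) (S T tau : hypergraph n).

Definition noncrossing_sets e f : Prop := forall a b c z,
  a \in e -> c \in e -> b \in f -> z \in f -> ~~ cross a b c z.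

Lemma noncrossing_sets_sym e f : noncrossing_sets e f -> noncrossing_sets f e.
Proof.
move=> h a b c z af cf be ze; apply/negP => cr.
by have := h b c z a be ze cf af; rewrite cross_rot.
Qed.

Definition noncrossing_rel (r : rel V) : Prop :=
  forall a b c z, cross a b c z -> r a c -> r b z -> r a b.

Lemma chord_side e f x z u u' : noncrossing_sets e f ->
  x \in e -> z \in e -> u \in f -> u' \in f ->
  [&& u != x, u != z, u' != x & u' != z] ->
  (d x u < d x z) = (d x u' < d x z).
Proof.
wlog suff hw : u u' / noncrossing_sets e f -> x \in e -> z \in e -> u \in f ->
    u' \in f -> [&& u != x, u != z, u' != x & u' != z] ->
    (d x u < d x z) -> (d x u' < d x z).
  move=> h xe ze uf uf' /[dup] /and4P[? ? ? ?] ne.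
  by apply/idP/idP; apply: hw => //; apply/and4P.
move=> h xe ze uf uf' ne lt; move: (h x u z u' xe ze uf uf') ne lt; clear=> ? ? ?.
cyc x.
Qed.

(** A connected set of vertices that avoids x and z stays on one side of the chord
    xz, since each of its hyperedges does. *)
Lemma conn_side e S x z a b : x \in e -> z \in e ->
  (forall f, f \in S -> f != e -> noncrossing_sets e f) ->
  ~~ conn S a x -> ~~ conn S a z -> conn S a b ->
  (d x a < d x z) = (d x b < d x z).
Proof.
move=> xe ze h ax az; move: b; apply: (conn_const (p := fun b => d x b < d x z)).
move=> f u v fS uf vf au.
have av : conn S a v by apply: conn_trans au (conn_edge fS uf vf).
have ne w y : conn S a w -> ~~ conn S a y -> w != y.
  by move=> aw; apply: contraNneq => <-.
have fe : f != e.
  by apply: contraNneq ax => fe; apply: (conn_trans au); apply: (conn_edge fS uf); rewrite fe.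
apply: (chord_side (h f fS fe) xe ze uf vf); by rewrite !ne.
Qed.

(** The combinatorial counterpart of a noncrossing hypertree; the two notions are
    identified by [noncrossing_hypertreeP]. *)
Definition noncrossing_tree tau : Prop :=
  [/\ is_hypergraph tau, connected_hypergraph tau, forest tau &
      forall e f, e \in tau -> f \in tau -> e != f -> noncrossing_sets e f].

Lemma forest_meet tau e f u v : forest tau -> e \in tau -> f \in tau ->
  e != f -> u \in e -> v \in e -> u \in f -> v \in f -> u = v.
Proof.
move=> ft et ft' ef ue ve uf vf; apply: ft et ue ve _.
by apply: conn_edge uf vf; rewrite !inE eq_sym ef.
Qed.

(** A chord of one component leaves every other component on one side; letting
    the chord run along the hyperedges joining b to z, the points a and c stay
    on the same side. *)
Lemma conn_nc tau S : forest tau ->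
  (forall e f, e \in tau -> f \in tau -> e != f -> noncrossing_sets e f) ->
  S \subset tau -> noncrossing_rel (conn S).
Proof.
move=> ft nc /subsetP St a b c z cr ac bz; apply/negPn/negP => nab.
have sep u : conn S b u -> u != a /\ u != c.
  move=> bu; split; apply/eqP => E; rewrite E in bu; move: nab; rewrite conn_sym.
    by rewrite bu.
  by rewrite (conn_trans bu) // conn_sym.
suff : (d a b < d a c) = (d a z < d a c).
  by move: cr; clear=> ? ?; cyc a.
move: z bz {cr}; apply: (conn_const (p := fun z => d a z < d a c)).
move=> e u v eS ue ve bu.
have bv : conn S b v by apply: conn_trans bu (conn_edge eS ue ve).
have nau : ~~ conn S a u.
  by apply: contra nab => h; rewrite (conn_trans h) // conn_sym.
have nav : ~~ conn S a v.
  by apply: contra nab => h; rewrite (conn_trans h) // conn_sym.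
have hnc f : f \in S -> f != e -> noncrossing_sets e f.
  by move=> fS fe; apply: nc; rewrite ?St // eq_sym.
have := conn_side ue ve hnc nau nav ac.
have [ua uc] := sep _ bu; have [va vc] := sep _ bv.
by move: ua uc va vc; clear=> ua uc va vc h; cyc u.
Qed.

Lemma local_ltP tau e f : reflect
  [/\ e \in tau, f \in tau, e != f & exists v, [/\ v \in e, v \in f &
    forall x y, x \in e -> x != v -> y \in f -> y != v -> d v x < d v y]]
  (local_lt tau e f).
Proof.
apply: (iffP and4P) => -[et ft ef]; last first.
  case=> v [ve vf h]; split=> //; apply/existsP; exists v; rewrite ve vf /=.
  apply/forallP => x; apply/implyP; rewrite !inE => /andP[xv xe].
  apply/forallP => y; apply/implyP; rewrite !inE => /andP[yv yf].
  exact: h.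
case/existsP => v /and3P[ve vf /forallP h]; split=> //; exists v; split=> // x y xe xv yf yv.
have /implyP := h x; rewrite !inE xe xv => /(_ isT)/forallP/(_ y)/implyP.
by rewrite !inE yf yv; apply.
Qed.

Lemma edge_other tau e v : is_hypergraph tau -> e \in tau ->
  exists2 x, x \in e & x != v.
Proof.
move=> hh /hh; case: (boolP (v \in e)) => ve.
  rewrite (cardsD1 v) ve ltnS card_gt0 => /set0Pn[x]; rewrite !inE => /andP[xv xe].
  by exists x.
move=> h; have : (0 < #|e|)%N by lia.
rewrite card_gt0 => /set0Pn[x xe]; exists x => //.
by apply: contraNneq ve => <-.
Qed.

Lemma local_lt_at tau e f v : noncrossing_tree tau -> local_lt tau e f ->
  v \in e -> v \in f ->
  forall x y, x \in e -> x != v -> y \in f -> y != v -> d v x < d v y.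
Proof.
move=> [_ _ ft _] /local_ltP[et ft' ef [v' [ve' vf' h]]] ve vf.
by have <- : v' = v by apply: forest_meet ft et ft' ef ve' ve vf' vf.
Qed.

(** If neither hyperedge came before the other at v, four of their vertices would
    alternate. *)
Lemma local_lt_total tau e f v : noncrossing_tree tau -> e \in tau -> f \in tau ->
  e != f -> v \in e -> v \in f -> local_lt tau e f || local_lt tau f e.
Proof.
move=> [hh _ ft nc] et ft' ef ve vf.
apply/negPn/negP; rewrite negb_or => /andP[nef nfe].
have ncef := nc e f et ft' ef.
have meet := forest_meet ft et ft' ef.
have witness e1 e2 : e1 \in tau -> e2 \in tau -> e1 != e2 -> v \in e1 -> v \in e2 ->
    ~~ local_lt tau e1 e2 ->
    exists x y, [/\ x \in e1, x != v & [/\ y \in e2, y != v & d v y < d v x]].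
  move=> t1 t2 e12 v1 v2 nlt.
  have /existsP[x /existsP[y /and5P[? ? ? ? ?]]] : [exists x, exists y,
      [&& x \in e1, x != v, y \in e2, y != v & d v y < d v x]].
    apply: contraR nlt; rewrite negb_exists => /forallP h; apply/local_ltP.
    split=> //; exists v; split=> // x y xe xv yf yv.
    have := h x; rewrite negb_exists => /forallP/(_ y); rewrite xe xv yf yv /= -leqNgt.
    rewrite leq_eqVlt => /orP[/eqP /steps_inj E|//]; rewrite -E in yf.
    by move: xv; rewrite (forest_meet ft t1 t2 e12 xe v1 yf v2) eqxx.
  by exists x, y.
have [x [y [xe xv [yf yv lt]]]] := witness e f et ft' ef ve vf nef.
have fe : f != e by rewrite eq_sym.
have [y' [x' [yf' yv' [xe' xv' lt']]]] := witness f e ft' et fe vf ve nfe.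
have [h|h|h] := ltngtP (d v x') (d v y).
- have := ncef x' y x v xe' xe yf vf; move: xv xv' yv lt lt' h; clear=> *; cyc v.
- have := ncef x' y' v y xe' ve yf' yf; move: xv xv' yv yv' lt lt' h; clear=> *; cyc v.
- by move/steps_inj: h => E; rewrite -E in yf; move: xv'; rewrite (meet x' v) ?eqxx.
Qed.

End Noncrossing.

(** * Cutting a hypertree in two at a vertex *)

Section Splits.
Variable n : nat.
Notation V := 'I_n.+1.
Notation d := (@clockwise_steps n).
Implicit Types (u v w x y z a b c m : V) (e f : {set V}) (S T tau : hypergraph n).

(** Cutting the polygon at v and just after m, clockwise from v, leaves two arcs
    that share the vertex v. *)
Definition low v m : {set V} := [set u | d v u <= d v m].
Definition high v m : {set V} := [set u | (u == v) || (d v m < d v u)].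
Definition halves v m : hypergraph n := [set low v m; high v m].
(** Excluded are m = v and the vertex m just before v, for which one of the arcs
    is reduced to v. *)
Definition proper_cut v m : bool := 0 < d v m < n.
Definition splits tau v m : bool :=
  [forall e in tau, (e \subset low v m) || (e \subset high v m)].

(** Going around the class of v clockwise, m is met just before returning to v; it
    is v itself when the class has no other element. *)
Definition predecessor (r : rel V) v m : bool :=
  r v m && [forall u, r v u ==> (d v u <= d v m)].

Definition initial_segment tau S : Prop :=
  S \subset tau /\ forall e f, f \in S -> local_lt tau e f -> e \in S.

Lemma splitsP tau v m e : splits tau v m -> e \in tau ->
  e \subset low v m \/ e \subset high v m.
Proof. by move=> /forallP/(_ e)/implyP h /h /orP. Qed.

Lemma low_high v m u : u \in low v m -> u \in high v m -> u = v.
Proof. by rewrite !inE; case: eqP => //= _; lia. Qed.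

Lemma low_high_edge tau v m e : is_hypergraph tau -> e \in tau ->
  e \subset low v m -> e \subset high v m -> False.
Proof.
move=> hh et /subsetP el /subsetP eh; have [x xe xv] := edge_other v hh et.
by move: xv; rewrite (low_high (el x xe) (eh x xe)) eqxx.
Qed.

Lemma predecessorP (r : rel V) v m :
  reflect (r v m /\ forall u, r v u -> d v u <= d v m) (predecessor r v m).
Proof.
apply: (iffP andP) => -[rm h]; split=> //.
  by move=> u; move: h => /forallP/(_ u)/implyP.
by apply/forallP => u; apply/implyP; apply: h.
Qed.

Lemma predecessor_exists (r : rel V) v : r v v -> exists m, predecessor r v m.
Proof.
move=> rv; case: (arg_maxnP (fun u => d v u) rv) => m rm h.
by exists m; apply/predecessorP.
Qed.

Lemma predecessor_uniq (r : rel V) v m m' : predecessor r v m -> predecessor r v m' -> m = m'.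
Proof.
move=> /predecessorP[rm hm] /predecessorP[rm' hm']; apply: (@steps_inj _ v).
by apply/eqP; rewrite eqn_leq hm // hm'.
Qed.

(** At x, the hyperedge e comes after all the hyperedges of the initial segment S;
    the rest of the component of x cannot cross e either. *)
Lemma initial_late tau S e x z u : noncrossing_tree tau -> initial_segment tau S ->
  e \in tau -> e \notin S -> x \in e -> z \in e -> z != x ->
  conn S x u -> u != x -> d x u < d x z.
Proof.
move=> nt [St init] et eS xe ze zx xu ux; have [hh _ ft nc] := nt.
have sub : S \subset tau :\ e.
  by apply/subsetP => f fS; rewrite !inE (subsetP St) // andbT;
     apply: contraNneq eS => <-.
have nxz w : conn S x w -> w \in e -> w = x.
  by move=> xw we; apply/esym/(ft e x w et xe we); apply: connS xw.
suff : (u == x) || (d x u < d x z) by rewrite (negbTE ux).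
apply: (conn_ind (p := fun u => (u == x) || (d x u < d x z))) xu => [|f w w' fS wf wf' xw].
  by rewrite eqxx.
have xw' : conn S x w' by apply: conn_trans xw (conn_edge fS wf wf').
have ftau := subsetP St _ fS.
have ef : e != f by apply: contraNneq eS => ->.
have [->|w'x] := eqVneq w' x; first by [].
have [xf|xf] := boolP (x \in f).
  move=> _ /=; have lfe : local_lt tau f e.
    case/orP: (local_lt_total nt et ftau ef xe xf) => // h.
    by move: eS; rewrite (init e f).
  exact: local_lt_at nt lfe xf xe _ _ wf' w'x ze zx.
case/orP => [/eqP wx|wz]; first by rewrite -wx wf in xf.
rewrite /=; have := chord_side (nc e f et ftau ef) xe ze wf wf'.
rewrite wz => <- //; apply/and4P; split=> //.
- by apply: contraNneq xf => <-.
- by apply/eqP => E; move: wz; rewrite E ltnn.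
- by apply/eqP => E; move: zx; rewrite -{1}E (nxz w') ?eqxx // E.
Qed.

(** A hyperedge from one side of the cut to the other would either separate v from
    m, which are connected, or start in their block without being late there. *)
Lemma predecessor_splits tau S v m : noncrossing_tree tau -> initial_segment tau S ->
  predecessor (conn S) v m -> splits tau v m.
Proof.
move=> nt init /predecessorP[vm hm]; have [hh _ ft nc] := nt; have [St ini] := init.
apply/forallP => e; apply/implyP => et; apply/negPn/negP.
rewrite negb_or => /andP[/subsetPn[z ze zl] /subsetPn[x xe xh]].
move: zl xh; rewrite !inE -ltnNge negb_or -leqNgt => mz /andP[xv xm].
have zv : z != v by rewrite -steps_gt0; apply: leq_ltn_trans mz.
have nz : ~~ conn S v z by apply/negP => /hm; rewrite leqNgt mz.
have xz : z != x by apply: contraTneq mz => ->; rewrite -leqNgt.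
have [vx|vx] := boolP (conn S v x).
  have eS : e \notin S.
    by apply: contra nz => eS; apply: conn_trans vx (conn_edge eS xe ze).
  have vx' : v != x by rewrite eq_sym.
  have := initial_late nt init et eS xe ze xz _ vx'; rewrite conn_sym => /(_ vx).
  by move: mz xm xv; clear=> *; cyc v.
have hnc f : f \in S -> f != e -> noncrossing_sets e f.
  by move=> fS fe; apply: (nc e f et (subsetP St _ fS)); rewrite eq_sym.
have := conn_side xe ze hnc vx nz vm.
have xm' : x != m by apply: contraNneq vx => ->.
by move: mz xm xv xm'; clear=> ? ? ? ? h; cyc v.
Qed.

(** A hyperedge at v outside S is late there, so that it has vertices beyond m. *)
Lemma predecessor_low tau S v m e : noncrossing_tree tau -> initial_segment tau S ->
  predecessor (conn S) v m -> e \in tau -> v \in e -> (e \subset low v m) = (e \in S).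
Proof.
move=> nt init /predecessorP[vm hm] et ve; have [hh _ _ _] := nt.
apply/idP/idP => [el|eS]; last first.
  by apply/subsetP => x xe; rewrite inE; apply: hm; apply: (conn_edge eS ve).
apply/negPn/negP => eS; have [x xe xv] := edge_other v hh et.
have xm : d v x <= d v m by move/subsetP/(_ x xe): el; rewrite inE.
have mv : m != v by apply: contraNneq xv => mv; rewrite (eq_steps v) stepsvv; rewrite mv stepsvv in xm; lia.
by have := initial_late nt init et eS ve xe xv vm mv; lia.
Qed.

(** The two arcs meet only in v, and at v the low arc comes first. *)
Lemma splits_local_lt tau v m e f : noncrossing_tree tau -> splits tau v m ->
  local_lt tau e f -> f \subset low v m -> e \subset low v m.
Proof.
move=> nt sp ef fl; have [hh _ _ _] := nt.
have /local_ltP[et ft nef [u [ue uf h]]] := ef.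
have [//|eh] := splitsP sp et.
have uv : u = v by apply: low_high (subsetP fl _ uf) (subsetP eh _ ue).
have [x xe xu] := edge_other u hh et; have [y yf yu] := edge_other u hh ft.
have := h x y xe xu yf yu; have := subsetP fl _ yf; have := subsetP eh _ xe.
rewrite !inE -uv (negbTE xu) /= => h1 h2 h3.
by have := ltn_trans h1 (leq_trans h3 h2); rewrite ltnn.
Qed.

(** As tau is connected, the vertices between two different cuts at v are reached
    from v through a hyperedge at v that lies between the cuts. *)
Lemma splits_uniq tau v m m' : noncrossing_tree tau -> splits tau v m -> splits tau v m' ->
  (forall e, e \in tau -> v \in e -> (e \subset low v m) = (e \subset low v m')) ->
  m = m'.
Proof.
move=> nt; wlog lt : m m' / d v m < d v m'.
  move=> hw s s' h; have [lt|lt|/steps_inj //] := ltngtP (d v m) (d v m').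
    exact: hw.
  by apply/esym/hw => // e et ve; rewrite h.
move=> sp sp' h; have [hh ct _ _] := nt.
have : conn tau m' v by apply: ct.
move=> /(conn_ind (p := fun u => d v m < d v u <= d v m')).
rewrite stepsvv lt leqnn ltn0 => H; suff : false by []; apply: H => // e u w et ue we _ /andP[um um'].
have el : e \subset low v m'.
  have [//|/subsetP/(_ u ue)] := splitsP sp' et; rewrite inE.
  case: eqP um => [->|_ _ /=]; first by rewrite stepsvv.
  by rewrite ltnNge um'.
have eh : e \subset high v m.
  have [/subsetP/(_ u ue)|//] := splitsP sp et; rewrite inE; lia.
have := subsetP el _ we; have := subsetP eh _ we; rewrite !inE.
case: eqP => [E _ _|_ /= -> ->] //.
have ve : v \in e by rewrite -E.
by case: (low_high_edge hh et (m := m) (v := v)) => //; rewrite h.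
Qed.

Lemma splits_vertex tau v : splits tau v v.
Proof.
apply/forallP => e; apply/implyP => _; apply/orP; right; apply/subsetP => x _.
by rewrite inE stepsvv steps_gt0 orbN.
Qed.

Lemma splits_full tau v m : d v m = n -> splits tau v m.
Proof.
move=> E; apply/forallP => e; apply/implyP => _; apply/orP; left.
by apply/subsetP => x _; rewrite inE E steps_le.
Qed.

Lemma last_vertex v : exists m, d v m = n.
Proof.
have [v0|v0] := posnP v.
  exists ord_max; rewrite clockwise_stepsE v0 /=; lia.
have lt : v.-1 < n.+1 by have := ltn_ord v; lia.
exists (Ordinal lt); rewrite clockwise_stepsE /=.
by case: leqP; have := ltn_ord v; lia.
Qed.

Lemma splits_low_edge tau v m : noncrossing_tree tau -> splits tau v m -> proper_cut v m ->
  exists e, [/\ e \in tau, v \in e & e \subset low v m].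
Proof.
move=> nt sp /andP[m0 _]; have [hh _ _ _] := nt.
have /existsP[e /and3P[? ? ?]] : [exists e, [&& e \in tau, v \in e & e \subset low v m]].
  apply: contraLR m0; rewrite negb_exists => /forallP h.
  suff -> : m = v by rewrite stepsvv.
  apply: splits_uniq nt sp (splits_vertex tau v) _ => e et ve.
  have := h e; rewrite et ve /= => /negbTE ->; apply/esym/negbTE/negP => el.
  apply: (low_high_edge hh et el); apply/subsetP => x _.
  by rewrite inE stepsvv steps_gt0 orbN.
by exists e.
Qed.

Lemma splits_high_edge tau v m : noncrossing_tree tau -> splits tau v m -> proper_cut v m ->
  exists e, [/\ e \in tau, v \in e & ~~ (e \subset low v m)].
Proof.
move=> nt sp /andP[_ mn].
have /existsP[e /and3P[? ? ?]] : [exists e, [&& e \in tau, v \in e & ~~ (e \subset low v m)]].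
  apply: contraLR mn; rewrite negb_exists => /forallP h.
  have [m' E] := last_vertex v.
  suff -> : m = m' by rewrite E ltnn.
  apply: splits_uniq nt sp (splits_full tau E) _ => e et ve.
  have := h e; rewrite et ve /= negbK => ->; apply/esym/subsetP => x _.
  by rewrite inE E steps_le.
by exists e.
Qed.

Lemma halves_inj v m v' m' : proper_cut v m -> proper_cut v' m' ->
  halves v m = halves v' m' -> v = v' /\ m = m'.
Proof.
move=> /andP[m0 mn] /andP[m0' mn'] E.
have [y yv] := last_vertex v; have [y' yv'] := last_vertex v'.
have vl w k : w \in low w k by rewrite inE stepsvv.
have vh w k : w \in high w k by rewrite inE eqxx.
have lE : low v m \in halves v' m' by rewrite -E !inE eqxx.
have hE : high v m \in halves v' m' by rewrite -E !inE eqxx orbT.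
have vv : v = v'.
  move: lE hE; rewrite !inE => /orP[]/eqP Hl /orP[]/eqP Hh.
  - have : y \in high v m by rewrite inE yv mn orbT.
    rewrite Hh -Hl inE yv; lia.
  - by apply: (@low_high v' m'); rewrite -?Hl -?Hh.
  - by apply: (@low_high v' m'); rewrite -?Hl -?Hh.
  - have : y \in high v m by rewrite inE yv mn orbT.
    rewrite Hh -Hl inE yv; lia.
split=> //; rewrite -{v' yv' m0' mn' E y'}vv in lE hE *.
move: lE; rewrite !inE => /orP[]/eqP Hl.
  have h1 : m \in low v m' by rewrite -Hl inE.
  have h2 : m' \in low v m by rewrite Hl inE.
  by move: h1 h2; rewrite !inE => h1 h2; apply: (@steps_inj _ v); lia.
have : m \in high v m' by rewrite -Hl inE.
have : y \notin low v m by rewrite inE yv -ltnNge.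
rewrite Hl !inE yv negb_or -leqNgt => /andP[_ h].
have -> : (m == v) = false by apply/negbTE; rewrite -steps_gt0.
by rewrite /= => h'; have := steps_le v m; lia.
Qed.

Lemma halves_card v m : proper_cut v m -> #|halves v m| = 2.
Proof.
move=> /andP[m0 mn]; rewrite cards2; case: eqP => // E.
have [y yv] := last_vertex v.
have : y \in high v m by rewrite inE yv mn orbT.
rewrite -E inE yv; lia.
Qed.
End Splits.

Import Order.TTheory GRing.Theory Num.Theory.

(** * Proper orderings *)

Section ProperOrderings.
Variable n : nat.
Notation V := 'I_n.+1.
Notation d := (@clockwise_steps n).
Implicit Types (u v w x y z a b c m : V) (e f : {set V}) (S T tau : hypergraph n).

(** Take for m the farthest vertex that is connected to e without using e
    itself, apart from v: no hyperedge can jump over it. *)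
Lemma local_lt_split tau e f : noncrossing_tree tau -> local_lt tau e f ->
  exists v m, [/\ proper_cut v m, splits tau v m, e \subset low v m
                & ~~ (f \subset low v m)].
Proof.
move=> nt ef; have [hh _ ft nc] := nt.
have /local_ltP[et ftau nef [v [ve vf h]]] := ef.
exists v; set T := tau :\ e.
pose K := [set u | [exists a in e :\ v, conn T a u]].
have KP u : reflect (exists a, [/\ a \in e, a != v & conn T a u]) (u \in K).
  rewrite inE; apply: (iffP 'exists_andP) => -[a].
    by rewrite !inE => -[/andP[av ae] au]; exists a.
  by case=> ae av au; exists a; rewrite !inE av ae.
have eK a : a \in e -> a != v -> a \in K.
  by move=> ae av; apply/KP; exists a; split=> //; apply: conn_refl.
have vK : v \notin K.
  apply/negP => /KP[a [ae av au]]; move: av; rewrite (ft e a v et ae ve) ?eqxx //.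
have closed g u u' : g \in T -> u \in g -> u' \in g -> u \in K -> u' \in K.
  move=> gT ug ug' /KP[a [ae av au]]; apply/KP; exists a; split=> //.
  exact: conn_trans au (conn_edge gT ug ug').
have fT : f \in T by rewrite !inE eq_sym nef.
have fK y : y \in f -> y \notin K.
  by move=> yf; apply: contra vK => /(closed f _ v fT yf vf).
have [a0 a0e a0v] := edge_other v hh et.
case: (arg_maxnP (fun u => d v u) (eK a0 a0e a0v)) => m mK mmax.
have [x [xe xv xm]] := KP _ mK.
have [b bf bv] := edge_other v hh ftau.
have mv : m != v by apply: contraTneq mK => ->.
have xb : d v x < d v b by apply: h.
have xvb : ~~ conn T x v.
  by apply: contra vK => xv'; apply/KP; exists x.
have xnb : ~~ conn T x b.
  by apply: contra (fK b bf) => xb'; apply/KP; exists x.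
(* the chord from v to b of f keeps m on the side of e *)
have mb : d v m < d v b.
  have hnc g : g \in T -> g != f -> noncrossing_sets f g.
    by rewrite !inE => /andP[_ gt] gf; apply: nc; rewrite // eq_sym.
  have := conn_side vf bf hnc xvb xnb xm.
  by rewrite xb => <-.
have el : e \subset low v m.
  apply/subsetP => u ue; rewrite inE; have [->|uv] := eqVneq u v; first by rewrite stepsvv.
  exact/mmax/eK.
exists m; split=> //.
- by rewrite /proper_cut steps_gt0 mv (leq_trans mb (steps_le v b)).
- apply/forallP => g; apply/implyP => gt; apply/negPn/negP.
  rewrite negb_or => /andP[/subsetPn[z zg zl] /subsetPn[y yg yh]].
  move: zl yh; rewrite !inE -ltnNge negb_or -leqNgt => mz /andP[yv ym].
  have ge : g != e.
    by apply: contraTneq mz => E; rewrite -leqNgt; move/subsetP/(_ z): el; rewrite inE -E; apply.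
  have gT : g \in T by rewrite !inE ge.
  have zK : z \notin K by apply/negP => /mmax /=; rewrite leqNgt mz.
  have gK u : u \in g -> u \notin K.
    by move=> ug; apply: contra zK; apply: closed gT ug zg.
  have xg u : u \in g -> ~~ conn T x u.
    by move=> /gK; apply: contra => xu; apply/KP; exists x.
  have hnc k : k \in T -> k != g -> noncrossing_sets g k.
    by rewrite !inE => /andP[_ kt] kg; apply: nc; rewrite // eq_sym.
  have := conn_side yg zg hnc (xg y yg) (xg z zg) xm.
  have ncr : ~~ cross v y x z by apply: (nc e g et gt _ v y x z ve xe yg zg); rewrite eq_sym.
  have xy : y != x by apply: contraTneq (eK x xe xv) => <-; apply: gK.
  have my : y != m by apply: contraTneq mK => <-; apply: gK.
  have {}xm : d v x <= d v m by apply/mmax/eK.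
  by move: mz yv ym ncr xy my xm xv; clear=> ? ? ? ? ? ? ? ? ?; cyc v.
- apply/subsetPn; exists b => //; by rewrite inE -ltnNge.
Qed.

Lemma connect_homo (T : finType) (r : rel T) (k : T -> nat) :
  (forall s t, r s t -> k s <= k t) -> forall s t, connect r s t -> k s <= k t.
Proof.
move=> h s t /connectP[p]; elim: p s => [|q p IH] s /=; first by move=> _ ->.
by case/andP=> /h sq pp e; apply: leq_trans sq (IH q pp e).
Qed.

(** Ties in w are broken by the number of cuts that have the hyperedge on their low
    side.  This number strictly decreases along the local orders, which also
    shows that they generate a partial order. *)
Lemma proper_ordering_exists (R : realDomainType) tau (w : {set V} -> R) :
  noncrossing_tree tau -> (forall e f, local_lt tau e f -> (w f <= w e)%R) ->
  exists s, proper_ordering tau s /\ sorted (fun e f => (w f <= w e)%R) s.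
Proof.
move=> nt hw.
pose A e := [set q : V * V | [&& proper_cut q.1 q.2, splits tau q.1 q.2 & e \subset low q.1 q.2]].
have Alt e f : local_lt tau e f -> #|A f| < #|A e|.
  move=> ef; apply: proper_card; apply/properP; split.
    apply/subsetP => -[v m]; rewrite !inE /= => /and3P[-> sp fl].
    by rewrite sp (splits_local_lt nt sp ef fl).
  have [v [m [vm sp el fl]]] := local_lt_split nt ef.
  by exists (v, m); rewrite !inE /= vm sp ?el ?(negbTE fl).
pose leT e f := (w f < w e)%R || ((w e == w f) && (#|A f| <= #|A e|)).
have leT_tot : total leT.
  move=> e f; rewrite /leT; case: (ltrgtP (w e) (w f)) => //= _.
  by rewrite leq_total.
have leT_tr : transitive leT.
  move=> f e g /orP[l1|/andP[/eqP e1 c1]] /orP[l2|/andP[/eqP e2 c2]]; apply/orP.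
  - by left; apply: lt_trans l2 l1.
  - by left; rewrite -e2.
  - by left; rewrite e1.
  - by right; rewrite e1 e2 eqxx (leq_trans c2 c1).
pose s := sort leT (enum tau).
have ss : sorted leT s := sort_sorted leT_tot _.
have ps : perm_eq s (enum tau) by rewrite perm_sort.
have mem e : (e \in s) = (e \in tau) by rewrite (perm_mem ps) mem_enum.
exists s; split; last first.
  apply: sub_sorted ss => e f /orP[/ltW//|/andP[/eqP->]] //.
split=> // e0 f0 _ _; apply: (connect_homo (k := fun e => index e s)) => e f ef.
have /local_ltP[et ft nef _] := ef.
rewrite leqNgt; apply/negP => lt.
have := sorted_ltn_index leT_tr ss; move=> /(_ f e); rewrite !mem => /(_ ft et lt).
case/orP => [l|/andP[_]]; last by rewrite leqNgt Alt.
by have := hw e f ef; rewrite leNgt l.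
Qed.

Lemma proper_ordering_mem tau s : proper_ordering tau s ->
  (forall e, (e \in s) = (e \in tau)) /\ uniq s.
Proof.
case=> ps _; split; first by move=> e; rewrite (perm_mem ps) mem_enum.
by rewrite (perm_uniq ps) enum_uniq.
Qed.

Lemma proper_ordering_lt tau s e f : proper_ordering tau s -> local_lt tau e f ->
  index e s < index f s.
Proof.
move=> ps ef; have [ms us] := proper_ordering_mem ps.
have /local_ltP[et ft nef _] := ef.
have le := ps.2 e f et ft (connect1 ef).
rewrite ltn_neqAle le andbT; apply: contra nef => /eqP E.
by rewrite -(nth_index set0 (x := e) (s := s)) ?ms // E nth_index // ms.
Qed.

Definition prefix_edges (s : seq {set V}) j : hypergraph n := [set e in take j s].

Lemma proper_ordering_prefix tau s e j : proper_ordering tau s -> e \in tau ->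
  (e \in prefix_edges s j) = (index e s < j).
Proof.
by move=> ps et; rewrite /prefix_edges inE in_take // (proper_ordering_mem ps).1.
Qed.

Lemma prefix_sub tau s j : proper_ordering tau s -> prefix_edges s j \subset tau.
Proof.
move=> ps; apply/subsetP => e; rewrite /prefix_edges inE => /mem_take.
by rewrite (proper_ordering_mem ps).1.
Qed.

Lemma prefix_initial tau s j : proper_ordering tau s -> initial_segment tau (prefix_edges s j).
Proof.
move=> ps; split; first exact: prefix_sub.
move=> e f fS ef; have /local_ltP[et ft _ _] := ef.
move: fS; rewrite !(proper_ordering_prefix _ ps) //.
exact/ltn_trans/(proper_ordering_lt ps ef).
Qed.
Lemma prefix_mono (s : seq {set V}) i j : i <= j -> prefix_edges s i \subset prefix_edges s j.
Proof.
move=> ij; apply/subsetP => e; rewrite !inE => es.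
by have := es; rewrite -(take_takel s ij) => /mem_take.
Qed.
End ProperOrderings.

(** * Hypertrees with two hyperedges *)

Section Halves.
Variable n : nat.
Hypothesis hn : (2 <= n)%N.
Notation V := 'I_n.+1.
Notation d := (@clockwise_steps n).
Implicit Types (u v w a b c m : V) (e f : {set V}) (tau sigma S P Q : hypergraph n).

Lemma first_vertex v : exists u, d v u = 1%N.
Proof.
have [vn|vn] := ltnP v n.
  by exists (Ordinal (vn : (v.+1 < n.+1)%N)); rewrite clockwise_stepsE /= leqnSn; lia.
by exists ord0; rewrite clockwise_stepsE /=; case: leqP; have := ltn_ord v; lia.
Qed.

Lemma halves_tree v m : proper_cut v m -> noncrossing_tree (halves v m).
Proof.
move=> vm; have /andP[m0 mn] := vm; have [y yv] := last_vertex v.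
have vl : v \in low v m by rewrite inE stepsvv.
have vh : v \in high v m by rewrite inE eqxx.
have ml : m \in low v m by rewrite inE.
have yh : y \in high v m by rewrite inE yv mn orbT.
have mv : m != v by rewrite -steps_gt0.
have yv' : y != v by rewrite -steps_gt0 yv; lia.
have lE : low v m \in halves v m by rewrite !inE eqxx.
have hE : high v m \in halves v m by rewrite !inE eqxx orbT.
have two e : e \in halves v m -> v \in e by rewrite !inE => /orP[]/eqP->.
split.
- move=> e; rewrite !inE => /orP[]/eqP->.
    have := subset_leq_card (_ : [set v; m] \subset low v m).
    by rewrite cards2 eq_sym mv; apply; apply/subsetP => u; rewrite !inE => /orP[]/eqP->; rewrite ?stepsvv.
  have := subset_leq_card (_ : [set v; y] \subset high v m).
  by rewrite cards2 eq_sym yv'; apply; apply/subsetP => u; rewrite !inE => /orP[]/eqP->; rewrite ?eqxx ?yv ?mn ?orbT.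
- have cv u : conn (halves v m) v u.
    have [h|h] := leqP (d v u) (d v m).
      by apply: (conn_edge lE) => //; rewrite inE.
    by apply: (conn_edge hE) => //; rewrite inE h orbT.
  by move=> u w; have := cv u; rewrite conn_sym => uv; apply: conn_trans uv (cv w).
- move=> e u w eE ue we.
  have meet f : f \in halves v m -> f != e -> u \in f -> u = v.
    move: eE ue; rewrite !inE => /orP[]/eqP-> ue /orP[]/eqP-> ; rewrite ?eqxx // => _.
      by apply: low_high.
    by move=> uf; apply: low_high uf ue.
  have meetw f : f \in halves v m -> f != e -> w \in f -> w = v.
    move: eE we; rewrite !inE => /orP[]/eqP-> we /orP[]/eqP-> ; rewrite ?eqxx // => _.
      by apply: low_high.
    by move=> uf; apply: low_high uf we.
  move=> uw; have [//|nuw] := eqVneq u w.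
  have step a b : a != b -> conn (halves v m :\ e) a b ->
      exists f, [/\ f \in halves v m, f != e & a \in f].
    move=> ab cab.
    have /existsP[f /and3P[? ? ?]] : [exists f, [&& f \in halves v m, f != e & a \in f]];
      last by exists f.
    apply: contraT; rewrite negb_exists => /forallP h.
    have := @conn_const _ (halves v m :\ e) a (fun z => z == a) _ b cab.
    rewrite eqxx [b == a]eq_sym (negbTE ab) => <- //.
    move=> f x1 y1; rewrite in_setD1 => /andP[fe fh] x1f y1f _.
    have := h f; rewrite fh fe /= => naf.
    have xa : x1 != a by apply: contraNneq naf => <-.
    have ya : y1 != a by apply: contraNneq naf => <-.
    by rewrite (negbTE xa) (negbTE ya).
  have [f [fh fe uf]] := step u w nuw uw.
  have wu : conn (halves v m :\ e) w u by rewrite conn_sym.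
  have nwu : w != u by rewrite eq_sym.
  have [g [gh ge wg]] := step w u nwu wu.
  by rewrite (meet f) // (meetw g).
- have nc : noncrossing_sets (low v m) (high v m).
    move=> a b c z; rewrite !inE => am cm bh zh; apply/negP => cr.
    have h1 : (b == v) || (d v a < d v b) && (d v c < d v b).
      by case/orP: bh => [->//|bm]; rewrite (leq_ltn_trans am bm) (leq_ltn_trans cm bm) orbT.
    have h2 : (z == v) || (d v a < d v z) && (d v c < d v z).
      by case/orP: zh => [->//|bm]; rewrite (leq_ltn_trans am bm) (leq_ltn_trans cm bm) orbT.
    have bz : b != z.
      apply: contraTneq cr => ->; rewrite /cross; apply/negP => /andP[/andP[_ l1] l2].
      by have := ltn_trans l1 l2; rewrite ltnn.
    case/orP: h1 => [/eqP Eb|/andP[]]; case/orP: h2 => [/eqP Ez|/andP[]].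
    - by move: bz; rewrite Eb Ez eqxx.
    - move: cr; rewrite Eb; clear=> ? ? ?; cyc v.
    - move: cr; rewrite Ez; clear=> ? ? ?; cyc v.
    - move: cr; clear=> ? ? ? ? ?; cyc v.
  move=> e f; rewrite !inE => /orP[]/eqP-> /orP[]/eqP->; rewrite ?eqxx // => _.
  exact: noncrossing_sets_sym.
Qed.

(** The two hyperedges share a vertex v, and around the rest of the polygon they
    cannot alternate. *)
Lemma noncrossing_tree_two sigma : noncrossing_tree sigma -> #|sigma| = 2%N ->
  exists v m, proper_cut v m /\ sigma = halves v m.
Proof.
move=> nt /eqP/cards2P[A [B [AB E]]]; have [hh ct ft nc] := nt.
have As : A \in sigma by rewrite E !inE eqxx.
have Bs : B \in sigma by rewrite E !inE eqxx orbT.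
have two e : e \in sigma -> e = A \/ e = B.
  by rewrite E !inE => /orP[]/eqP->; [left|right].
have cover u : (u \in A) || (u \in B).
  have [w wu] : exists w, w != u.
    have [w] := first_vertex u; exists w; rewrite -steps_gt0; lia.
  apply: contraNT wu; rewrite negb_or => /andP[uA uB].
  have := @conn_const _ sigma u (fun z => z == u) _ w (ct u w).
  rewrite eqxx => <- // e x y es xe ye _.
  have ue : u \notin e by case: (two e es) => ->.
  have xu : x != u by apply: contraNneq ue => <-.
  have yu : y != u by apply: contraNneq ue => <-.
  by rewrite (negbTE xu) (negbTE yu).
have /existsP[v /andP[vA vB]] : [exists v, (v \in A) && (v \in B)].
  apply: contraT; rewrite negb_exists => /forallP h.
  have [a aA _] := edge_other ord0 hh As; have [b bB _] := edge_other ord0 hh Bs.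
  have := @conn_const _ sigma a (fun z => z \in A) _ b (ct a b).
  have nb : b \notin A by have := h b; rewrite bB andbT.
  rewrite aA (negbTE nb) => <- // e x y es xe ye _.
  case: (two e es) => Ee; rewrite Ee in xe ye; first by rewrite xe ye.
  by have := h x; have := h y; rewrite xe ye !andbT => /negbTE-> /negbTE->.
have meet u : u \in A -> u \in B -> u = v.
  by move=> uA uB; apply: forest_meet ft As Bs AB uA vA uB vB.
have [u1 u1v] := first_vertex v.
wlog u1A : A B AB E As Bs two cover vA vB meet / u1 \in A.
  move=> hw; case/orP: (cover u1) => [h|u1B].
    exact: (hw A B AB E As Bs two cover vA vB meet h).
  have BA : B != A by rewrite eq_sym.
  have E' : sigma = [set B; A] by rewrite setUC.
  apply: (hw B A BA E' Bs As) => //.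
  - by move=> e /two[]; [right|left].
  - by move=> u; rewrite orbC.
  - by move=> u uB uA; apply: meet.
case: (@arg_maxnP _ u1 (mem A) (fun u => d v u) u1A) => m mA mmax.
have Alow u : d v u <= d v m -> u \in A.
  move=> um; apply: contraT => uA.
  have uB : u \in B by have := cover u; rewrite (negbTE uA).
  have uv : u != v by apply: contraNneq uA => ->.
  have uu1 : u != u1 by apply: contraNneq uA => ->.
  have um' : u != m by apply: contraNneq uA => ->.
  have := nc A B As Bs AB u1 u m v u1A mA uB vB.
  by move: u1v um uv uu1 um'; clear=> *; cyc v.
have lowA u : u \in A -> d v u <= d v m by move/mmax.
have u1v' : u1 != v by rewrite -steps_gt0 u1v.
exists v, m; split.
  apply/andP; split; first by have /= := lowA u1 u1A; rewrite u1v.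
  have [b bB bv] := edge_other v hh Bs.
  rewrite ltnNge; apply/negP => nm; move: bv; rewrite (meet b) ?eqxx //.
  by apply: Alow; apply: leq_trans nm; apply: steps_le.
rewrite E; congr (_ :|: _); congr set1; apply/setP => u; rewrite !inE.
  by apply/idP/idP => [/lowA|/Alow].
apply/idP/orP => [uB|[/eqP->//|um]].
  case: (eqVneq u v) => uv; [by left|right]; rewrite ltnNge; apply/negP => /Alow uA.
  by move: uv; rewrite (meet u) ?eqxx.
have := cover u; case/orP => // /lowA; rewrite leqNgt um //.
Qed.

End Halves.

(** * Hypertrees from chains of partitions *)

Section TreeOfChain.
Variable n : nat.
Notation V := 'I_n.+1.
Notation d := (@clockwise_steps n).
Implicit Types (u v w x y z a b c m : V) (e f : {set V}) (S T tau : hypergraph n).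
Implicit Types (s : seq {set V}) (q : rel V).

Lemma conn_merge S x y u w : conn ([set x; y] |: S) u w ->
  conn S u w || ((conn S x u || conn S y u) && (conn S x w || conn S y w)).
Proof.
pose K u := conn S x u || conn S y u.
have KS a b : conn S a b -> K a -> K b.
  by move=> ab /orP[]h; rewrite /K (conn_trans h ab) ?orbT.
apply: (conn_sub (r := fun u w => conn S u w || (K u && K w))).
- by move=> a; rewrite conn_refl.
- move=> b a c /orP[ab|/andP[Ka Kb]] /orP[bc|/andP[Kb' Kc]].
  + by rewrite (conn_trans ab bc).
  + by rewrite Kc (KS b) ?orbT // conn_sym.
  + by rewrite Ka (KS b) ?orbT // conn_sym.
  + by rewrite Ka Kc orbT.
- move=> e a b; rewrite in_setU1 => /orP[/eqP->|eS ae be].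
    rewrite !inE => /orP[]/eqP-> /orP[]/eqP->; rewrite /K !conn_refl ?orbT //=.
  by rewrite (conn_edge eS ae be).
Qed.

(** The conditions on the distances make the new edge the last one at each of its
    ends, as a proper ordering requires. *)
Definition merging_edge S e : Prop := exists x y,
  [/\ e = [set x; y], ~~ conn S x y,
      forall u, conn S x u -> u != x -> d x u < d x y,
      forall u, conn S y u -> u != y -> d y u < d y x
    & noncrossing_rel (conn (e |: S))].

Definition merging_seq s : Prop := forall j, j < size s ->
  merging_edge (prefix_edges s j) (nth set0 s j).

(** Let y be the successor of a in its q-block and x its successor in its
    block of S, where the two differ: the edge xy enters the gap before x and
    the gap before y, so that it comes last at both of its ends. *)
Lemma merging_edge_exists S q : reflexive q -> symmetric q -> transitive q ->
  noncrossing_rel (conn S) -> noncrossing_rel q -> (forall u w, conn S u w -> q u w) ->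
  (exists u w, q u w /\ ~~ conn S u w) ->
  exists e, merging_edge S e /\ forall u w, conn (e |: S) u w -> q u w.
Proof.
move=> qr qs qt ncS ncq sub [u0 [w0 [quw nuw]]].
pose P (p : V * V) := q p.1 p.2 && ~~ conn S p.1 p.2.
have P0 : P (u0, w0) by rewrite /P quw.
case: (arg_minnP (fun p : V * V => d p.1 p.2) P0) => -[a y] /andP[/= qay nay] amin.
have {amin}gap u : q a u -> ~~ (0 < d a u < d a y).
  move=> qau; apply/negP => /andP[u0' uy]; have [Sau|nau] := boolP (conn S a u); last first.
    by have := amin (a, u); rewrite /P /= qau nau leqNgt uy => /(_ isT).
  have quy : q u y by apply: (qt a) => //; rewrite qs.
  have := amin (u, y); rewrite /P /= quy.
  have -> : ~~ conn S u y by apply: contra nay; apply: conn_trans Sau.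
  by move=> /(_ isT); move: u0' uy; clear=> *; cyc a.
case: (arg_maxnP (fun x => d x a) (conn_refl S a)) => x Sax xmax.
have qax := sub _ _ Sax.
have nxy : ~~ conn S x y.
  by apply: contra nay; apply: conn_trans Sax.
have ya : y != a by apply: contraNneq nay => ->; apply: conn_refl.
have xy : x != y by apply: contraNneq nxy => ->; apply: conn_refl.
have gx := gap x qax.
exists [set x; y]; split; last first.
  apply: conn_sub => // e u w; rewrite in_setU1 => /orP[/eqP->|eS ue we]; last first.
    by apply: sub; apply: conn_edge eS ue we.
  have qxy : q x y by apply: (qt a) => //; rewrite qs.
  by rewrite !inE => /orP[]/eqP-> /orP[]/eqP-> //; rewrite qs.
have nyu u : conn S y u -> ~~ conn S a u.
  move=> yu; apply: contra nay => au; rewrite conn_sym in yu.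
  exact: conn_trans au yu.
exists x, y; split=> //.
- move=> u xu ux; have /xmax /= := conn_trans Sax xu.
  by move: ux ya xy gx; clear=> ? ? ? ? ?; cyc a.
- move=> u yu uy; have nau := nyu u yu.
  have qau : q a u := qt _ _ _ qay (sub _ _ yu).
  have ua : u != a by apply: contraNneq nau => ->; apply: conn_refl.
  have ux : u != x by apply: contraNneq nau => ->.
  have gu := gap u qau.
  have ncr : ~~ cross a y x u.
    by apply: contra nay => cr; apply: ncS cr Sax yu.
  by move: uy ya xy gx ua ux gu ncr; clear=> *; cyc a.
- pose K u := conn S x u || conn S y u.
  have Ka : K a by rewrite /K conn_sym Sax.
  (* the chord uw of a third block leaves both merged blocks, and the pair a, y,
     on one side *)
  have sep b b' u w : conn S b b' -> conn S u w -> ~~ conn S b u ->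
      (d u b < d u w) = (d u b' < d u w).
    move=> bb uw nbu.
    have hne b1 u1 : conn S b b1 -> conn S u u1 -> b1 != u1.
      move=> h1 h2; apply: contraNneq nbu => E.
      by apply: conn_trans h1 _; rewrite conn_sym E.
    have := hne b u (conn_refl S b) (conn_refl S u).
    have := hne b w (conn_refl S b) uw.
    have := hne b' u bb (conn_refl S u); have := hne b' w bb uw.
    have nub : ~~ conn S u b by rewrite conn_sym.
    have nub' : ~~ conn S u b'.
      by apply: contra nub => h; apply: conn_trans h _; rewrite conn_sym.
    have : ~~ cross u b w b' by apply: contra nub => cr; apply: ncS cr uw bb.
    have : ~~ cross u b' w b.
      by apply: contra nub' => cr; apply: ncS cr uw _; rewrite conn_sym.
    by clear=> ? ? ? ? ? ?; cyc u.
  have nK u w : conn S u w -> ~~ K u -> (d u a < d u w) = (d u y < d u w).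
    rewrite negb_or => uw /andP[nxu nyu'].
    have nau : ~~ conn S a u by apply: contra nxu; apply: conn_trans; rewrite conn_sym.
    have ne b : conn S y b || conn S a b -> b != u /\ b != w.
      move=> h; split; apply/eqP => E; move: h; rewrite E.
        by rewrite (negbTE nyu') (negbTE nau).
      by case/orP => h; [move: nyu'|move: nau]; rewrite (conn_trans h) // conn_sym.
    have [|yu' yw] := ne y; first by rewrite conn_refl.
    have [|au' aw] := ne a; first by rewrite conn_refl orbT.
    have [qau|nqau] := boolP (q a u).
      have gu := gap u qau; have gw := gap w (qt _ _ _ qau (sub _ _ uw)).
      by move: yu' yw au' aw gu gw ya; clear=> *; cyc a.
    have nquy : ~~ q u y by apply: contra nqau => h; apply: qt qay _; rewrite qs.
    have nqua : ~~ q u a by rewrite qs.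
    have quw' := sub _ _ uw.
    have : ~~ cross u a w y by apply: contra nqua => cr; apply: ncq cr quw' qay.
    have : ~~ cross u y w a by apply: contra nquy => cr; apply: ncq cr quw' _; rewrite qs.
    by move: yu' yw au' aw ya; clear=> ? ? ? ? ? ? ?; cyc u.
  have core b b' u w : K b -> K b' -> conn S u w -> ~~ K u ->
      (d u b < d u w) = (d u b' < d u w).
    suff hw b1 : K b1 -> conn S u w -> ~~ K u -> (d u b1 < d u w) = (d u a < d u w).
      by move=> Kb Kb' uw nu; rewrite !hw.
    move=> Kb uw nu; have := nu; rewrite negb_or => /andP[nxu nyu'].
    case/orP: Kb => h.
      rewrite -(sep x b1 u w) // (sep x a u w) //; by rewrite conn_sym.
    by rewrite -(sep y b1 u w) // -(nK u w).
  have merged a' b' : K a' -> K b' -> conn ([set x; y] |: S) a' b'.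
    have Kx a1 : K a1 -> conn ([set x; y] |: S) x a1.
      case/orP => h; first exact: connS (subsetUr _ _) h.
      apply: conn_trans (connS (subsetUr _ _) h).
      by apply: (conn_edge (e := [set x; y])); rewrite !inE eqxx ?orbT.
    by move=> /Kx h1 /Kx h2; rewrite conn_sym in h1; apply: conn_trans h1 h2.
  move=> b1 b2 b3 b4 cr /conn_merge/orP[h13|/andP[K1 K3]] /conn_merge/orP[h24|/andP[K2 K4]].
  + by apply: connS (subsetUr _ _) _; apply: ncS cr h13 h24.
  + have [K1|nK1] := boolP (K b1); first exact: merged.
    by have := core b2 b4 b1 b3 K2 K4 h13 nK1; move: cr; clear=> ? ?; cyc b1.
  + have [K2|nK2] := boolP (K b2); first exact: merged.
    by have := core b1 b3 b2 b4 K1 K3 h24 nK2; move: cr; clear=> ? ?; cyc b2.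
  + exact: merged.
Qed.

Lemma prefix_size s : prefix_edges s (size s) = [set e in s].
Proof. by rewrite /prefix_edges take_size. Qed.

Lemma prefix_cat s s' j : j <= size s -> prefix_edges (s ++ s') j = prefix_edges s j.
Proof. by move=> h; rewrite /prefix_edges takel_cat. Qed.

Lemma merging_rcons s e : merging_seq s -> merging_edge [set e in s] e ->
  merging_seq (rcons s e).
Proof.
move=> ms me j; rewrite size_rcons ltnS nth_rcons => js.
rewrite -cats1 prefix_cat //; case: ltngtP js => // [js _|-> _].
  exact: ms.
by rewrite prefix_size.
Qed.

Lemma merging_nc s : merging_seq s -> noncrossing_rel (conn [set e in s]).
Proof.
case/lastP: s => [|s e] ms.
  move=> a b c z cr ac _; suff E : a = c by move: cr; rewrite E /cross stepsvv andbF.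
  by apply: conn0; apply: connS ac; apply/subsetP => e; rewrite inE.
have := ms (size s); rewrite size_rcons ltnSn nth_rcons ltnn eqxx => /(_ isT)[x [y [_ _ _ _]]].
rewrite -cats1 prefix_cat // prefix_size.
suff -> : [set e0 in s ++ [:: e]] = e |: [set e in s] by [].
by apply/setP => f; rewrite !inE mem_cat inE orbC.
Qed.

Lemma merging_reach s q : reflexive q -> symmetric q -> transitive q -> noncrossing_rel q ->
  merging_seq s -> (forall u w, conn [set e in s] u w -> q u w) ->
  exists s', merging_seq (s ++ s') /\ conn [set e in s ++ s'] =2 q.
Proof.
move=> qr qs qt ncq.
move: {2}(#|_|) (leqnn #|[set p | q p.1 p.2 && ~~ conn [set e in s] p.1 p.2]|) => k.
elim: k s => [|k IH] s hk ms sub.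
  exists [::]; rewrite cats0; split=> // u w; apply/idP/idP => [/sub//|quw].
  apply/negPn/negP => nuw; move: hk; rewrite leqNgt card_gt0 => /negP; apply.
  by apply/set0Pn; exists (u, w); rewrite inE /= quw.
have [h0|] := leqP #|[set p | q p.1 p.2 && ~~ conn [set e in s] p.1 p.2]| 0.
  by apply: IH => //; apply: leq_trans h0 _.
rewrite card_gt0 => /set0Pn[[u w]]; rewrite inE /= => /andP[quw nuw].
have [|e [me sube]] := merging_edge_exists qr qs qt (merging_nc ms) ncq sub.
  by exists u, w.
have E : [set e0 in rcons s e] = e |: [set e in s].
  by apply/setP => f; rewrite !inE mem_rcons inE.
have [||| s' [ms' hs']] := IH (rcons s e).
- rewrite -ltnS; apply: leq_trans hk; apply: proper_card; apply/properP; split.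
    apply/subsetP => -[u1 w1]; rewrite !inE /= => /andP[-> /=]; apply: contra.
    by rewrite E; apply: connS; apply: subsetUr.
  case: me => x [y [exy nxy _ _ _]]; exists (x, y).
    rewrite inE /= nxy andbT; apply: sube; apply: (conn_edge (e := e)).
    + by rewrite !inE eqxx.
    + by rewrite exy !inE eqxx.
    + by rewrite exy !inE eqxx orbT.
  rewrite inE /= negb_and negbK E orbC (conn_edge (e := e)) //.
    + by rewrite !inE eqxx.
    + by rewrite exy !inE eqxx.
    + by rewrite exy !inE eqxx orbT.
- exact: merging_rcons.
- by move=> u1 w1; rewrite E; apply: sube.
- by exists (e :: s'); rewrite -cat_rcons.
Qed.

Lemma merging_chain (c : seq (rel V)) s :
  (forall i, i < size c -> let q := nth (fun _ _ => true) c i in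
     [/\ reflexive q, symmetric q, transitive q & noncrossing_rel q]) ->
  (forall i j u w, i <= j -> j < size c -> nth (fun _ _ => true) c i u w -> nth (fun _ _ => true) c j u w) ->
  merging_seq s ->
  (forall u w, conn [set e in s] u w -> nth (fun _ _ => true) c 0 u w) ->
  exists s', [/\ merging_seq (s ++ s'), (forall u w, conn [set e in s ++ s'] u w) &
    forall i, i < size c -> exists j, conn (prefix_edges (s ++ s') j) =2 nth (fun _ _ => true) c i].
Proof.
elim: c s => [|q c IH] s hq hm ms sub.
  have [s' [ms' hs']] := @merging_reach s (fun _ _ => true) (fun=> erefl)
    (fun _ _ => erefl) (fun _ _ _ _ _ => erefl) (fun _ _ _ _ _ _ _ => erefl) ms
    (fun _ _ _ => erefl).
  by exists s'; split=> // u w; rewrite hs'.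
have [qr qs qt qnc] := hq 0 isT.
have [s1 [ms1 hs1]] := merging_reach qr qs qt qnc ms sub.
have [||u w|s' [ms' ct hs']] := IH (s ++ s1) _ _ ms1.
- by move=> i ic; apply: (hq i.+1).
- by move=> i j u w ij jc; apply: (hm i.+1 j.+1).
- rewrite hs1; case: (c) hm => [//|q' c'] hm /=; exact: (hm 0 1).
exists (s1 ++ s'); rewrite catA; split=> // -[_|i ic]; last exact: hs'.
exists (size (s ++ s1)); rewrite prefix_cat // prefix_size; exact: hs1.
Qed.

Lemma merging_seq_uniq s : merging_seq s -> uniq s.
Proof.
elim/last_ind: s => [//|s e IH] ms; rewrite rcons_uniq; apply/andP; split.
  have := ms (size s); rewrite size_rcons ltnSn nth_rcons ltnn eqxx => /(_ isT)[x [y [exy nxy _ _ _]]].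
  apply: contra nxy => es; apply: (conn_edge (e := e)).
  - by rewrite -cats1 prefix_cat // prefix_size inE.
  - by rewrite exy !inE eqxx.
  - by rewrite exy !inE eqxx orbT.
apply: IH => j js; have := ms j; rewrite size_rcons nth_rcons js => /(_ (ltnW js)).
by rewrite -cats1 prefix_cat // ltnW.
Qed.

Lemma merging_seq_lt s i j : merging_seq s -> i < j -> j < size s ->
  nth set0 s i \in prefix_edges s j.
Proof.
move=> ms ij js; rewrite /prefix_edges inE in_take; last by rewrite mem_nth // (ltn_trans ij).
by rewrite index_uniq // ?(ltn_trans ij) // merging_seq_uniq.
Qed.

(** A simple cycle is impossible because its last edge would join two vertices
    that the other edges have already connected. *)
Lemma merging_seq_tree s : merging_seq s ->
  (forall u w, conn [set e in s] u w) ->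
  noncrossing_tree [set e in s] /\ proper_ordering [set e in s] s.
Proof.
move=> ms ct; have us := merging_seq_uniq ms; set tau := [set e in s].
have mE e : e \in tau -> exists2 j, j < size s & e = nth set0 s j.
  by rewrite inE => es; exists (index e s); rewrite ?index_mem // nth_index.
have ncE i j : i < j -> j < size s -> noncrossing_sets (nth set0 s i) (nth set0 s j).
  move=> ij js; have eS := merging_seq_lt ms ij js.
  have [x [y [exy nxy hx hy hnc]]] := ms j js.
  set S := prefix_edges s j in eS nxy hx hy hnc.
  apply: noncrossing_sets_sym => a b c z; rewrite exy => ae ce be ze; apply/negP => cr.
  have bz : conn S b z := conn_edge eS be ze.
  have key x1 y1 b1 z1 : (forall u, conn S x1 u -> u != x1 -> d x1 u < d x1 y1) ->
      conn S x1 b1 -> conn S b1 z1 -> cross x1 b1 y1 z1 -> False.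
    move=> h xb bz1 cr1; have := h z1 (conn_trans xb bz1).
    case/andP: cr1 => /andP[l1 l2] l3.
    rewrite -steps_gt0 (ltn_trans l1 (ltn_trans l2 l3)).
    by move=> /(_ isT); rewrite ltnNge ltnW.
  have symm x1 y1 b1 z1 : (forall u, conn S y1 u -> u != y1 -> d y1 u < d y1 x1) ->
      conn S y1 b1 -> conn S b1 z1 -> cross x1 b1 y1 z1 -> False.
    move=> h yb bz1 cr1; apply: (key y1 x1 z1 b1) => //.
    - exact: conn_trans bz1.
    - by rewrite conn_sym.
    - by apply: cross_rot; apply: cross_rot.
  have main x1 y1 : (forall u, conn S x1 u -> u != x1 -> d x1 u < d x1 y1) ->
     (forall u, conn S y1 u -> u != y1 -> d y1 u < d y1 x1) ->
     [set x1; y1] = [set x; y] -> cross x1 b y1 z -> False.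
    move=> h1 h2 E cr1.
    have : conn (nth set0 s j |: S) x1 b.
      apply: hnc cr1 _ _; last exact: connS (subsetUr _ _) bz.
      by apply: (conn_edge (e := nth set0 s j)); rewrite ?exy -?E !inE eqxx ?orbT.
    rewrite exy -E => /conn_merge/orP[|/andP[_ /orP[]]] h; [exact: key h1 h bz cr1|exact: key h1 h bz cr1|].
    exact: symm h2 h bz cr1.
  move: ae ce cr; rewrite !inE => /orP[]/eqP-> /orP[]/eqP->.
  - by rewrite /cross stepsvv; lia.
  - exact: main.
  - by apply: main => //; rewrite setUC.
  - by rewrite /cross stepsvv; lia.
have hyp : is_hypergraph tau.
  move=> e /mE[j js ->]; have [x [y [-> nxy _ _ _]]] := ms j js.
  by rewrite cards2; case: eqP nxy => // ->; rewrite conn_refl.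
split; first split=> //.
- apply: no_cycle_forest => -[k [v [e [k2 vi ei h]]]].
  have k0 : 0 < k by lia.
  pose i0 := Ordinal k0.
  case: (@arg_maxnP _ i0 predT (fun i => index (e i) s) isT) => i _ imax.
  have [eit vie vSie] := h i.
  have [j js eE] := mE _ eit.
  have ji : index (e i) s = j by rewrite eE index_uniq.
  have := @cycle_conn _ k v e (prefix_edges s j) i
            (fun j => let: And3 _ p q := h j in conj p q).
  move=> H; have {H}vv : conn (prefix_edges s j) (v (ordS i)) (v i).
    apply: H => i' ii'; have [eit' _ _] := h i'.
    have es : e i' \in s by move: eit'; rewrite inE.
    have /= le := imax i' isT.
    rewrite /prefix_edges inE in_take // ltn_neqAle -{2}ji le andbT.
    apply: contra ii' => /eqP E; apply/eqP/ei.
    by rewrite eE -(nth_index set0 es) E.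
  have neq : v (ordS i) != v i.
    apply/eqP => /vi /(congr1 val) /=; have := ltn_ord i.
    have [lt|ge] := ltnP i.+1 k; first by rewrite modn_small //; lia.
    by move=> ik; rewrite (_ : i.+1 = k) ?modnn; lia.
  have [x [y [exy nxy _ _ _]]] := ms j js.
  move: nxy vv neq; move: vie vSie; rewrite eE exy !inE => /orP[]/eqP-> /orP[]/eqP->; rewrite ?eqxx //.
    by rewrite conn_sym => /negbTE->.
  by move=> /negbTE->.
- move=> e f /mE[i is' ->] /mE[j js ->] ef; have [ij|ij|ij] := ltngtP i j.
  + exact: ncE.
  + by apply: noncrossing_sets_sym; apply: ncE.
  + by move: ef; rewrite ij eqxx.
split.
  apply: uniq_perm => //; first exact: enum_uniq.
  by move=> e; rewrite mem_enum inE.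
move=> e0 f0 _ _; apply: (connect_homo (k := fun e => index e s)) => f e fe.
have /local_ltP[ft et nfe [v [vf ve h]]] := fe.
rewrite leqNgt; apply/negP => lt.
have [j js eE] := mE _ ft; have [i is' fE] := mE _ et.
have ij : i < j by move: lt; rewrite eE fE !index_uniq.
have eS := merging_seq_lt ms ij js; rewrite -fE in eS.
have [x [y [exy nxy hx hy _]]] := ms j js.
have [w we wv] := edge_other v hyp et.
have [w' wf wv'] := edge_other v hyp ft.
have := h w' w wf wv' we wv; have vw := conn_edge eS ve we.
move: vf wf; rewrite eE exy !inE => /orP[]/eqP E /orP[]/eqP E'.
- by move: wv'; rewrite E' E eqxx.
- by rewrite ltnNge ltnW // E E' hx -?E.
- by rewrite ltnNge ltnW // E E' hy -?E.
- by move: wv'; rewrite E' E eqxx.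
Qed.
End TreeOfChain.

(** * Partitions and their predecessor maps *)

Section Partitions.
Variable n : nat.
Notation V := 'I_n.+1.
Notation d := (@clockwise_steps n).
Implicit Types (u v w x y z a b c m : V) (e f A B : {set V}) (S T P Q tau : hypergraph n).
Implicit Types (r q : rel V).

Definition is_partition P : bool := finset.partition P [set: V].

Definition is_equivalence r : Prop := [/\ reflexive r, symmetric r & transitive r].

Lemma conn_eqv S : is_equivalence (conn S).
Proof. by split; [exact: conn_refl|exact: conn_sym|exact: conn_trans]. Qed.

Lemma part_same P A B u : is_partition P -> A \in P -> B \in P -> u \in A -> u \in B -> A = B.
Proof.
case/and3P=> _ tP _ AP BP uA uB; apply/eqP/negPn/negP => AB.
by have /disjoint_setI0/setP/(_ u) := trivIsetP tP A B AP BP AB; rewrite !inE uA uB.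
Qed.

Lemma part_block P u : is_partition P -> exists2 A, A \in P & u \in A.
Proof.
case/and3P=> /eqP cP _ _; have : u \in cover P by rewrite cP inE.
by case/bigcupP => A; exists A.
Qed.

Lemma adjacent_eqv P : is_partition P -> is_equivalence (adjacent P).
Proof.
move=> pP; split; last 2 first; [exact: adjacent_sym| | ].
  move=> v u w /adjacentP[A [AP uA vA]] /adjacentP[B [BP vB wB]].
  by apply/adjacentP; exists A; rewrite {3}(part_same pP AP BP vA vB).
by move=> u; have [A AP uA] := part_block u pP; apply/adjacentP; exists A.
Qed.

Lemma adjacent_components S : adjacent (components S) =2 conn S.
Proof.
move=> u v; apply/adjacentP/idP => [[A [/imsetP[x _ ->]]]|uv].
  rewrite !inE /= -!/(conn S _ _) => xu; rewrite conn_sym in xu; exact: conn_trans.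
exists [set y in [set: V] | connect (adjacent S) u y]; split.
- by apply/imsetP; exists u.
- by rewrite !inE connect0.
- by rewrite !inE.
Qed.

Lemma components_part S : is_partition (components S).
Proof.
apply: equivalence_partitionP => u v w _ _ _; have [rr rs rt] := conn_eqv S.
split; first exact: rr.
move=> uv; have vu : conn S v u by rewrite conn_sym.
by apply/idP/idP; [exact: (conn_trans vu)|exact: (conn_trans uv)].
Qed.

Lemma refinesP P Q : is_partition P -> is_partition Q ->
  reflect (forall u v, adjacent P u v -> adjacent Q u v) (refines P Q).
Proof.
move=> pP pQ; apply: (iffP forallP) => [h u v /adjacentP[A [AP uA vA]]|h A].
  have /implyP/(_ AP)/'exists_andP[B [BQ /subsetP AB]] := h A.
  by apply/adjacentP; exists B; rewrite !AB.
apply/implyP => AP; have /and3P[_ _ n0] := pP.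
have /set0Pn[u uA] : A != set0 by apply: contraNneq n0 => <-.
have [B BQ uB] := part_block u pQ.
apply/'exists_andP; exists B; split=> //; apply/subsetP => v vA.
have /adjacentP[B' [B'Q uB' vB']] : adjacent Q u v.
  by apply: h; apply/adjacentP; exists A.
by rewrite (part_same pQ BQ B'Q uB uB').
Qed.

Lemma part_ext P Q : is_partition P -> is_partition Q -> adjacent P =2 adjacent Q -> P = Q.
Proof.
suff h P' Q' : is_partition P' -> is_partition Q' -> adjacent P' =2 adjacent Q' -> {subset P' <= Q'}.
  move=> pP pQ E; apply/setP => A; apply/idP/idP; apply: h => //.
move=> pP' pQ' E A AP; have /and3P[_ _ n0] := pP'.
have /set0Pn[u uA] : A != set0 by apply: contraNneq n0 => <-.
have [B BQ uB] := part_block u pQ'.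
suff -> : A = B by [].
apply/setP => v; apply/idP/idP => h.
  have : adjacent Q' u v by rewrite -E; apply/adjacentP; exists A.
  by case/adjacentP => B' [B'Q uB' vB']; rewrite (part_same pQ' BQ B'Q uB uB').
have : adjacent P' u v by rewrite E; apply/adjacentP; exists B.
by case/adjacentP => A' [A'P uA' vA']; rewrite (part_same pP' AP A'P uA uA').
Qed.

Lemma components_id P : is_partition P -> components P = P.
Proof.
move=> pP; apply: (part_ext (components_part P) pP) => u v.
rewrite adjacent_components; have [rr rs rt] := adjacent_eqv pP.
apply/idP/idP => [|h]; last exact: connect1.
by apply: conn_sub => // e x y eP xe ye; apply/adjacentP; exists e.
Qed.

Lemma ordering_chain_part (s : seq {set V}) P : P \in ordering_chain s -> is_partition P.
Proof. by case/mapP => j _ ->; apply: components_part. Qed.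

Lemma ordering_chain_comparable (s : seq {set V}) P Q :
  P \in ordering_chain s -> Q \in ordering_chain s -> refines P Q || refines Q P.
Proof.
case/mapP => i _ -> /mapP[j _ ->].
have rf k l : k <= l -> refines (components (prefix_edges s k)) (components (prefix_edges s l)).
  move=> kl; apply/refinesP; try exact: components_part.
  by move=> u v; rewrite !adjacent_components; apply: connS; apply: prefix_mono.
by case/orP: (leq_total i j) => /rf h; rewrite -!/(prefix_edges _ _) h ?orbT.
Qed.

Lemma discrete_part : is_partition (discrete_partition n).
Proof.
apply/and3P; split.
- rewrite eqEsubset subsetT; apply/subsetP => u _; apply/bigcupP.
  by exists [set u]; rewrite ?inE //; apply/imsetP; exists u.
- apply/trivIsetP => A B /imsetP[u _ ->] /imsetP[v _ ->] uv.
  rewrite disjoints1 inE; apply: contra uv => /eqP-> //.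
- apply/negP => /imsetP[u _ /setP/(_ u)]; by rewrite !inE eqxx.
Qed.

Lemma one_block_part : is_partition (one_block_partition n).
Proof.
apply/and3P; split.
- by rewrite /cover big_set1.
- by apply/trivIsetP => A B; rewrite !inE => /eqP-> /eqP->; rewrite eqxx.
- by rewrite inE eq_sym -card_gt0 cardsT card_ord.
Qed.

Lemma adjacent_discrete u v : adjacent (discrete_partition n) u v = (u == v).
Proof.
apply/adjacentP/eqP => [[A [/imsetP[w _ ->]]]|->].
  by rewrite !inE => /eqP-> /eqP->.
by exists [set v]; rewrite !inE eqxx; split=> //; apply/imsetP; exists v.
Qed.

Lemma adjacent_one_block u v : adjacent (one_block_partition n) u v.
Proof. by apply/adjacentP; exists [set: V]; rewrite !inE. Qed.

Lemma card_discrete : #|discrete_partition n| = n.+1.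
Proof. by rewrite card_imset ?card_ord //; apply: set1_inj. Qed.

Lemma part_card_gt0 P : is_partition P -> 0 < #|P|.
Proof. by move=> pP; have [A AP _] := part_block ord0 pP; rewrite card_gt0; apply/set0Pn; exists A. Qed.

Lemma part_card1 P : is_partition P -> #|P| = 1 -> P = one_block_partition n.
Proof.
move=> pP /eqP/cards1P[A PA]; rewrite /one_block_partition PA; congr [set _].
by have /and3P[/eqP] := pP; rewrite PA /cover big_set1.
Qed.

Lemma part_card_sum P : is_partition P -> \sum_(A in P) #|A| = n.+1.
Proof. by move=> /card_partition <-; rewrite cardsT card_ord. Qed.

Lemma part_block_gt0 P A : is_partition P -> A \in P -> 0 < #|A|.
Proof. by case/and3P=> _ _ n0 AP; rewrite card_gt0; apply: contraNneq n0 => <-. Qed.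

Lemma part_card_le P : is_partition P -> #|P| <= n.+1.
Proof.
move=> pP; rewrite -[leqRHS](part_card_sum pP) -sum1_card; apply: leq_sum => A AP.
exact: part_block_gt0 AP.
Qed.

Lemma part_card_max P : is_partition P -> #|P| = n.+1 -> P = discrete_partition n.
Proof.
move=> pP cP; apply: (part_ext pP discrete_part) => u v; rewrite adjacent_discrete.
have [pr _ _] := adjacent_eqv pP.
apply/idP/idP => [/adjacentP[A [AP uA vA]]|/eqP->//].
have : \sum_(B in P) (#|B| - 1) = 0.
  have := part_card_sum pP; rewrite (eq_bigr (fun B => (#|B| - 1) + 1)); last first.
    by move=> B BP; rewrite subnK // (part_block_gt0 pP BP).
  by rewrite big_split /= sum1_card cP; lia.
move/eqP; rewrite sum_nat_eq0 => /forallP/(_ A); rewrite AP /= subn_eq0 => cA.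
by apply/eqP; apply: (card_le1_eqP cA).
Qed.

Definition proper_part P : Prop :=
  [/\ is_partition P, P <> discrete_partition n & P <> one_block_partition n].

Lemma proper_part_card P : proper_part P -> 1 < #|P| < n.+1.
Proof.
case=> pP nd no; have := part_card_le pP; have := part_card_gt0 pP.
have n1 : #|P| <> 1 by move=> E; apply: no; apply: part_card1.
have n2 : #|P| <> n.+1 by move=> E; apply: nd; apply: part_card_max.
by move=> h1 h2; apply/andP; split; rewrite ltn_neqAle ?h1 ?h2 andbT; apply/eqP; auto.
Qed.

Lemma predecessor_inj r v v' m : is_equivalence r -> predecessor r v m -> predecessor r v' m -> v = v'.
Proof.
move=> [rr rs rt] /predecessorP[rm hm] /predecessorP[rm' hm']; apply/eqP/negPn/negP => vv.
have vv' : r v v' by apply: rt rm _; rewrite rs.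
have v'v : r v' v by rewrite rs.
have := hm v' vv'; have := hm' v v'v; move: vv; clear=> ? ? ?; cyc v.
Qed.

Lemma predecessor_eq r q v m : r =2 q -> predecessor r v m = predecessor q v m.
Proof. by move=> E; rewrite /predecessor E; congr (_ && _); apply: eq_forallb => u; rewrite E. Qed.

Lemma predecessor_mono r q v m m' : (forall u w, r u w -> q u w) -> predecessor r v m -> predecessor q v m' ->
  d v m <= d v m'.
Proof. by move=> sub /predecessorP[rm hm] /predecessorP[qm hm']; apply/hm'/sub. Qed.

(** Following predecessors around a block visits the whole block. *)
Lemma predecessor_ext r q : is_equivalence r -> is_equivalence q -> (forall v m, predecessor r v m -> predecessor q v m) ->
  forall u v, r u v -> q u v.
Proof.
move=> [rr rs rt] [qr qs qt] h u v; have [k] := ubnP (d u v); elim: k u v => // k IH u v.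
rewrite ltnS => le ruv; have [->|uv] := eqVneq u v; first exact: qr.
have [m pm] := predecessor_exists (rr v); have /predecessorP[rm hm] := pm.
have /predecessorP[qm _] := h v m pm.
apply: (qt m); last by rewrite qs.
have rum : r u m by apply: rt rm.
apply: IH => //; apply: leq_trans le.
have mv : m != v.
  apply: contraNneq uv => mv; have := hm u; rewrite rs ruv mv stepsvv leqn0 => /(_ isT).
  by rewrite -[_ == _]negbK -lt0n steps_gt0 negbK.
have := hm u; rewrite rs ruv => /(_ isT); move: mv uv; clear=> ? ? ?; cyc v.
Qed.

Lemma part_prd_ext P Q : is_partition P -> is_partition Q ->
  (forall v m, predecessor (adjacent P) v m -> predecessor (adjacent Q) v m) -> P = Q.
Proof.
move=> pP pQ h; have eP := adjacent_eqv pP; have eQ := adjacent_eqv pQ.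
apply: part_ext => // u v; apply/idP/idP; apply: predecessor_ext => //.
move=> w m pm; have [rr _ _] := eP; have [m' pm'] := predecessor_exists (rr w).
by rewrite (predecessor_uniq pm (h _ _ pm')).
Qed.

(** If every vertex is its own predecessor or follows it immediately, one fixed
    vertex forces all the others, going around the polygon, to be fixed; then P is
    one of the bounding partitions. *)
Lemma proper_part_valid P : proper_part P ->
  exists v m, proper_cut v m /\ predecessor (adjacent P) v m.
Proof.
case=> pP nd no; have [rr rs rt] := adjacent_eqv pP.
have /existsP[v /existsP[m /andP[]]] : [exists v, exists m, proper_cut v m && predecessor (adjacent P) v m];
    last by exists v, m.
apply: contraT; rewrite negb_exists => /forallP h; exfalso.
have triv v m : predecessor (adjacent P) v m -> d v m = 0 \/ d v m = n.
  move=> pm; have /= := h v; rewrite negb_exists => /forallP/(_ m).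
  by rewrite pm andbT /proper_cut; have := steps_le v m; lia.
have inj := predecessor_inj (adjacent_eqv pP).
have [/existsP[v0 pv0]|none] := boolP [exists v, predecessor (adjacent P) v v]; last first.
  apply: no; apply: (part_prd_ext _ one_block_part) => // v m pm.
  have [dm|dm] := triv v m pm.
    have E : m = v by apply: (@steps_inj _ v); rewrite stepsvv.
    by case/existsP: none; exists v; rewrite -{2}E.
  by apply/predecessorP; split=> [|u _]; rewrite ?adjacent_one_block // dm steps_le.
apply: nd; apply/esym; apply: (part_prd_ext discrete_part pP) => v m.
move=> /predecessorP[]; rewrite adjacent_discrete => /eqP <- _.
have [k] := ubnP (d v0 v); elim: k v => // k IH v; rewrite ltnS => le.
have [->//|vv0] := eqVneq v v0.
have [m' pm] := predecessor_exists (rr v); have [dm|dm] := triv v m' pm.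
  by have E : m' = v by [apply: (@steps_inj _ v); rewrite stepsvv]; rewrite E in pm.
have lt : d v0 m' < k by apply: leq_trans le; move: dm vv0; clear=> ? ?; cyc v0.
by have E := inj _ _ _ (IH m' lt) pm; rewrite E in pm.
Qed.

Lemma card_components_merge S x y :
  #|components ([set x; y] |: S)| + ~~ conn S x y = #|components S|.
Proof.
pose cl S u : {set V} := [set w in [set: V] | connect (adjacent S) u w].
have clE T u w : (w \in cl T u) = conn T u w by rewrite !inE.
have cleq T u w : conn T u w -> cl T u = cl T w.
  move=> uw; apply/setP => z; rewrite !clE; apply/idP/idP; last exact: conn_trans.
  by apply: conn_trans; rewrite conn_sym.
have comp T A : (A \in components T) = [exists u, A == cl T u].
  by apply/imsetP/existsP => [[u _ ->]|[u /eqP->]]; exists u.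
set S' := [set x; y] |: S.
have S'xy : conn S' x y.
  by apply: (conn_edge (e := [set x; y])); rewrite !inE eqxx ?orbT.
have sub u w : conn S u w -> conn S' u w by apply: connS; apply: subsetUr.
have [xy|nxy] := boolP (conn S x y).
  rewrite addn0; congr #|pred_of_set _|; apply: part_ext; try exact: components_part.
  move=> u w; rewrite !adjacent_components; apply/idP/idP => [/conn_merge/orP[//|]|]; last exact: sub.
  have K z : conn S x z || conn S y z -> conn S x z by case/orP=> // /(conn_trans xy).
  by case/andP => /K xu /K xw; rewrite conn_sym in xu; apply: conn_trans xu xw.
have clx : cl S' x = cl S x :|: cl S y.
  apply/setP => u; rewrite in_setU !clE; apply/idP/idP.
    case/conn_merge/orP => [->//|/andP[_ //]].
  by case/orP => /sub // h; apply: conn_trans h.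
have oth u : ~~ conn S x u -> ~~ conn S y u -> cl S' u = cl S u.
  move=> xu yu; apply/setP => w; rewrite !clE; apply/idP/idP; last exact: sub.
  by case/conn_merge/orP => //; rewrite (negbTE xu) (negbTE yu).
have EC : components S' = cl S' x |: (components S :\ cl S x :\ cl S y).
  apply/setP => A; rewrite !inE !comp; apply/existsP/orP => [[u /eqP->]|].
    have [xu|xu] := boolP (conn S' x u); first by left; rewrite (cleq _ _ _ xu).
    have nx : ~~ conn S x u by apply: contra xu; apply: sub.
    have ny : ~~ conn S y u by apply: contra xu => /sub; apply: conn_trans.
    right; rewrite oth //; apply/and3P; split; last by apply/existsP; exists u.
      by apply: contraNneq ny => /setP/(_ u); rewrite !clE conn_refl => <-.
    by apply: contraNneq nx => /setP/(_ u); rewrite !clE conn_refl => <-.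
  case=> [/eqP->|/and3P[ny nx /existsP[u /eqP E]]]; first by exists x.
  have nxu : ~~ conn S x u by apply: contra nx => xu; rewrite E (cleq S x u xu).
  have nyu : ~~ conn S y u by apply: contra ny => yu; rewrite E (cleq S y u yu).
  by exists u; rewrite oth ?E.
have inx : cl S x \in components S by rewrite comp; apply/existsP; exists x.
have iny : cl S y \in components S :\ cl S x.
  rewrite in_setD1 comp; apply/andP; split; last by apply/existsP; exists y.
  by apply: contraNneq nxy => /setP/(_ y); rewrite !clE conn_refl => <-.
rewrite EC cardsU1 (cardsD1 (cl S x) (components S)) inx (cardsD1 (cl S y) (_ :\ _)) iny /=.
suff -> : cl S' x \notin components S :\ cl S x :\ cl S y by rewrite addn1.
rewrite !inE; apply/negP => /and3P[_ _]; rewrite comp => /existsP[u /eqP E].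
have := clE S' x x; have := clE S' x y; rewrite E !clE conn_refl S'xy => uy ux.
by move: nxy; rewrite (@conn_trans _ _ u) // conn_sym.
Qed.
End Partitions.

(** * Redundant spokes *)

Section Retraction.
Variables (n : nat) (tau : hypergraph n).
Notation V := 'I_n.+1.
Notation H := (hypergraph n).
Hypothesis nt : noncrossing_tree tau.
Implicit Types (u v w a : V) (e f : {set V}) (S P Q G : H).

Definition hub e : V := odflt ord0 [pick x in e].

(** Replacing each hyperedge by a star spanning it gives an ordinary tree, whose
    edges are listed in an arbitrary order. *)
Definition spokes : seq ({set V} * V) :=
  enum [set q : {set V} * V | (q.1 \in tau) && (q.2 \in q.1 :\ hub q.1)].

Notation m := (size spokes).
Definition spoke i : {set V} * V := nth (set0, ord0) spokes i.
Definition spoke_edge (q : {set V} * V) : {set V} := [set hub q.1; q.2].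
Definition spokes_before i : H := [set spoke_edge q | q in take i spokes].

(** Seeing a partition as the linear span of the differences of basis vectors from
    a common block, this is the retraction of a spherical building onto the
    apartment of the tree of spokes, centred at the chamber given by their
    order. *)
Definition redundant P i : bool :=
  conn (P :|: spokes_before i) (hub (spoke i).1) (spoke i).2.

Lemma hub_in e : e \in tau -> hub e \in e.
Proof.
have [hh _ _ _] := nt; move=> et; rewrite /hub; case: pickP => //= h.
by have [x xe _] := edge_other ord0 hh et; have := h x; rewrite xe.
Qed.

Lemma spokesP q : q \in spokes ->
  [/\ q.1 \in tau, hub q.1 \in q.1, q.2 \in q.1 & q.2 != hub q.1].
Proof.
by rewrite mem_enum inE in_setD1 => /and3P[qt qr q2]; split=> //; apply: hub_in.
Qed.

Lemma spokeP i : i < m ->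
  [/\ (spoke i).1 \in tau, hub (spoke i).1 \in (spoke i).1,
      (spoke i).2 \in (spoke i).1 & (spoke i).2 != hub (spoke i).1].
Proof. by move=> im; apply/spokesP/mem_nth. Qed.

(** The other hyperedges do not connect the ends of the spoke, and the earlier
    spokes of the same star only reach other vertices of the hyperedge. *)
Lemma independent_spoke S i : i < m -> S \subset tau -> (spoke i).1 \notin S ->
  ~~ conn (S :|: spokes_before i) (hub (spoke i).1) (spoke i).2.
Proof.
move=> im St; case E : (spoke i) => [e u] /= eS; have [hh ct ft _] := nt.
have := spokeP im; rewrite E /= => -[et re ue ur].
pose A := [set a | (a == hub e) || ((e, a) \in take i spokes)].
pose K w := [exists a in A, conn (tau :\ e) a w].
have KI a w : a \in A -> conn (tau :\ e) a w -> K w.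
  by move=> aA aw; apply/'exists_andP; exists a.
have Kc f w w' : f \in tau -> f != e -> w \in f -> w' \in f -> K w -> K w'.
  move=> ft' fe wf wf' /'exists_andP[a [aA aw]]; apply: (KI a) => //.
  by apply: conn_trans aw (conn_edge _ wf wf'); rewrite !inE fe.
have nth_notin : (e, u) \notin take i spokes.
  by rewrite -E in_take ?mem_nth // index_uniq ?enum_uniq // ltnn.
have AE a : a \in A -> a \in e /\ a != u.
  rewrite inE => /orP[/eqP->|h]; first by rewrite eq_sym.
  have [_ _ ae _] := spokesP (mem_take h); split=> //.
  by apply: contraNneq nth_notin => <-.
apply/negP => ru.
have : K u.
  apply: (conn_ind (p := K)) ru => [|f w w' fS wf wf' _].
    by apply: (KI (hub e)); rewrite ?inE ?eqxx //; apply: conn_refl.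
  case/setUP: fS => [fS|/imsetP[q qi fE]].
    by apply: Kc wf wf'; [exact: (subsetP St)|apply: contraNneq eS => <-].
  have [qt qr q2 _] := spokesP (mem_take qi).
  have sub x : x \in f -> x \in q.1 by rewrite fE !inE => /orP[]/eqP->.
  have [qe|qe] := eqVneq q.1 e; last by apply: Kc (sub w wf) (sub w' wf').
  move=> _; apply: (KI w'); last exact: conn_refl.
  move: wf'; rewrite fE !inE qe => /orP[->//|/eqP->].
  by rewrite -qe -surjective_pairing qi orbT.
case/'exists_andP=> a [/AE[ae au] /(ft e a u et ae ue)]; by move/eqP: au.
Qed.

Lemma spokes_step i : i < m -> spokes_before i.+1 = spoke_edge (spoke i) |: spokes_before i.
Proof.
move=> im; rewrite /spokes_before (take_nth (set0, ord0)) // -/(spoke i).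
apply/setP => f; rewrite in_setU1; apply/imsetP/orP.
  case=> q; rewrite mem_rcons inE => /orP[/eqP->|qi] ->; first by left.
  by right; apply/imsetP; exists q.
case=> [/eqP->|/imsetP[q qi ->]].
  by exists (spoke i); rewrite // mem_rcons inE eqxx.
by exists q; rewrite // mem_rcons inE qi orbT.
Qed.

Lemma spokes_count G j : j <= m ->
  #|components (G :|: spokes_before j)| +
  \sum_(i < j) ~~ conn (G :|: spokes_before i) (hub (spoke i).1) (spoke i).2 =
  #|components G|.
Proof.
elim: j => [|j IH] jm.
  rewrite big_ord0 addn0; congr #|pred_of_set (components _)|.
  apply/setP => f; rewrite in_setU; case E : (f \in spokes_before 0); rewrite ?orbF //.
  by case/imsetP: E => q; rewrite take0.
rewrite big_ord_recr /= -[RHS](IH (ltnW jm)) spokes_step //.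
rewrite setUCA -[#|components (G :|: _)|](@card_components_merge _ _ (hub (spoke j).1) (spoke j).2).
by rewrite addnA addnAC.
Qed.

Lemma spokes_connected G u v : conn (G :|: spokes_before m) u v.
Proof.
have [hh ct ft _] := nt.
have star e w : e \in tau -> w \in e -> conn (G :|: spokes_before m) (hub e) w.
  move=> et we; have [->|wr] := eqVneq w (hub e); first exact: conn_refl.
  have qs : (e, w) \in spokes by rewrite mem_enum !inE /= et we wr.
  apply: (conn_edge (e := spoke_edge (e, w))); rewrite ?inE ?eqxx ?orbT //.
  by apply/orP; right; apply/imsetP; exists (e, w); rewrite // take_size.
have := ct u v; apply: conn_sub; [exact: conn_refl|exact: conn_trans|].
move=> e a b et ae be; have := star e a et ae; rewrite conn_sym => h.
exact: conn_trans h (star e b et be).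
Qed.

Lemma spokes_components G : #|components (G :|: spokes_before m)| = 1.
Proof.
rewrite (_ : components _ = one_block_partition n) ?cards1 //.
apply: part_ext (components_part _) (one_block_part n) _ => u v.
by rewrite adjacent_components adjacent_one_block spokes_connected.
Qed.

Lemma size_spokes : m = n.
Proof.
have := @spokes_count set0 m (leqnn m); rewrite spokes_components.
rewrite (eq_bigr (fun=> 1)); last first.
  by move=> i _; rewrite (independent_spoke (ltn_ord i)) ?sub0set ?inE.
rewrite sum1_card card_ord (_ : components set0 = discrete_partition n).
  by rewrite card_discrete add1n => -[].
apply: part_ext (components_part _) (discrete_part n) _ => u v.
rewrite adjacent_components adjacent_discrete; apply/idP/eqP => [|->]; last exact: conn_refl.
exact: conn0.
Qed.

(** Every spoke that is not redundant merges two components, until only one is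
    left. *)
Lemma redundant_count P : is_partition P -> \sum_(i < m) redundant P i = rank P.
Proof.
move=> pP; have := @spokes_count P m (leqnn m); rewrite spokes_components components_id //.
have : \sum_(i < m) redundant P i + \sum_(i < m) ~~ redundant P i = n.
  rewrite -big_split /= -[RHS]size_spokes -[RHS]card_ord -sum1_card.
  by apply: eq_bigr => i _; case: redundant.
rewrite /rank /redundant; lia.
Qed.

Lemma redundant_mono P Q i : is_partition P -> is_partition Q -> refines P Q ->
  redundant P i -> redundant Q i.
Proof.
move=> pP pQ /(refinesP pP pQ) rf; apply: conn_sub; [exact: conn_refl|exact: conn_trans|].
move=> e a b /setUP[eP|eB] ae be.
  apply: (@connS _ Q); first exact: subsetUl.
  by apply/connect1/rf/adjacentP; exists e.
by apply: (conn_edge _ ae be); rewrite in_setU eB orbT.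
Qed.

Lemma redundant_components S i : i < m -> S \subset tau ->
  redundant (components S) i = ((spoke i).1 \in S).
Proof.
move=> im St; have [et re ue _] := spokeP im.
have sub a b : conn (components S :|: spokes_before i) a b -> conn (S :|: spokes_before i) a b.
  apply: conn_sub; [exact: conn_refl|exact: conn_trans|].
  move=> e x y /setUP[eP|eB] xe ye.
    apply: (@connS _ S); first exact: subsetUl.
    by rewrite -adjacent_components; apply/adjacentP; exists e.
  by apply: (conn_edge _ xe ye); rewrite in_setU eB orbT.
apply/idP/idP => [/sub|eS].
  by apply: contraTT => eS; apply: independent_spoke.
apply: (@connS _ (components S)); first exact: subsetUl.
by apply: connect1; rewrite [adjacent _ _ _]adjacent_components (conn_edge eS).
Qed.

Lemma spoke_of e : e \in tau -> exists2 i, i < m & (spoke i).1 = e.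
Proof.
have [hh _ _ _] := nt; move=> et; have [u ue ur] := edge_other (hub e) hh et.
have qs : (e, u) \in spokes by rewrite mem_enum !inE /= et ue ur.
by exists (index (e, u) spokes); rewrite ?index_mem // /spoke nth_index.
Qed.
End Retraction.

From mathcomp Require Import lra.

(** * Predecessor weights *)

Section Weights.
Local Open Scope ring_scope.
Variables (R : realFieldType) (n : nat).
Hypothesis hn : (2 <= n)%N.
Notation V := 'I_n.+1.
Notation H := (hypergraph n).
Notation d := (@clockwise_steps n).
Implicit Types (u v w a b c m : V) (e f : {set V}) (tau sigma S P Q : H) (y z : H -> R).

(** The matrix of weights is the sum of the permutation matrices of the
    predecessor maps, each P counted y P times. *)
Definition weight y v m : R := \sum_P y P * (predecessor (adjacent P) v m)%:R.

Definition vertex_weight y sigma : R :=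
  \sum_(q : V * V | proper_cut q.1 q.2 && (sigma == halves q.1 q.2)) weight y q.1 q.2.

Definition in_low_half sigma e : bool :=
  [exists q : V * V, [&& proper_cut q.1 q.2, sigma == halves q.1 q.2 & e \subset low q.1 q.2]].

(** For coordinates a on the simplex of a hypertree, these heights of its
    hyperedges decrease along the hyperedge poset. *)
Definition height (a : H -> R) e : R := \sum_sigma a sigma * (in_low_half sigma e)%:R.

(** The gaps between successive heights are the coordinates along the chain of s. *)
Definition chain_point (s : seq {set V}) (g : {set V} -> R) P : R :=
  \sum_(1 <= j < size s) (P == components (prefix_edges s j))%:R *
     (g (nth set0 s j.-1) - g (nth set0 s j)).

Definition vertex_support tau (a : H -> R) : Prop := forall sigma, a sigma != 0 ->
  exists v m, [/\ proper_cut v m, sigma = halves v m & splits tau v m].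

Definition chain_supported y : Prop :=
  [/\ forall P, 0 <= y P, forall P, y P != 0 -> is_partition P
    & forall P Q, y P != 0 -> y Q != 0 -> refines P Q || refines Q P].

Lemma vertex_weight_halves y v m : proper_cut v m -> vertex_weight y (halves v m) = weight y v m.
Proof.
move=> vm; rewrite /vertex_weight (bigD1 (v, m)) /= ?vm ?eqxx // big1 ?addr0 //.
move=> [v' m'] /= /andP[/andP[vm' /eqP E] ne].
by case: (halves_inj vm vm' E) ne => <- <-; rewrite eqxx.
Qed.

Lemma weight_support y v m : weight y v m != 0 ->
  exists P, y P != 0 /\ predecessor (adjacent P) v m.
Proof.
move=> w; have /existsP[P /andP[yP pP]] : [exists P, (y P != 0) && predecessor (adjacent P) v m].
  apply: contraNT w; rewrite negb_exists => /forallP h; rewrite /weight big1 // => P _.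
  have := h P; rewrite negb_and negbK => /orP[/eqP->|/negbTE->]; rewrite ?mul0r ?mulr0 //.
by exists P.
Qed.

Lemma vertex_weight_support y sigma : vertex_weight y sigma != 0 ->
  exists v m P, [/\ proper_cut v m, sigma = halves v m, y P != 0 & predecessor (adjacent P) v m].
Proof.
move=> nz; have /existsP[[v m] /= /and3P[vm /eqP E w]] : [exists q : V * V,
    [&& proper_cut q.1 q.2, sigma == halves q.1 q.2 & weight y q.1 q.2 != 0]].
  apply: contraNT nz; rewrite negb_exists => /forallP h; rewrite /vertex_weight big1 // => q /andP[q1 q2].
  by have := h q; rewrite q1 q2 /= negbK => /eqP.
have [P [yP pP]] := weight_support w; by exists v, m, P.
Qed.

Lemma lower_halves v m e : proper_cut v m -> in_low_half (halves v m) e = (e \subset low v m).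
Proof.
move=> vm; apply/existsP/idP => [[[v' m'] /= /and3P[vm' /eqP E el]]|el].
  by case: (halves_inj vm vm' E) el => <- <-.
by exists (v, m); rewrite /= vm eqxx.
Qed.

Lemma weightD y z v m : weight (fun P => y P + z P) v m = weight y v m + weight z v m.
Proof. by rewrite -big_split /=; apply: eq_bigr => P _; rewrite mulrDl. Qed.

Lemma weight_single P0 (k : R) v m :
  weight (fun P => k * (P == P0)%:R) v m = k * (predecessor (adjacent P0) v m)%:R.
Proof.
rewrite /weight (bigD1 P0) //= eqxx mulr1 big1 ?addr0 // => P /negbTE->.
by rewrite mulr0 mul0r.
Qed.

Lemma weightZ (k : R) y v m : weight (fun P => k * y P) v m = k * weight y v m.
Proof. by rewrite mulr_sumr; apply: eq_bigr => P _; rewrite mulrA. Qed.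

Lemma vertex_weightZ (k : R) y sigma : vertex_weight (fun P => k * y P) sigma = k * vertex_weight y sigma.
Proof. by rewrite mulr_sumr; apply: eq_bigr => q _; rewrite weightZ. Qed.

Lemma weight_ge0 y v m : (forall P, 0 <= y P) -> 0 <= weight y v m.
Proof. by move=> y0; apply: sumr_ge0 => P _; rewrite mulr_ge0 // ler0n. Qed.

Lemma vertex_weight_ge0 y sigma : (forall P, 0 <= y P) -> 0 <= vertex_weight y sigma.
Proof. by move=> y0; apply: sumr_ge0 => q _; apply: weight_ge0. Qed.

Lemma weight_gt0 y v m P : (forall P, 0 <= y P) -> y P != 0 -> predecessor (adjacent P) v m ->
  0 < weight y v m.
Proof.
move=> y0 yP pP; rewrite /weight (bigD1 P) //= pP mulr1.
apply: ltr_pwDl; first by rewrite lt_def yP y0.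
by apply: sumr_ge0 => Q _; rewrite mulr_ge0 // ler0n.
Qed.

Lemma vertex_weight_sum_gt0 y P : (forall Q, 0 <= y Q) -> y P != 0 -> proper_part P ->
  0 < \sum_sigma vertex_weight y sigma.
Proof.
move=> y0 yP /proper_part_valid[v [m [vm pm]]].
rewrite (bigD1 (halves v m)) //= vertex_weight_halves //.
apply: ltr_pwDl; first exact: weight_gt0 y0 yP pm.
by apply: sumr_ge0 => q _; apply: vertex_weight_ge0.
Qed.

Lemma row_sum y v : (forall P, y P != 0 -> is_partition P) ->
  \sum_m weight y v m = \sum_P y P.
Proof.
move=> yp; rewrite exchange_big /=; apply: eq_bigr => P _.
have [->|yP] := eqVneq (y P) 0; first by rewrite big1 // => m _; rewrite mul0r.
have [rr rs rt] := adjacent_eqv (yp P yP); have [m pm] := predecessor_exists (rr v).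
rewrite (bigD1 m) //= pm mulr1 big1 ?addr0 // => m' mm'.
case E: (predecessor _ _ _); last by rewrite mulr0.
by move: mm'; rewrite (predecessor_uniq E pm) eqxx.
Qed.

(** Taking predecessors permutes the vertices, so that m is counted once for each
    partition. *)
Lemma column_sum y m : (forall P, y P != 0 -> is_partition P) ->
  \sum_v weight y v m = \sum_P y P.
Proof.
move=> yp; rewrite exchange_big /=; apply: eq_bigr => P _.
have [->|yP] := eqVneq (y P) 0; first by rewrite big1 // => v _; rewrite mul0r.
have ev := adjacent_eqv (yp P yP); have [rr _ _] := ev.
pose f v := xchoose (predecessor_exists (rr v)).
have fP v : predecessor (adjacent P) v (f v) by apply: xchooseP.
have finj : injective f by move=> v v' E; apply: (predecessor_inj ev (fP v)); rewrite E.
have /codomP[v mE] : m \in codom f by apply: injF_onto.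
have pv : predecessor (adjacent P) v m by rewrite mE.
rewrite (bigD1 v) //= pv mulr1 big1 ?addr0 // => v' vv'.
case E: (predecessor _ _ _); last by rewrite mulr0.
by move: vv'; rewrite (predecessor_inj ev E pv) eqxx.
Qed.

Lemma chain_min y : chain_supported y -> (exists P, y P != 0) ->
  exists P, y P != 0 /\ forall Q, y Q != 0 -> forall u v, adjacent P u v -> adjacent Q u v.
Proof.
case=> y0 yp yc [P0 yP0].
case: (@arg_minnP _ P0 (fun P => y P != 0)
  (fun P => #|[set q : V * V | adjacent P q.1 q.2]|) yP0) => P yP Pmin.
exists P; split=> // Q yQ u v uv; case/orP: (yc P Q yP yQ) => /refinesP rf.
  exact: (rf (yp P yP) (yp Q yQ)).
have /eqP E : [set q : V * V | adjacent Q q.1 q.2] == [set q : V * V | adjacent P q.1 q.2].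
  rewrite eqEcard Pmin // andbT; apply/subsetP => q; rewrite !inE.
  exact: (rf (yp Q yQ) (yp P yP)).
by have := erefl ((u, v) \in [set q : V * V | adjacent Q q.1 q.2]); rewrite {1}E !inE /= uv => <-.
Qed.

Lemma chain_min_weight y z P P' : chain_supported y -> chain_supported z ->
  weight y =2 weight z -> y P != 0 -> z P' != 0 ->
  (forall Q, y Q != 0 -> forall u v, adjacent P u v -> adjacent Q u v) ->
  (forall Q, z Q != 0 -> forall u v, adjacent P' u v -> adjacent Q u v) -> P = P'.
Proof.
move=> [y0 yp yc] [z0 zp zc] E yP zP' Pmin P'min.
apply: (part_prd_ext (yp _ yP) (zp _ zP')) => v m pm.
have [rr _ _] := adjacent_eqv (zp _ zP'); have [m' pm'] := predecessor_exists (rr v).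
suff -> : m = m' by [].
have wm : weight z v m != 0 by rewrite -E gt_eqF // (weight_gt0 y0 yP pm).
have wm' : weight y v m' != 0 by rewrite E gt_eqF // (weight_gt0 z0 zP' pm').
have [Q' [zQ' pQ']] := weight_support wm; have [Q [yQ pQ]] := weight_support wm'.
apply: (@steps_inj _ v); apply/eqP; rewrite eqn_leq.
by rewrite (predecessor_mono (Pmin _ yQ) pm pQ) (predecessor_mono (P'min _ zQ') pm' pQ').
Qed.

(** The smallest partition carrying weight is read off from the weights: for
    each v it gives the first nonzero entry clockwise from v.  Peel it off and
    repeat. *)
Lemma weight_inj y z : chain_supported y -> chain_supported z ->
  weight y =2 weight z -> y =1 z.
Proof.
have [k] := ubnP (#|[set P | y P != 0%R]| + #|[set P | z P != 0%R]|)%N.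
elim: k y z => // k IH y z; rewrite ltnS => le cy cz E.
have [y0 yp yc] := cy; have [z0 zp zc] := cz.
have zero y1 z1 : chain_supported y1 -> chain_supported z1 -> weight y1 =2 weight z1 ->
    ~~ [exists P, y1 P != 0] -> y1 =1 z1.
  move=> [_ y1p _] [z10 z1p _] E1; rewrite negb_exists => /forallP h P.
  have y10 Q : y1 Q = 0 by have := h Q; rewrite negbK => /eqP.
  rewrite y10; apply/esym.
  have : \sum_Q z1 Q = 0.
    rewrite -(row_sum ord0 z1p); rewrite big1 // => m _.
    by rewrite -E1 /weight big1 // => Q _; rewrite y10 mul0r.
  by move/psumr_eq0P => H; apply: H.
have [/existsP yex|yno] := boolP [exists P, y P != 0]; last exact: zero.
have [/existsP zex|zno] := boolP [exists P, z P != 0]; last first.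
  by move=> P; apply/esym/zero => // v m; rewrite E.
have [P [yP Pmin]] := chain_min cy yex; have [P' [zP' P'min]] := chain_min cz zex.
have PP' := chain_min_weight cy cz E yP zP' Pmin P'min.
rewrite -{P'}PP' in zP' P'min.
pose k0 := Num.min (y P) (z P).
have k0P : 0 < k0 by rewrite lt_min !lt_def yP zP' y0 z0.
pose sub (x : H -> R) Q := x Q + (- k0) * (Q == P)%:R.
have csub x : chain_supported x -> k0 <= x P -> chain_supported (sub x) /\
    forall Q, sub x Q != 0 -> x Q != 0.
  move=> [x0 xp xc] kx.
  have sx Q : sub x Q != 0 -> x Q != 0.
    rewrite /sub; have [->|QP] := eqVneq Q P; last by rewrite mulr0 addr0.
    by move=> _; rewrite gt_eqF // (lt_le_trans k0P).
  split=> //; split=> [Q|Q /sx|Q Q' /sx h /sx]; [|exact: xp|exact: xc].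
  rewrite /sub; have [->|QP] := eqVneq Q P; last by rewrite mulr0 addr0.
  by rewrite mulr1 subr_ge0.
have ky : k0 <= y P by rewrite /k0 ge_min lexx.
have [cy' sy] := csub y cy ky.
have kz : k0 <= z P by rewrite /k0 ge_min lexx orbT.
have [cz' sz] := csub z cz kz.
have subE x : (forall Q, sub x Q != 0 -> x Q != 0) ->
    [set Q | sub x Q != 0] \subset [set Q | x Q != 0].
  by move=> h; apply/subsetP => Q; rewrite !inE; apply: h.
have lt : (#|[set Q | sub y Q != 0%R]| + #|[set Q | sub z Q != 0%R]| <
          #|[set Q | y Q != 0%R]| + #|[set Q | z Q != 0%R]|)%N.
  have prop x : (forall Q, sub x Q != 0 -> x Q != 0) -> x P = k0 ->
      (#|[set Q | sub x Q != 0%R]| < #|[set Q | x Q != 0%R]|)%N.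
    move=> h xk; apply: proper_card; apply/properP; split; first exact: subE.
    exists P; first by rewrite inE xk gt_eqF.
    by rewrite inE /sub eqxx mulr1 xk subrr eqxx.
  have cy1 := subset_leq_card (subE y sy); have cz1 := subset_leq_card (subE z sz).
  have [h|h] : y P = k0 \/ z P = k0 by rewrite /k0; case: leP => _; [left|right].
    by rewrite -addSn leq_add // prop.
  by rewrite -addnS leq_add // prop.
have /IH : (#|[set Q | sub y Q != 0%R]| + #|[set Q | sub z Q != 0%R]| < k)%N.
  exact: leq_trans lt le.
move=> /(_ cy' cz') H Q.
have /(_ Q) : sub y =1 sub z.
  by apply: H => v m; rewrite !weightD E.
by rewrite /sub => /addIr.
Qed.

(** The weights of improper cuts form the diagonal of the matrix and the entries
    next to it.  As rows and columns all have the same sum, the other entries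
    determine these up to a constant on the diagonal and one next to it, which
    are contributions of the two bounding partitions. *)
Lemma vertex_weight_inj y z : chain_supported y -> chain_supported z ->
  (forall P, y P != 0 -> proper_part P) -> (forall P, z P != 0 -> proper_part P) ->
  vertex_weight y =1 vertex_weight z -> y =1 z.
Proof.
move=> cy cz py pz E; have [y0 yp yc] := cy; have [z0 zp zc] := cz.
pose D v m := weight y v m - weight z v m.
have Dvalid v m : proper_cut v m -> D v m = 0.
  by move=> vm; rewrite /D -!vertex_weight_halves // E subrr.
pose K := \sum_P y P - \sum_P z P.
have ntriv v m : m != v -> d v m != n -> proper_cut v m.
  by move=> h1 h2; rewrite /proper_cut steps_gt0 h1 ltn_neqAle h2 steps_le.
have row v l : d v l = n -> D v v + D v l = K.
  move=> vl; rewrite /K -(row_sum v yp) -(row_sum v zp) -sumrB.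
  have lv : l != v by rewrite -steps_gt0 vl; lia.
  rewrite (bigD1 v) //= (bigD1 l) //= big1 ?addr0 // => m /andP[mv ml].
  apply: Dvalid; apply: ntriv => //; apply: contra ml => /eqP h.
  by apply/eqP/(@steps_inj _ v); rewrite h.
have col v l : d v l = n -> D l l + D v l = K.
  move=> vl; rewrite /K -(column_sum l yp) -(column_sum l zp) -sumrB.
  have lv : v != l by rewrite eq_sym -steps_gt0 vl; lia.
  rewrite (bigD1 l) //= (bigD1 v) //= big1 ?addr0 // => m /andP[mv ml].
  apply: Dvalid; apply: ntriv; first by rewrite eq_sym.
  apply: contra ml => /eqP h; move: vl h mv; clear=> *; cyc l.
have diag v : D v v = D ord0 ord0.
  have [k] := ubnP (d ord0 v); elim: k v => // k IH v; rewrite ltnS => le.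
  have [->//|v0] := eqVneq v ord0; have [l vl] := last_vertex v.
  rewrite -(IH l); first by apply: (addIr (D v l)); rewrite row // col.
  apply: leq_trans le; move: vl v0; clear=> ? ?; cyc (@ord0 n).
pose D0 := D ord0 ord0; pose E0 := K - D0.
(* large enough to keep all padded coordinates nonnegative *)
pose k := `|D0| + `|E0|.
have DE v m : D v m = D0 * (predecessor (adjacent (discrete_partition n)) v m)%:R +
                      E0 * (predecessor (adjacent (one_block_partition n)) v m)%:R.
  have -> : predecessor (adjacent (discrete_partition n)) v m = (m == v).
    apply/predecessorP/eqP => [[]|->]; first by rewrite adjacent_discrete => /eqP->.
    by split=> [|u]; rewrite adjacent_discrete // => /eqP->.
  have -> : predecessor (adjacent (one_block_partition n)) v m = (d v m == n).
    apply/predecessorP/eqP => [[_ h]|h]; last first.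
      by split=> [|u _]; rewrite ?adjacent_one_block // h steps_le.
    have [l vl] := last_vertex v; have := h l (adjacent_one_block v l).
    by have := steps_le v m; lia.
  have [->|mv] := eqVneq m v.
    by rewrite stepsvv diag (_ : (0 == n)%N = false) ?mulr0 ?addr0 ?mulr1 //; apply/eqP; lia.
  have [vm|vm] := eqVneq (d v m) n; last by rewrite Dvalid ?ntriv // !mulr0 addr0.
  by rewrite mulr0 add0r mulr1 /E0 /D0 -(row v m vm) diag addrAC subrr add0r.
pose pad (x : H -> R) (a b : R) P := x P + (a * (P == discrete_partition n)%:R +
                                       b * (P == one_block_partition n)%:R).
have cpad x (a b : R) : 0 <= a -> 0 <= b -> chain_supported x -> chain_supported (pad x a b).
  move=> a0 b0 [x0 xp xc].
  have padP P : pad x a b P != 0 ->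
      [\/ x P != 0, P = discrete_partition n | P = one_block_partition n].
    rewrite /pad; have [->|nd] := eqVneq P (discrete_partition n); first by constructor 2.
    have [->|no] := eqVneq P (one_block_partition n); first by constructor 3.
    by rewrite !mulr0 !addr0; constructor 1.
  have part P : pad x a b P != 0 -> is_partition P.
    by case/padP => [/xp|->|->] //; [exact: discrete_part|exact: one_block_part].
  split=> //.
    by move=> P; rewrite /pad !addr_ge0 // mulr_ge0 // ler0n.
  move=> P Q hP hQ; have pP := part P hP; have pQ := part Q hQ.
  have [dP|oQ] : P = discrete_partition n \/ P = one_block_partition n \/ x P != 0.
      by case/padP: hP; auto.
    apply/orP; left; apply/refinesP => // u v; rewrite dP adjacent_discrete => /eqP->.
    by have [rr _ _] := adjacent_eqv pQ.
  case: oQ => [oP|xP].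
    by apply/orP; right; apply/refinesP => // u v _; rewrite oP adjacent_one_block.
  case/padP: (hQ) => [xQ|dQ|oQ]; first exact: xc.
    apply/orP; right; apply/refinesP => // u v; rewrite dQ adjacent_discrete => /eqP->.
    by have [rr _ _] := adjacent_eqv pP.
  by apply/orP; left; apply/refinesP => // u v _; rewrite oQ adjacent_one_block.
have n1 := normr_ge0 D0; have n2 := normr_ge0 E0.
have b1 : - `|D0| <= D0 by rewrite lerNl -normrN ler_norm.
have b2 : - `|E0| <= E0 by rewrite lerNl -normrN ler_norm.
have k0 : 0 <= k by rewrite /k; lra.
have kD : 0 <= k + D0 by rewrite /k; lra.
have kE : 0 <= k + E0 by rewrite /k; lra.
have padE := @weight_inj _ _ (cpad y k k k0 k0 cy) (cpad z _ _ kD kE cz).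
have {}padE : pad y k k =1 pad z (k + D0) (k + E0).
  apply: padE => v m; rewrite /pad !weightD !weight_single.
  have := DE v m; rewrite /D => /eqP; rewrite subr_eq => /eqP ->; rewrite !mulrDl; lra.
move=> P; have := padE P; rewrite /pad.
have [PE|nd] := eqVneq P (discrete_partition n).
  have yd : y P = 0 by apply/eqP/negPn/negP => /py[].
  have zd : z P = 0 by apply/eqP/negPn/negP => /pz[].
  by rewrite yd zd.
have [PE|no] := eqVneq P (one_block_partition n); last by rewrite !mulr0 !addr0.
have yd : y P = 0 by apply/eqP/negPn/negP => /py[].
have zd : z P = 0 by apply/eqP/negPn/negP => /pz[].
by rewrite yd zd.
Qed.
End Weights.

(** * Coordinates of a point with given heights *)

Section ChainPoints.
Local Open Scope ring_scope.
Variables (R : realFieldType) (n : nat).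
Notation V := 'I_n.+1.
Notation H := (hypergraph n).
Notation d := (@clockwise_steps n).
Implicit Types (u v w b c m : V) (e f : {set V}) (tau sigma S P Q : H) (y z : H -> R).
Implicit Types (s : seq {set V}) (a : H -> R) (g : {set V} -> R).

Lemma telescope_window (g : nat -> R) i0 i1 k : (i0 <= i1 < k)%N ->
  \sum_(1 <= j < k) (g j.-1 - g j) * (i0 < j <= i1)%N%:R = g i0 - g i1.
Proof.
move=> /andP[i01 i1k].
rewrite (@big_cat_nat _ _ _ i0.+1) //=; last by lia.
rewrite (@big_cat_nat _ _ _ i1.+1 i0.+1) //=.
rewrite big_nat big1 ?add0r; last first.
  by move=> j /andP[_ h]; rewrite (_ : (i0 < j)%N = false) ?mulr0 //; apply/negbTE; rewrite -leqNgt.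
rewrite [X in _ + X]big_nat [X in _ + X]big1 ?addr0; last first.
  by move=> j /andP[h _]; rewrite (_ : (j <= i1)%N = false) ?andbF ?mulr0 //; apply/negbTE; rewrite -ltnNge.
rewrite big_add1 /= -(opprB (g i1)) -(telescope_sumr _ i01) -sumrN big_nat [RHS]big_nat.
by apply: eq_bigr => j /andP[j0 j1]; rewrite opprB ltnS j0 j1 mulr1.
Qed.

Lemma sum_chain_point s g (F : H -> R) :
  \sum_P chain_point s g P * F P =
  \sum_(1 <= j < size s) (g (nth set0 s j.-1) - g (nth set0 s j)) *
     F (components (prefix_edges s j)).
Proof.
under eq_bigr do rewrite mulr_suml.
rewrite exchange_big /=; apply: eq_bigr => j _.
rewrite (bigD1 (components (prefix_edges s j))) //= eqxx mul1r big1 ?addr0 //.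
by move=> P /negbTE->; rewrite !mul0r.
Qed.

Lemma weight_chain_point s g v m : weight (chain_point s g) v m =
  \sum_(1 <= j < size s) (g (nth set0 s j.-1) - g (nth set0 s j)) *
     (predecessor (conn (prefix_edges s j)) v m)%:R.
Proof.
rewrite [LHS]sum_chain_point; apply: eq_bigr => j _; congr (_ * _%:R).
congr nat_of_bool; apply: predecessor_eq; exact: adjacent_components.
Qed.

Lemma chain_point_support s g P : chain_point s g P != 0 -> P \in ordering_chain s.
Proof.
move=> h; apply/negPn/negP => nP; move: h; rewrite /chain_point big_nat big1 ?eqxx //.
move=> j /andP[j1 js]; case: eqP => [E|]; last by rewrite mul0r.
case/negP: nP; apply/mapP; exists j; rewrite // mem_iota j1 /=; lia.
Qed.

Lemma chain_point_ge0 s g P : sorted (fun e f => g f <= g e) s -> 0 <= chain_point s g P.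
Proof.
move=> ss; rewrite /chain_point big_nat; apply: sumr_ge0 => j /andP[j1 js].
apply: mulr_ge0; first exact: ler0n.
have tr : transitive (fun e f => g f <= g e) by move=> ? ? ? h1 h2; apply: le_trans h2 h1.
have rf : reflexive (fun e f => g f <= g e) by move=> ?; apply: lexx.
rewrite subr_ge0; apply: (sorted_leq_nth tr rf set0 ss); rewrite ?inE ?leq_pred //.
exact: leq_ltn_trans (leq_pred _) js.
Qed.

Lemma chain_point_supported s g : sorted (fun e f => g f <= g e) s ->
  chain_supported (chain_point s g).
Proof.
move=> ss; split.
- by move=> P; apply: chain_point_ge0.
- by move=> P /chain_point_support /ordering_chain_part.
- by move=> P Q /chain_point_support hP /chain_point_support; apply: ordering_chain_comparable.
Qed.

Section Tree.
Variables (tau : H) (s : seq {set V}).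
Hypotheses (nt : noncrossing_tree tau) (ps : proper_ordering tau s).

Lemma height_mono a e f : (forall sigma, 0 <= a sigma) -> vertex_support tau a ->
  local_lt tau e f -> height a f <= height a e.
Proof.
move=> a0 sa ef; apply: ler_sum => sigma _.
have [->|as0] := eqVneq (a sigma) 0; first by rewrite !mul0r.
apply: ler_wpM2l => //; have [v [m [vm -> sp]]] := sa sigma as0.
rewrite ler_nat !lower_halves //; case E: (f \subset low v m) => //.
by rewrite (splits_local_lt nt sp ef E).
Qed.

(** Take for f the last hyperedge at v below the cut and for f' the first one above
    it.  They are consecutive at v, so that no other cut separates them. *)
Lemma splitting_window v m : proper_cut v m -> splits tau v m -> exists f f',
  [/\ [/\ f \in tau, f' \in tau & (index f s < index f' s)%N],
     f \subset low v m, ~~ (f' \subset low v m),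
     forall j, predecessor (conn (prefix_edges s j)) v m = (index f s < j <= index f' s)%N
   & forall v' m', proper_cut v' m' -> splits tau v' m' ->
     ((f \subset low v' m') == (f' \subset low v' m')) || ((v' == v) && (m' == m))
     /\ (f' \subset low v' m' -> f \subset low v' m')].
Proof.
move=> vm sp; have [hh ct ft nc] := nt; have [ms us] := proper_ordering_mem ps.
have [f0 [f0t vf0 f0l]] := splits_low_edge nt sp vm.
have [f1 [f1t vf1 f1l]] := splits_high_edge nt sp vm.
pose Lo f := [&& f \in tau, v \in f & f \subset low v m].
pose Hi f := [&& f \in tau, v \in f & ~~ (f \subset low v m)].
have L0 : Lo f0 by rewrite /Lo f0t vf0.
have H0 : Hi f1 by rewrite /Hi f1t vf1.
case: (@arg_maxnP _ f0 Lo (fun f => index f s) L0) => f /and3P[ft' vf fl] fmax.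
case: (@arg_minnP _ f1 Hi (fun f => index f s) H0) => f' /and3P[ft'' vf' fl'] fmin.
have ff' : f != f' by apply: contraNneq fl' => <-.
have ltff : local_lt tau f f'.
  case/orP: (local_lt_total nt ft' ft'' ff' vf vf') => // h.
  by move: fl'; rewrite (splits_local_lt nt sp h fl).
have iff' := proper_ordering_lt ps ltff.
have window e j : e \in tau -> v \in e -> (index f s < j <= index f' s)%N ->
    (e \subset low v m) = (e \in prefix_edges s j).
  move=> et ve /andP[fj jf']; rewrite (proper_ordering_prefix _ ps) //.
  apply/idP/idP => [el|]; first by apply: leq_ltn_trans fj; apply: fmax; rewrite /Lo et ve.
  apply: contraTT => el; rewrite -leqNgt; apply: leq_trans jf' _.
  by apply: fmin; rewrite /Hi et ve.
exists f, f'; split=> // [j|v' m' vm' sp'].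
  have init := prefix_initial j ps.
  apply/idP/idP => [pm|jw].
    have h := predecessor_low nt init pm.
    have := h f ft' vf; have := h f' ft'' vf'; rewrite fl (negbTE fl').
    by rewrite !(proper_ordering_prefix _ ps) // => /esym/negbT; rewrite -leqNgt => -> <-.
  have [m' pm'] := predecessor_exists (conn_refl (prefix_edges s j) v).
  have sp' := predecessor_splits nt init pm'.
  suff -> : m = m' by [].
  apply: splits_uniq nt sp sp' _ => e et ve.
  by rewrite (window e j et ve jw) (predecessor_low nt init pm').
have mono := splits_local_lt nt sp' ltff; split=> //.
case: (boolP (f \subset low v' m')) => fl2; last first.
  by case E: (f' \subset low v' m') => //; rewrite mono in fl2.
case: (boolP (f' \subset low v' m')) => [//|fl2'] /=.
have f'h : f' \subset high v' m' by case: (splitsP sp' ft'') fl2' => // ->.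
have vv : v = v' by apply: (low_high (subsetP fl2 v vf) (subsetP f'h v vf')).
rewrite -{v'}vv in vm' sp' mono fl2 fl2' f'h *; rewrite eqxx; apply/eqP.
apply: (splits_uniq nt sp' sp) => e et ve; apply/idP/idP => el.
  apply: contraT => el'; have := fmin e; rewrite /Hi et ve el' => /(_ isT) h.
  have [Ee|ne] := eqVneq f' e; first by rewrite -Ee (negbTE fl2') in el.
  case/orP: (local_lt_total nt ft'' et ne vf' ve) => lt.
    by move: fl2'; rewrite (splits_local_lt nt sp' lt el).
  by have := proper_ordering_lt ps lt; rewrite ltnNge h.
have [->//|ne] := eqVneq e f.
case/orP: (local_lt_total nt et ft' ne ve vf) => lt.
  exact: splits_local_lt nt sp' lt fl2.
have := fmax e; rewrite /Lo et ve el => /(_ isT) /=.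
by rewrite leqNgt (proper_ordering_lt ps lt).
Qed.

(** The predecessor of v is m while f but not f' has been added, so that the sum
    telescopes to the difference of the heights of f and f'; no cut except the
    one at v and m contributes to this difference. *)
Lemma chain_point_weight a v m : vertex_support tau a -> proper_cut v m ->
  weight (chain_point s (height a)) v m = a (halves v m).
Proof.
move=> sa vm; rewrite weight_chain_point.
have [sp|nsp] := boolP (splits tau v m); last first.
  have -> : a (halves v m) = 0.
    apply/eqP/negPn/negP => /sa[v' [m' [vm' E sp']]].
    by case: (halves_inj vm vm' E) nsp => -> ->; rewrite sp'.
  rewrite big1 // => j _; case E: (predecessor _ _ _); last by rewrite mulr0.
  by rewrite (predecessor_splits nt (prefix_initial j ps) E) in nsp.
have [f [f' [[ft ft' ff'] fl fl' pw only]]] := splitting_window vm sp.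
have [ms us] := proper_ordering_mem ps.
under eq_bigr do rewrite pw.
have f's : (index f' s < size s)%N by rewrite index_mem ms.
rewrite (@telescope_window (fun j => height a (nth set0 s j))); last by rewrite (ltnW ff').
rewrite !nth_index ?ms // /height -sumrB (bigD1 (halves v m)) //= big1 ?addr0.
  by rewrite -mulrBr !lower_halves // fl (negbTE fl') subr0 mulr1.
move=> sigma ns; have [->|as0] := eqVneq (a sigma) 0; first by rewrite !mul0r subrr.
have [v' [m' [vm' E sp']]] := sa sigma as0; rewrite E in ns *.
have [/orP[/eqP h|/andP[/eqP h1 /eqP h2]] _] := only v' m' vm' sp'.
  by rewrite !lower_halves // h subrr.
by rewrite h1 h2 eqxx in ns.
Qed.

Lemma vertex_weight_chain_point a : vertex_support tau a ->
  vertex_weight (chain_point s (height a)) =1 a.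
Proof.
move=> sa sigma.
have [/existsP[[v m] /= /andP[vm /eqP->]]|no] :=
    boolP [exists q : V * V, proper_cut q.1 q.2 && (sigma == halves q.1 q.2)].
  by rewrite vertex_weight_halves // chain_point_weight.
have -> : a sigma = 0.
  apply/eqP/negPn/negP => /sa[v [m [vm E _]]]; case/negP: no.
  by apply/existsP; exists (v, m); rewrite /= vm E eqxx.
rewrite /vertex_weight big1 // => q h; case/negP: no; by apply/existsP; exists q.
Qed.

(** The coordinates are differences of heights. *)
Lemma height_const a k : vertex_support tau a ->
  (forall e, e \in tau -> height a e = k) -> a =1 (fun=> 0).
Proof.
move=> sa hk sigma; have [ms us] := proper_ordering_mem ps.
rewrite -vertex_weight_chain_point // /vertex_weight big1 // => q _; rewrite weight_chain_point.
rewrite big_nat big1 // => j /andP[j1 js]; rewrite !hk -?ms ?mem_nth ?subrr ?mul0r //.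
exact: leq_ltn_trans (leq_pred _) js.
Qed.
End Tree.
End ChainPoints.

From mathcomp Require Import ring.
From mathcomp Require Import all_classical all_reals all_analysis.
Import Defs numFieldNormedType.Exports.

(** * Convex polygons *)

Section Geometry.
Local Open Scope ring_scope.
Variables (R : realType) (n : nat) (p : 'I_n.+1 -> 'rV[R]_2).
Hypothesis hn : (2 <= n)%N.
Hypothesis hp : clockwise_convex_polygon p.
Notation V := 'I_n.+1.
Notation d := (@clockwise_steps n).
Implicit Types (u v w a b c m : V) (e f : {set V}).

Lemma orient_rot (a b c : 'rV[R]_2) : orient b c a = orient a b c.
Proof. rewrite /orient; ring. Qed.

Lemma orient_swap (a b c : 'rV[R]_2) : orient a c b = - orient a b c.
Proof. rewrite /orient; ring. Qed.

Lemma orient_clockwise a b c : (0 < d a b < d a c)%N -> orient (p a) (p b) (p c) < 0.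
Proof.
rewrite !clockwise_stepsE => h.
have : (a < b /\ b < c \/ b < c /\ c < a \/ c < a /\ a < b)%N.
  have := ltn_ord a; have := ltn_ord b; have := ltn_ord c; move: h.
  by case: (leqP a b); case: (leqP a c); move=> *; lia.
case=> [[h1 h2]|[[h1 h2]|[h1 h2]]]; first exact: hp.
- by rewrite -orient_rot; apply: hp.
- by rewrite -2!orient_rot; apply: hp.
Qed.

Lemma orient_counterclockwise a b c : (0 < d a b < d a c)%N -> 0 < orient (p a) (p c) (p b).
Proof. by move=> h; rewrite orient_swap oppr_gt0 orient_clockwise. Qed.

Lemma orient_aab (a b : 'rV[R]_2) : orient a b a = 0 /\ orient a b b = 0.
Proof. by rewrite /orient; split; ring. Qed.

Lemma orient_side a c i : i != a -> i != c -> a != c ->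
  orient (p a) (p c) (p i) = 0 -> False.
Proof.
move=> ia ic ac o0; have [h|h|h] := ltngtP (d a i) (d a c).
- have := @orient_counterclockwise a i c; rewrite h steps_gt0 ia o0 ltxx => /(_ isT) //.
- have := @orient_clockwise a c i; rewrite h steps_gt0 eq_sym ac o0 ltxx => /(_ isT) //.
- by move: ic; rewrite (steps_inj h) eqxx.
Qed.

Lemma polygon_inj : injective p.
Proof.
move=> a c pac; apply/eqP/negPn/negP => ac.
have [i /andP[ia ic]] : exists i, (i != a) && (i != c).
  have /existsP[i] : [exists i, i \notin [set a; c]]; last by rewrite !inE negb_or; exists i.
  apply: contraT; rewrite negb_exists => /forallP h.
  have : (#|[set: V]| <= #|[set a; c]|)%N.
    by apply: subset_leq_card; apply/fintype.subsetP => i _; have := h i; rewrite negbK.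
  by rewrite cardsT card_ord cards2 ac; lia.
apply: (orient_side ia ic ac); rewrite pac /orient; ring.
Qed.

Lemma orient_sum (A C : 'rV[R]_2) e (w : V -> R) : \sum_(i in e) w i = 1 ->
  orient A C (\sum_(i in e) w i *: p i) = \sum_(i in e) w i * orient A C (p i).
Proof.
move=> w1; rewrite /orient.
have E j : (\sum_(i in e) w i *: p i) 0 j = \sum_(i in e) w i * p i 0 j.
  by rewrite summxE; apply: eq_bigr => i _; rewrite mxE.
pose al := C 0 0 - A 0 0; pose be := C 0 1 - A 0 1.
pose k := be * A 0 0 - al * A 0 1.
transitivity (al * (\sum_(i in e) w i * p i 0 1) - be * (\sum_(i in e) w i * p i 0 0)
              + k * \sum_(i in e) w i).
  by rewrite w1 !E /k /al /be; ring.
rewrite !mulr_sumr -sumrB -big_split /=; apply: eq_bigr => i _.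
by rewrite /k /al /be; ring.
Qed.

Lemma hull_vertex e v : v \in e -> hull p e (p v).
Proof.
move=> ve; exists (fun i => (i == v)%:R); split=> [i||]; first exact: ler0n.
  rewrite (bigD1 v) //= eqxx big1 ?addr0 // => i /andP[_ /negbTE->] //.
rewrite (bigD1 v) //= eqxx scale1r big1 ?addr0 // => i /andP[_ /negbTE->].
by rewrite scale0r.
Qed.

Lemma hull_segment e a c (t : R) : a \in e -> c \in e -> a != c -> 0 <= t <= 1 ->
  hull p e (t *: p a + (1 - t) *: p c).
Proof.
move=> ae ce ac /andP[t0 t1].
exists (fun i => if i == a then t else if i == c then 1 - t else 0); split=> [i||].
- by case: ifP => // _; case: ifP => // _; rewrite subr_ge0.
- rewrite (bigD1 a) //= eqxx (bigD1 c) /=; last by rewrite ce eq_sym.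
  rewrite eq_sym (negbTE ac) eqxx big1 ?addr0; first by rewrite addrC subrK.
  by move=> i /andP[/andP[_ /negbTE->] /negbTE->].
- rewrite (bigD1 a) //= eqxx (bigD1 c) /=; last by rewrite ce eq_sym.
  rewrite [c == a]eq_sym (negbTE ac) eqxx big1 ?addr0 //.
  by move=> i /andP[/andP[_ /negbTE->] /negbTE->]; rewrite scale0r.
Qed.

(** The diagonals ac and bz meet, and the signed areas of the four triangles they
    cut out give the barycentric coordinates of the common point. *)
Lemma crossing_hulls e f a b c z : a \in e -> c \in e -> b \in f -> z \in f ->
  cross a b c z -> exists2 x, (hull p e `&` hull p f)%classic x & forall v, x <> p v.
Proof.
move=> ae ce bf zf cr.
have o1 : 0 < orient (p a) (p c) (p b).
  by apply: orient_counterclockwise; move: cr; rewrite /cross => /andP[].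
have o2 : orient (p a) (p c) (p z) < 0.
  by apply: orient_clockwise; move: cr; rewrite /cross; lia.
have cr2 := cross_rot cr.
have o3 : 0 < orient (p b) (p z) (p c).
  by apply: orient_counterclockwise; move: cr2; rewrite /cross => /andP[].
have o4 : orient (p b) (p z) (p a) < 0.
  by apply: orient_clockwise; move: cr2; rewrite /cross; lia.
have ac : a != c by rewrite eq_sym -steps_gt0; move: cr; rewrite /cross; lia.
have bz : b != z by rewrite eq_sym -steps_gt0; move: cr2; rewrite /cross; lia.
pose D := orient (p a) (p c) (p b) - orient (p a) (p c) (p z).
have D0 : 0 < D by rewrite /D; lra.
have DE : D = orient (p b) (p z) (p c) - orient (p b) (p z) (p a).
  rewrite /D /orient; ring.
pose s := - orient (p a) (p c) (p z) / D.
pose t := orient (p b) (p z) (p c) / D.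
have s01 : 0 <= s <= 1.
  by apply/andP; split; rewrite /s ?ler_pdivrMr // ?divr_ge0 ?mul1r // /D; lra.
have t01 : 0 <= t <= 1.
  by apply/andP; split; rewrite /t ?ler_pdivrMr // ?divr_ge0 ?mul1r ?DE // -?DE; lra.
have E : s *: p b + (1 - s) *: p z = t *: p a + (1 - t) *: p c.
  apply/rowP => j; rewrite !mxE.
  have Dn : D != 0 by rewrite gt_eqF.
  have Ds : D * s = - orient (p a) (p c) (p z) by rewrite /s mulrC divfK.
  have Dt : D * t = orient (p b) (p z) (p c) by rewrite /t mulrC divfK.
  apply: (mulfI Dn).
  transitivity ((D * s) * p b 0 j + (D - D * s) * p z 0 j); first by ring.
  transitivity ((D * t) * p a 0 j + (D - D * t) * p c 0 j); last by ring.
  rewrite Ds Dt /D /orient; have [->|->] : j = 0 \/ j = 1.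
    by case: j => -[|[|//]] i; [left|right]; apply/val_inj.
  - ring.
  - ring.
exists (s *: p b + (1 - s) *: p z).
  by split; [rewrite E; apply: hull_segment|apply: hull_segment].
move=> v pv.
have v1 : orient (p a) (p c) (p v) = 0.
  rewrite -pv E /orient !mxE; ring.
have v2 : orient (p b) (p z) (p v) = 0.
  rewrite -pv /orient !mxE; ring.
have [va|va] := eqVneq v a; first by move: v2 o4; rewrite va; lra.
have [vc|vc] := eqVneq v c; first by move: v2 o3; rewrite vc; lra.
exact: (orient_side va vc ac v1).
Qed.

(** The line through A and C has e on one side and f on the other. *)
Lemma separated_hulls (A C : 'rV[R]_2) e f v x :
  (forall i, i \in e -> 0 <= orient A C (p i)) ->
  (forall i, i \in f -> orient A C (p i) <= 0 /\ (orient A C (p i) = 0 -> i = v)) ->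
  hull p e x -> hull p f x -> v \in f /\ x = p v.
Proof.
move=> he hf [w [w0 w1 xw]] [w' [w0' w1' xw']].
have ge : 0 <= orient A C x.
  by rewrite xw orient_sum //; apply: sumr_ge0 => i ie; rewrite mulr_ge0 ?he.
have z i : i \in f -> w' i * - orient A C (p i) = 0.
  have : \sum_(i in f) w' i * - orient A C (p i) = 0.
    apply/eqP; rewrite eq_le; apply/andP; split; last first.
      by apply: sumr_ge0 => j jf; rewrite mulr_ge0 // oppr_ge0; case: (hf j jf).
    move: ge; rewrite xw' orient_sum // => ge.
    by under eq_bigr do rewrite mulrN; rewrite sumrN oppr_le0.
  move/psumr_eq0P => H jf; apply: H => // j jf'.
  by rewrite mulr_ge0 // oppr_ge0; case: (hf j jf').
have wv i : i \in f -> i != v -> w' i = 0.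
  move=> fi iv; have := z i fi; move/eqP; rewrite mulf_eq0 oppr_eq0 => /orP[/eqP//|/eqP h].
  by move: iv; rewrite ((hf i fi).2 h) eqxx.
have vf : v \in f.
  apply/negPn/negP => vf; have : \sum_(i in f) w' i = 0.
    by apply: big1 => i fi; apply: wv => //; apply: contraNneq vf => <-.
  by rewrite w1' => /eqP; rewrite oner_eq0.
split=> //; rewrite xw' (bigD1 v) //= big1 ?addr0; last first.
  by move=> i /andP[fi iv]; rewrite wv // scale0r.
move: w1'; rewrite (bigD1 v) //= big1 ?addr0 => [->|i /andP[fi iv]]; last exact: wv.
by rewrite scale1r.
Qed.

(** The line through v and the last vertex of e separates the hyperedges. *)
Lemma hulls_touching e f v :
  v \in e -> v \in f -> (forall u, u \in e -> u \in f -> u = v) ->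
  (exists2 a, a \in e & a != v) ->
  (forall x y, x \in e -> x != v -> y \in f -> y != v -> (d v x < d v y)%N) ->
  (hull p e `&` hull p f)%classic = [set p v]%classic.
Proof.
move=> ve vf ef [a0 a0e a0v] lt; apply/seteqP; split; last first.
  by move=> _ -> ; split; apply: hull_vertex.
move=> x [xe xf] /=.
have [a [ae av amax]] : exists a, [/\ a \in e, a != v & forall u, u \in e -> (d v u <= d v a)%N].
  case: (@arg_maxnP _ a0 (mem e) (fun u => d v u) a0e) => a ae amax; exists a; split=> //.
  by have /= := amax a0 a0e; rewrite -!steps_gt0 in a0v *; apply: leq_trans.
suff : v \in f /\ x = p v by case.
apply: (@separated_hulls (p v) (p a) e f) => // i ie.
  have [->|iv] := eqVneq i v; first by rewrite (orient_aab _ _).1.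
  have [->|ia] := eqVneq i a; first by rewrite (orient_aab _ _).2.
  apply/ltW/orient_counterclockwise; rewrite steps_gt0 iv /= ltn_neqAle amax // andbT.
  by rewrite (inj_eq (@steps_inj _ v)).
have [->|iv] := eqVneq i v; first by rewrite (orient_aab _ _).1.
have h : orient (p v) (p a) (p i) < 0.
  by apply: orient_clockwise; rewrite steps_gt0 av lt.
by split; [exact: ltW|move=> h0; rewrite h0 ltxx in h].
Qed.

(** Seen from a vertex of e, all of e lies beyond the line through the first and
    the last vertex of f. *)
Lemma hulls_disjoint e f : noncrossing_sets e f -> (forall u, u \in e -> u \in f -> False) ->
  e != finset.set0 -> f != finset.set0 -> (hull p e `&` hull p f)%classic = classical_sets.set0.
Proof.
move=> nc ef e0 f0; apply/seteqP; split=> // x [xe xf]; exfalso.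
wlog f1 : e f nc ef e0 f0 xe xf / (1 < #|f|)%N.
  move=> hw; have [|f1] := ltnP 1 #|f|; first exact: hw nc ef e0 f0 xe xf.
  have [|e1] := ltnP 1 #|e|.
    by apply: (hw f e) => //; [exact: noncrossing_sets_sym|move=> u uf ue; apply: (ef u)].
  move: e1 f1; rewrite leq_eqVlt ltnS leqn0 cards_eq0 (negbTE e0) orbF => /cards1P[a ea].
  rewrite leq_eqVlt ltnS leqn0 cards_eq0 (negbTE f0) orbF => /cards1P[b fb].
  have one A c : A = finset.set1 c -> hull p A x -> x = p c.
    by move=> -> [w [_]]; rewrite !big_set1 => -> ->; rewrite scale1r.
  have /polygon_inj ab : p a = p b by rewrite -(one e a ea xe) (one f b fb xf).
  by apply: (ef a); rewrite ?ea ?fb ab inE.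
have /set0Pn[v ve] := e0; have /set0Pn[b0 b0f] := f0.
case: (@arg_minnP _ b0 (mem f) (fun u => d v u) b0f) => b bf bmin.
case: (@arg_maxnP _ b0 (mem f) (fun u => d v u) b0f) => b' bf' bmax.
have nv u : u \in f -> u != v by move=> uf; apply/eqP => E; apply: (ef v); rewrite // -E.
have bb : b != b'.
  apply/eqP => E; move: f1; rewrite leqNgt => /negP; apply; rewrite ltnS.
  apply/card_le1_eqP => u1 u2 h1 h2; apply: (@steps_inj _ v).
  have := bmin _ h1; have := bmin _ h2; have := bmax _ h1; have := bmax _ h2 => /=.
  by rewrite E; lia.
have lt : (d v b < d v b')%N.
  by have /= := bmin b' bf'; rewrite leq_eqVlt (inj_eq (@steps_inj _ v)) (negbTE bb).
suff [] : b \in e /\ x = p b by move=> be _; apply: (ef b).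
apply: (@separated_hulls (p b) (p b') f e) => // i ie.
  have [->|ib] := eqVneq i b; first by rewrite (orient_aab _ _).1.
  have [->|ib'] := eqVneq i b'; first by rewrite (orient_aab _ _).2.
  apply/ltW/orient_counterclockwise; have /= h1 := bmin i ie; have /= h2 := bmax i ie.
  by move: h1 h2 lt ib ib' (nv _ bf); clear=> *; apply/andP; split; cyc v.
have ib : i != b by apply/eqP => E; apply: (ef i); rewrite // E.
have ib' : i != b' by apply/eqP => E; apply: (ef i); rewrite // E.
have h : orient (p b) (p b') (p i) < 0.
  apply: orient_clockwise; have n1 := nc v b i b' ve ie bf bf'.
  by move: n1 lt ib ib' (nv _ bf) bb; clear=> *; apply/andP; split; cyc v.
by split; [exact: ltW|move=> h0; rewrite h0 ltxx in h].
Qed.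
End Geometry.

(** * Geometric and combinatorial noncrossing *)

Section Bridge.
Variables (R : realType) (n : nat) (p : 'I_n.+1 -> 'rV[R]_2).
Hypothesis hn : (2 <= n)%N.
Hypothesis hp : clockwise_convex_polygon p.
Notation V := 'I_n.+1.
Notation d := (@clockwise_steps n).
Implicit Types (u v w a b c m : V) (e f : {set V}) (tau sigma S P Q : hypergraph n).

Lemma noncrossing_hypertreeP tau : noncrossing_hypertree p tau <-> noncrossing_tree tau.
Proof.
split=> [[[hh ct nc] ng]|nt].
  split=> //; first exact: no_cycle_forest.
  move=> e f et ft ef a b c z ae ce bf zf; apply/negP => cr.
  have [x xef nx] := crossing_hulls hn hp ae ce bf zf cr.
  case: (ng e f et ft ef) => [E|[v E]]; rewrite E in xef => //.
  exact: (nx v).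
have [hh ct ft nc] := nt; split; first split=> //; first exact: forest_no_cycle.
move=> e f et ft' ef.
have [/existsP[v /andP[ve vf]]|none] := boolP [exists v, (v \in e) && (v \in f)].
  right; exists v; have meet := forest_meet ft et ft' ef.
  have touch e' f' : local_lt tau e' f' -> v \in e' -> v \in f' ->
      (hull p e' `&` hull p f')%classic = [set p v]%classic.
    move=> lt ve' vf'; have /local_ltP[et' ft'' ef' _] := lt.
    have [a ae av] := edge_other v hh et'.
    apply: hulls_touching => //.
    - by move=> u ue uf; apply: forest_meet ft et' ft'' ef' ue ve' uf vf'.
    - by exists a.
    - exact: local_lt_at nt lt ve' vf'.
  case/orP: (local_lt_total nt et ft' ef ve vf) => lt; first exact: touch.
  by rewrite setIC; apply: touch.
left; apply: hulls_disjoint => //; first exact: nc.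
- move=> u ue uf; case/negP: none; apply/existsP; exists u; exact/andP.
- by rewrite -card_gt0; apply: leq_trans (hh e et).
- by rewrite -card_gt0; apply: leq_trans (hh f ft').
Qed.

Lemma noncrossing_partitionP P :
  noncrossing_partition p P <-> is_partition P /\ noncrossing_rel (adjacent P).
Proof.
split=> [[pP hP]|[pP nP]]; split=> //.
  move=> a b c z cr /adjacentP[A [AP aA cA]] /adjacentP[B [BP bB zB]].
  have [AB|AB] := eqVneq A B; first by apply/adjacentP; exists A; rewrite {3}AB.
  have [x xAB _] := crossing_hulls hn hp aA cA bB zB cr.
  by have := hP A B AP BP AB; move/seteqP => [/(_ x xAB)].
move=> A B AP BP AB; apply: hulls_disjoint => //.
- move=> a b c z aA cA bB zB; apply/negP => cr.
  have /adjacentP[C [CP aC bC]] : adjacent P a b.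
    by apply: nP cr _ _; apply/adjacentP; [exists A|exists B].
  move: AB; rewrite (part_same pP AP CP aA aC) (part_same pP BP CP bB bC).
  by rewrite eqxx.
- by move=> u uA uB; move: AB; rewrite (part_same pP AP BP uA uB) eqxx.
- by rewrite -card_gt0; apply: part_block_gt0 AP.
- by rewrite -card_gt0; apply: part_block_gt0 BP.
Qed.

Lemma proper_noncrossing_partitionP P :
  proper_noncrossing_partition p P <-> proper_part P /\ noncrossing_rel (adjacent P).
Proof.
split=> [[/noncrossing_partitionP[pP nP] h1 h2]|[[pP h1 h2] nP]]; first by [].
by split=> //; apply/noncrossing_partitionP.
Qed.

Lemma simplex_verticesP tau sigma : simplex_vertices p tau sigma <->
  exists v m, [/\ proper_cut v m, sigma = halves v m & splits tau v m].
Proof.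
have E v m : refines tau (halves v m) = splits tau v m.
  apply: eq_forallb => e; congr (_ ==> _); apply/'exists_andP/orP => [[f []]|].
    by rewrite !inE => /orP[]/eqP->; [left|right].
  by case=> h; [exists (low v m)|exists (high v m)]; rewrite !inE eqxx ?orbT.
split=> [[/noncrossing_hypertreeP nt c2 rf]|[v [m [vm -> sp]]]].
  have [v [m [vm sE]]] := noncrossing_tree_two hn nt c2; exists v, m; split=> //.
  by rewrite -E -sE.
split; [exact/noncrossing_hypertreeP/halves_tree|exact: halves_card|].
by rewrite E.
Qed.

Lemma ordering_chainE (s : seq {set V}) : ordering_chain s =
  [seq components (prefix_edges s j) | j <- iota 1 (size s).-1].
Proof. by []. Qed.

Lemma prefix_proper tau s j : noncrossing_tree tau -> proper_ordering tau s ->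
  (0 < j < size s)%N -> proper_part (components (prefix_edges s j)).
Proof.
move=> nt ps /andP[j0 js]; have [hh ct ft nc] := nt.
have [ms us] := proper_ordering_mem ps.
split; first exact: components_part.
  pose e := nth finset.set0 s 0.
  have es : e \in s by rewrite mem_nth // (ltn_trans j0).
  have et : e \in tau by rewrite -ms.
  have [a ae _] := edge_other ord0 hh et; have [b be ba] := edge_other a hh et.
  move=> E; have : adjacent (components (prefix_edges s j)) a b.
    rewrite adjacent_components; apply: conn_edge ae be.
    by rewrite (proper_ordering_prefix _ ps) // index_uniq // (ltn_trans j0).
  by rewrite E adjacent_discrete eq_sym (negbTE ba).
pose e := nth finset.set0 s j.
have es : e \in s by rewrite mem_nth.
have et : e \in tau by rewrite -ms.
have [a ae _] := edge_other ord0 hh et; have [b be ba] := edge_other a hh et.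
move=> E; have := adjacent_one_block a b; rewrite -E adjacent_components => ab.
move: ba; rewrite (ft e a b et ae be) ?eqxx //; apply: connS ab.
apply/fintype.subsetP => f fS; rewrite !inE (fintype.subsetP (prefix_sub j ps)) // andbT.
apply: contraTneq fS => ->; rewrite (proper_ordering_prefix _ ps) //.
by rewrite index_uniq // ltnn.
Qed.

Lemma ordering_chain_proper tau s : noncrossing_tree tau -> proper_ordering tau s ->
  is_proper_chain p (ordering_chain s).
Proof.
move=> nt ps; have [hh ct ft nc] := nt; rewrite ordering_chainE.
have mem P : P \in [seq components (prefix_edges s j) | j <- iota 1 (size s).-1] ->
    exists j, (0 < j < size s)%N /\ P = components (prefix_edges s j).
  case/mapP => j; rewrite mem_iota => h ->; exists j; split=> //; lia.
split=> [P /mem[j [js ->]]|P Q]; last exact: ordering_chain_comparable.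
apply/proper_noncrossing_partitionP; split; first exact: prefix_proper nt ps js.
move=> a b c z; rewrite !adjacent_components.
exact: (conn_nc ft nc (prefix_sub j ps)).
Qed.

Lemma proper_chain_ordering (c : seq (hypergraph n)) : is_proper_chain p c ->
  exists tau s, [/\ noncrossing_tree tau, proper_ordering tau s & {subset c <= ordering_chain s}].
Proof.
case=> hc cmp.
pose N P := #|[set q : V * V | adjacent P q.1 q.2]|.
pose c' := sort (fun P Q => N P <= N Q)%N c.
have mc P : (P \in c') = (P \in c) by rewrite mem_sort.
have hP P : P \in c' -> proper_part P /\ noncrossing_rel (adjacent P).
  by rewrite mc => /hc /proper_noncrossing_partitionP.
have part P : P \in c' -> is_partition P by move/hP => [[]].
have mono P Q u v : P \in c' -> Q \in c' -> (N P <= N Q)%N -> adjacent P u v -> adjacent Q u v.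
  move=> Pc Qc NPQ uv; have Pc' := Pc; have Qc' := Qc; rewrite !mc in Pc' Qc'.
  case/orP: (cmp P Q Pc' Qc') => /refinesP rf; first exact: (rf (part _ Pc) (part _ Qc)).
  have /eqP E : [set q : V * V | adjacent Q q.1 q.2]%SET == [set q : V * V | adjacent P q.1 q.2]%SET.
    rewrite eqEcard NPQ andbT; apply/fintype.subsetP => q; rewrite !inE.
    exact: (rf (part _ Qc) (part _ Pc)).
  by have := erefl ((u, v) \in [set q : V * V | adjacent Q q.1 q.2]%SET); rewrite {1}E !inE /= uv => <-.
have nthE i : (i < size c')%N ->
    nth (fun _ _ => true) (map (@adjacent n) c') i = adjacent (nth (one_block_partition n) c' i).
  by move=> ic; rewrite (nth_map (one_block_partition n)).
have [|||u v uv|s [ms ct hs]] := @merging_chain n (map (@adjacent n) c') [::].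
- move=> i; rewrite size_map => ic /=; rewrite nthE //.
  have ic' := mem_nth (one_block_partition n) ic.
  have [[pP _ _] nP] := hP _ ic'; have [rr rs rt] := adjacent_eqv pP; split=> //.
- move=> i j u v ij; rewrite size_map => jc; have ic := leq_ltn_trans ij jc.
  rewrite !nthE //; apply: mono; rewrite ?mem_nth //.
  have tr : transitive (fun P Q => N P <= N Q)%N by move=> ? ? ?; apply: leq_trans.
  apply: (@sorted_leq_nth _ (fun P Q => N P <= N Q)%N) => //.
  by apply: sort_sorted => ? ?; apply: leq_total.
- by [].
- have -> : u = v.
    by apply: conn0; move: uv; apply: connS; apply/fintype.subsetP => e; rewrite inE.
  case E : (size c') => [|k]; first by rewrite nth_default // size_map E.
  rewrite nthE ?E //; have ic' := mem_nth (one_block_partition n) (_ : (0 < size c')%N).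
  rewrite E in ic'; have [[pP _ _] _] := hP _ (ic' isT); have [rr _ _] := adjacent_eqv pP.
  exact: rr.
rewrite /= in ms ct hs; have [nt ps] := merging_seq_tree ms ct.
exists [set e in s]%SET, s; split=> // P Pc.
have Pc' : P \in c' by rewrite mc.
have ic : (index P c' < size c')%N by rewrite index_mem.
have [|j hj] := hs (index P c'); first by rewrite size_map.
rewrite nthE // nth_index // in hj.
have [[pP nd no] _] := hP _ Pc'.
rewrite ordering_chainE; apply/mapP; exists j; last first.
  by apply: (part_ext pP (components_part _)) => u v; rewrite adjacent_components hj.
rewrite mem_iota; case: (posnP j) => j0.
  case: nd; apply: (part_ext pP (discrete_part n)) => u v; rewrite -hj adjacent_discrete.
  apply/idP/eqP => [|->]; last exact: conn_refl.
  move=> h; apply: conn0; apply: connS h; rewrite j0 /prefix_edges take0.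
  by apply/fintype.subsetP => e; rewrite inE.
case: (leqP (size s) j) => js; last by rewrite ?j0 /= add1n prednK // (leq_trans _ js).
case: no; apply: (part_ext pP (one_block_part n)) => u v.
by rewrite adjacent_one_block -hj /prefix_edges take_oversize // ct.
Qed.
End Bridge.

(** * Spherical trigonometry *)

Section Sphere.
Local Open Scope ring_scope.
Variables (R : realType) (m : nat).
Implicit Types (u v w a b c : 'rV[R]_m) (x y k l : R).

Lemma dotvC u v : dotv u v = dotv v u.
Proof. by apply: eq_bigr => i _; rewrite mulrC. Qed.

Lemma dotvDl u v w : dotv (u + v) w = dotv u w + dotv v w.
Proof. by rewrite -big_split /=; apply: eq_bigr => i _; rewrite mxE mulrDl. Qed.

Lemma dotvZl k u v : dotv (k *: u) v = k * dotv u v.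
Proof. by rewrite mulr_sumr; apply: eq_bigr => i _; rewrite mxE mulrA. Qed.

Lemma dotvDr u v w : dotv w (u + v) = dotv w u + dotv w v.
Proof. by rewrite dotvC dotvDl !(dotvC w). Qed.

Lemma dotvZr k u v : dotv v (k *: u) = k * dotv v u.
Proof. by rewrite dotvC dotvZl dotvC. Qed.

Lemma dotv_ge0 u : 0 <= dotv u u.
Proof. by apply: sumr_ge0 => i _; rewrite -expr2 sqr_ge0. Qed.

Lemma dotv_eq0 u : dotv u u = 0 -> u = 0.
Proof.
move/psumr_eq0P => h; apply/rowP => i; rewrite mxE; apply/eqP.
by rewrite -sqrf_eq0 expr2; apply/eqP/h => // j _; rewrite -expr2 sqr_ge0.
Qed.

Lemma dotv_gt0 u : u != 0 -> 0 < dotv u u.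
Proof. by move=> u0; rewrite lt_def dotv_ge0 andbT; apply: contra_neq u0 => /dotv_eq0. Qed.

Lemma cauchy_schwarz u v : dotv u v ^+ 2 <= dotv u u * dotv v v.
Proof.
have [->|v0] := eqVneq v 0.
  have z w : dotv w 0 = 0 by apply: big1 => i _; rewrite mxE mulr0.
  by rewrite !z mulr0 expr0n.
have vv := dotv_gt0 v0.
have := dotv_ge0 (dotv v v *: u + (- dotv u v) *: v).
rewrite !(dotvDl, dotvDr, dotvZl, dotvZr) (dotvC v u) => h.
rewrite -subr_ge0 -(pmulr_rge0 _ vv); apply: le_trans h _; rewrite le_eqVlt; apply/orP; left.
apply/eqP; ring.
Qed.

Lemma unit_dot u v : dotv u u = 1 -> dotv v v = 1 -> -1 <= dotv u v <= 1.
Proof.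
move=> u1 v1; have := cauchy_schwarz u v; rewrite u1 v1 mulr1 => h.
by rewrite -ler_norml -(@ler_pXn2r _ 2) ?nnegrE // real_normK ?num_real // expr1n.
Qed.

Lemma acos_anti x y : -1 <= x -> x <= y -> y <= 1 -> acos y <= acos x.
Proof.
move=> x1 xy y1; have xb : -1 <= x <= 1 by rewrite x1 (le_trans xy).
have yb : -1 <= y <= 1 by rewrite y1 (le_trans x1 xy).
rewrite leNgt; apply/negP => lt.
have := ltr_cos (_ : acos x \in `[0, pi]) (_ : acos y \in `[0, pi]).
rewrite !in_itv /= !acos_ge0 // !acos_lepi // => /(_ isT isT).
by rewrite !acosK ?in_itv //= lt ltNge xy.
Qed.

Lemma acos_sum_le x y z : -1 <= x <= 1 -> -1 <= y <= 1 -> -1 <= z <= 1 ->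
  x * y - Num.sqrt (1 - x ^+ 2) * Num.sqrt (1 - y ^+ 2) <= z ->
  acos z <= acos x + acos y.
Proof.
move=> xb yb zb h; have [le|gt] := leP (acos x + acos y) pi; last first.
  by apply: ltW; apply: le_lt_trans gt; apply: acos_lepi.
have cE : cos (acos x + acos y) =
    x * y - Num.sqrt (1 - x ^+ 2) * Num.sqrt (1 - y ^+ 2).
  by rewrite cosD !acosK ?in_itv //= !sin_acos.
have -> : acos x + acos y = acos (cos (acos x + acos y)).
  by rewrite cosK // in_itv /= le andbT addr_ge0 // acos_ge0.
apply: acos_anti; first exact: cos_geN1; first by rewrite cE.
by case/andP: zb.
Qed.

(** Gram: the components of a and c orthogonal to b satisfy Cauchy-Schwarz. *)
Lemma spherical_triangle a b c : dotv a a = 1 -> dotv b b = 1 -> dotv c c = 1 ->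
  acos (dotv a c) <= acos (dotv a b) + acos (dotv b c).
Proof.
move=> a1 b1 c1; set x := dotv a b; set y := dotv b c; set z := dotv a c.
have xb : -1 <= x <= 1 := unit_dot a1 b1; have yb : -1 <= y <= 1 := unit_dot b1 c1.
apply: acos_sum_le => //; first exact: unit_dot.
have := cauchy_schwarz (a + (- x) *: b) (c + (- y) *: b).
have expand u v (k l : R) : dotv (u + (- k) *: b) (v + (- l) *: b) =
    dotv u v - l * dotv u b - k * dotv b v + k * l.
  by rewrite !(dotvDl, dotvDr, dotvZl, dotvZr) b1; ring.
rewrite !expand a1 c1 (dotvC b a) (dotvC c b) -/x -/y -/z.
have -> : z - y * x - x * y + x * y = z - x * y by ring.
have -> : 1 - x * x - x * x + x * x = 1 - x ^+ 2 by ring.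
have -> : 1 - y * y - y * y + y * y = 1 - y ^+ 2 by ring.
have sq (t : R) : -1 <= t <= 1 -> 0 <= 1 - t ^+ 2 by move=> /andP[t1 t2]; nra.
move=> h; rewrite -sqrtrM ?sq // lerBlDr -lerBlDl.
have /ler_sqrt h' : 0 <= (1 - x ^+ 2) * (1 - y ^+ 2) by rewrite mulr_ge0 ?sq.
move: h; rewrite -h' sqrtr_sqr => h; apply: le_trans h.
by rewrite -normrN; apply: le_trans (ler_norm _); rewrite opprB.
Qed.

(** A point c between a and b on a great circle cuts the angle into two. *)
Lemma spherical_between a b c (s t : R) : dotv a a = 1 -> dotv b b = 1 ->
  dotv c c = 1 -> 0 <= s -> 0 <= t -> c = s *: a + t *: b ->
  acos (dotv a c) + acos (dotv c b) <= acos (dotv a b).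
Proof.
move=> a1 b1 c1 s0 t0 cE; set x := dotv a b.
have xb : -1 <= x <= 1 := unit_dot a1 b1.
have acb := unit_dot a1 c1; have cbb := unit_dot c1 b1.
have ac : dotv a c = s + t * x by rewrite cE dotvDr !dotvZr a1 mulr1.
have cb : dotv c b = s * x + t by rewrite cE dotvDl !dotvZl b1 mulr1.
have st : s ^+ 2 + t ^+ 2 + s * t * x *+ 2 = 1.
  rewrite -c1 {1}cE dotvDl !dotvZl ac dotvC cb; rewrite mulr2n; ring.
have xx : 0 <= 1 - x ^+ 2 by case/andP: xb => ? ?; nra.
have le : acos (dotv a c) + acos (dotv c b) <= pi.
  rewrite -lerBrDl -acosN //; apply: acos_anti; last by case/andP: cbb.
    by rewrite lerN2; case/andP: acb.
  by rewrite ac cb; case/andP: xb => ? ?; nra.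
have sE : Num.sqrt (1 - dotv a c ^+ 2) = t * Num.sqrt (1 - x ^+ 2).
  have -> : 1 - dotv a c ^+ 2 = t ^+ 2 * (1 - x ^+ 2).
    by rewrite ac -[X in X - _]st mulr2n; ring.
  by rewrite sqrtrM ?sqr_ge0 // sqrtr_sqr ger0_norm.
have tE : Num.sqrt (1 - dotv c b ^+ 2) = s * Num.sqrt (1 - x ^+ 2).
  have -> : 1 - dotv c b ^+ 2 = s ^+ 2 * (1 - x ^+ 2).
    by rewrite cb -[X in X - _]st mulr2n; ring.
  by rewrite sqrtrM ?sqr_ge0 // sqrtr_sqr ger0_norm.
have cosE : cos (acos (dotv a c) + acos (dotv c b)) = x.
  rewrite cosD !acosK ?in_itv //= !sin_acos // sE tE ac cb.
  have -> : t * Num.sqrt (1 - x ^+ 2) * (s * Num.sqrt (1 - x ^+ 2)) =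
      s * t * (1 - x ^+ 2).
    by rewrite mulrACA -expr2 sqr_sqrtr // [t * s]mulrC.
  have -> : (s + t * x) * (s * x + t) - s * t * (1 - x ^+ 2) =
      x * (s ^+ 2 + t ^+ 2 + s * t * x *+ 2) by rewrite mulr2n; ring.
  by rewrite st mulr1.
by rewrite -cosE cosK // in_itv /= le andbT addr_ge0 // acos_ge0.
Qed.

Definition unitv u : 'rV[R]_m := (Num.sqrt (dotv u u))^-1 *: u.

Lemma unitv_unit u : u != 0 -> dotv (unitv u) (unitv u) = 1.
Proof.
move=> u0; have uu := dotv_gt0 u0.
by rewrite dotvZl dotvZr mulrA -invfM -expr2 sqr_sqrtr ?ltW // mulVf // gt_eqF.
Qed.

Lemma unitv_id u : dotv u u = 1 -> unitv u = u.
Proof. by move=> u1; rewrite /unitv u1 sqrtr1 invr1 scale1r. Qed.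

Lemma unitvZ k u : 0 < k -> unitv (k *: u) = unitv u.
Proof.
move=> k0; rewrite /unitv dotvZl dotvZr mulrA -expr2 sqrtrM ?sqr_ge0 // sqrtr_sqr.
by rewrite gtr0_norm // invfM scalerA mulrAC mulVf ?mul1r // gt_eqF.
Qed.
End Sphere.

(** * The simplicial maps between the two complexes *)

Section LinkMap.
Local Open Scope ring_scope.
Variables (R : realType) (n : nat) (p : 'I_n.+1 -> 'rV[R]_2).
Hypothesis hn : (2 <= n)%N.
Hypothesis hp : clockwise_convex_polygon p.
Notation V := 'I_n.+1.
Notation H := (hypergraph n).
Implicit Types (u v w m : V) (e f : {set V}) (tau sigma P Q : H) (x y z : coords R n).
Implicit Types (s : seq {set V}) (c : seq H).

Lemma rank_discrete : rank (discrete_partition n) = 0%N.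
Proof. by rewrite /rank card_discrete subnn. Qed.

Lemma rank_one_block : rank (one_block_partition n) = n.
Proof. by rewrite /rank cards1 subn1. Qed.

Lemma rank_le P : is_partition P -> (rank P <= n)%N.
Proof. by move/part_card_gt0; rewrite /rank; case: #|_| => // k _; rewrite subSS leq_subr. Qed.

Lemma rank_proper P : proper_part P -> (0 < rank P < n)%N.
Proof.
move/proper_part_card; rewrite /rank; move: #|_| => k /andP[h1 h2]; apply/andP.
by clear -h1 h2; lia.
Qed.

Lemma orthoscheme_dotE P Q :
  orthoscheme_dot R P Q = Num.min (rank P)%:R (rank Q)%:R.
Proof.
rewrite /orthoscheme_dot /orthoscheme_edge rank_discrete !sqr_sqrtr ?normr_ge0 //.
rewrite !subr0 !(ger0_norm (ler0n _ _)).
case: (leP (rank P)%:R ((rank Q)%:R : R)) => h.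
  by rewrite ger0_norm ?subr_ge0 //; lra.
by rewrite ltr0_norm ?subr_lt0 //; lra.
Qed.

(** These are the inner products of the indicator vectors of nested sets with rank P
    and rank Q elements, projected orthogonally to the constant vectors. *)
Lemma link_vertex_dotE P Q : is_partition P -> is_partition Q ->
  link_vertex_dot R P Q =
  Num.min (rank P)%:R (rank Q)%:R - (rank P)%:R * (rank Q)%:R / n%:R.
Proof.
move=> /rank_le hP /rank_le hQ; rewrite /link_vertex_dot !orthoscheme_dotE rank_one_block.
have minE k : (k <= n)%N -> Num.min (k%:R : R) n%:R = k%:R.
  by move=> kn; apply/min_idPl; rewrite ler_nat.
by rewrite !minE.
Qed.

Lemma link_vertex_dot_gt0 P Q : proper_part P -> proper_part Q ->
  0 < link_vertex_dot R P Q.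
Proof.
move=> hP hQ; have [pP _ _] := hP; have [pQ _ _] := hQ.
rewrite link_vertex_dotE //.
have n0 : 0 < n%:R :> R by rewrite ltr0n; lia.
have /andP[P0 Pn] := rank_proper hP; have /andP[Q0 Qn] := rank_proper hQ.
rewrite subr_gt0 ltr_pdivrMr //.
have {}P0 : 0 < (rank P)%:R :> R by rewrite ltr0n.
have {}Q0 : 0 < (rank Q)%:R :> R by rewrite ltr0n.
have {}Pn : (rank P)%:R < n%:R :> R by rewrite ltr_nat.
have {}Qn : (rank Q)%:R < n%:R :> R by rewrite ltr_nat.
by case: (leP ((rank P)%:R : R) (rank Q)%:R) => _; [rewrite ltr_pM2l|rewrite mulrC ltr_pM2l].
Qed.

Definition proper_supported y : Prop := forall P, y P != 0 -> proper_part P.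

Lemma link_dot_gt0 y : (forall P, 0 <= y P) -> proper_supported y ->
  (exists P, y P != 0) -> 0 < link_dot y y.
Proof.
move=> y0 yp [P yP].
have pos Q Q' : 0 <= y Q * y Q' * link_vertex_dot R Q Q'.
  have [->|yQ] := eqVneq (y Q) 0; first by rewrite !mul0r.
  have [->|yQ'] := eqVneq (y Q') 0; first by rewrite mulr0 mul0r.
  by rewrite !mulr_ge0 // ltW // link_vertex_dot_gt0 //; apply: yp.
rewrite /link_dot (bigD1 P) //= ltr_pwDl //; last first.
  by apply: sumr_ge0 => Q _; apply: sumr_ge0.
rewrite (bigD1 P) //= ltr_pwDl //; last by apply: sumr_ge0.
have yP0 : 0 < y P by rewrite lt_def yP y0.
by rewrite !mulr_gt0 // link_vertex_dot_gt0 //; apply: yp.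
Qed.

Lemma link_dotZ (k l : R) x y :
  link_dot (fun P => k * x P : R) (fun P => l * y P : R) = k * l * link_dot x y.
Proof.
rewrite /link_dot mulr_sumr; apply: eq_bigr => P _; rewrite mulr_sumr.
by apply: eq_bigr => Q _; ring.
Qed.

Lemma link_dot_supported y : link_dot y y = 1 -> exists P, y P != 0.
Proof.
move=> y1; apply/existsP; apply: contra_eqT y1; rewrite negb_exists => /forallP h.
have y0 P : y P = 0 by have := h P; rewrite negbK => /eqP.
suff -> : link_dot y y = 0 by rewrite eq_sym oner_neq0.
rewrite /link_dot big1 // => P _; rewrite big1 // => Q _.
by rewrite y0 !mul0r.
Qed.

Lemma link_simplex_supported c y : is_proper_chain p c -> link_simplex c y ->
  chain_supported y /\ proper_supported y.
Proof.
case=> hc cmp [y0 yc _].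
have inc P : y P != 0 -> P \in c.
  by move=> yP; apply/negPn/negP => /yc E; rewrite E eqxx in yP.
have prop P : y P != 0 -> proper_part P.
  by move/inc/hc => /(proper_noncrossing_partitionP hn hp)[].
split=> //; split=> // [P /prop[]//|P Q /inc hP /inc]; exact: cmp.
Qed.

Definition total_weight y : R := \sum_sigma vertex_weight y sigma.

(** This is the inverse of the homeomorphism. *)
Definition simplex_map y : coords R n := fun sigma => vertex_weight y sigma / total_weight y.

Lemma total_weight_gt0 y : chain_supported y -> proper_supported y -> (exists P, y P != 0) ->
  0 < total_weight y.
Proof. by case=> y0 _ _ yp [P yP]; exact: (vertex_weight_sum_gt0 y0 yP (yp P yP)). Qed.

Lemma simplex_map_Simplex tau y : noncrossing_tree tau -> Simplex tau y ->
  closed_simplex p tau (simplex_map y).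
Proof.
move=> nt [s ps ys]; have cp := ordering_chain_proper hn hp nt ps.
have [cy py] := link_simplex_supported cp ys; have [y0 yc y1] := ys.
have t0 := total_weight_gt0 cy py (link_dot_supported y1).
split.
- by move=> sigma; rewrite divr_ge0 ?(ltW t0) // vertex_weight_ge0.
- move=> sigma nv; rewrite /simplex_map.
  have [->|un] := eqVneq (vertex_weight y sigma) 0; first by rewrite mul0r.
  case: nv; have [v [m [P [vm sE yP pm]]]] := vertex_weight_support un.
  apply/(simplex_verticesP hn hp); exists v, m; split=> //.
  have : P \in ordering_chain s by apply/negPn/negP => /yc E; rewrite E eqxx in yP.
  case/mapP => j _ PE; apply: (predecessor_splits nt (prefix_initial j ps)).
  by rewrite -(predecessor_eq _ _ (adjacent_components _)) -PE.
- by rewrite -mulr_suml divff // gt_eqF.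
Qed.

Lemma partition_link_Simplex y : partition_link p y ->
  exists2 tau, noncrossing_tree tau & Simplex tau y.
Proof.
case=> c cp [y0 yc y1]; have [tau [s [nt ps sub]]] := proper_chain_ordering hn hp cp.
exists tau => //; exists s => //; split=> // P nP; apply: yc.
by apply: contra nP; apply: sub.
Qed.

Lemma Simplex_partition_link tau y : noncrossing_tree tau -> Simplex tau y -> partition_link p y.
Proof.
by move=> nt [s ps ys]; exists (ordering_chain s) => //; exact: (ordering_chain_proper hn hp nt ps).
Qed.

(** Proportional images come from proportional points, and both have norm 1. *)
Lemma simplex_map_inj y z : partition_link p y -> partition_link p z ->
  simplex_map y = simplex_map z -> y = z.
Proof.
move=> [c cp ys] [c' cp' zs] E.
have [cy py] := link_simplex_supported cp ys.
have [cz pz] := link_simplex_supported cp' zs.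
have [y0 _ y1] := ys; have [z0 _ z1] := zs.
have ty := total_weight_gt0 cy py (link_dot_supported y1).
have tz := total_weight_gt0 cz pz (link_dot_supported z1).
pose k := total_weight y / total_weight z; have k0 : 0 < k by rewrite divr_gt0.
pose z' : coords R n := fun P => k * z P.
have z'nz P : z' P != 0 -> z P != 0.
  by apply: contra_neq => E'; rewrite /z' E' mulr0.
have cz' : chain_supported z'.
  have [c1 c2 c3] := cz; split=> [P|P /z'nz|P Q /z'nz h /z'nz]; [|exact: c2|exact: c3].
  by rewrite mulr_ge0 ?(ltW k0).
have yz : y =1 z'.
  apply: (vertex_weight_inj hn cy cz') => // [P /z'nz /pz //|sigma].
  rewrite vertex_weightZ /k mulrAC -mulrA.
  have /(congr1 (fun x => x sigma)) := E; rewrite /simplex_map => E'.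
  by rewrite -E' mulrC divfK // gt_eqF.
have k1 : k = 1.
  have : k ^+ 2 = 1.
    have -> : k ^+ 2 = link_dot z' z' by rewrite link_dotZ z1 mulr1 expr2.
    by rewrite -y1; congr link_dot; apply/funext => P; rewrite yz.
  by move/eqP; rewrite sqrf_eq1 => /orP[/eqP//|/eqP h]; move: k0; rewrite h; lra.
by apply/funext => P; rewrite yz /z' k1 mul1r.
Qed.

Lemma closed_simplex_support tau x : closed_simplex p tau x ->
  [/\ forall sigma, 0 <= x sigma, vertex_support tau x & exists sigma, x sigma != 0].
Proof.
case=> x0 xv x1; split=> //.
  move=> sigma xs; apply/(simplex_verticesP hn hp); apply: contrapT => /xv E.
  by rewrite E eqxx in xs.
apply/existsP; apply: contra_eqT x1; rewrite negb_exists => /forallP h.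
suff -> : \sum_sigma x sigma = 0 by rewrite eq_sym oner_neq0.
by apply: big1 => sigma _; have := h sigma; rewrite negbK => /eqP.
Qed.

Definition normalize y : coords R n := fun P => (Num.sqrt (link_dot y y))^-1 * y P.

Lemma normalize_link s (x : H -> R) tau : noncrossing_tree tau -> proper_ordering tau s ->
  (forall sigma, 0 <= x sigma) -> vertex_support tau x -> (exists sigma, x sigma != 0) ->
  sorted (fun e f => height x f <= height x e) s ->
  let y := chain_point s (height x) in
  0 < link_dot y y /\ link_simplex (ordering_chain s) (normalize y).
Proof.
move=> nt ps x0 xs [sigma xsig] ss y.
have cy : chain_supported y := chain_point_supported ss.
have ych P : y P != 0 -> P \in ordering_chain s := @chain_point_support _ _ s (height x) P.
have [hc _] := ordering_chain_proper hn hp nt ps.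
have py : proper_supported y.
  by move=> P /ych /hc /(proper_noncrossing_partitionP hn hp)[].
have ynz : exists P, y P != 0.
  apply/existsP; move: xsig; apply: contraNT; rewrite negb_exists => /forallP h.
  have y0 P : y P = 0 by have := h P; rewrite negbK => /eqP.
  rewrite -(vertex_weight_chain_point nt ps xs) /vertex_weight big1 // => q _.
  by rewrite /weight big1 // => P _; rewrite -/y y0 mul0r.
have [y0 _ _] := cy; have d0 := link_dot_gt0 y0 py ynz.
split=> //; split.
- by move=> P; rewrite mulr_ge0 // invr_ge0 sqrtr_ge0.
- move=> P nP; rewrite /normalize (_ : y P = 0) ?mulr0 //.
  by apply/eqP/negPn/negP => /ych; rewrite (negbTE nP).
- rewrite link_dotZ -invfM -expr2 sqr_sqrtr ?ltW // mulVf // gt_eqF //.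
Qed.

Lemma simplex_map_chain_point s x tau : noncrossing_tree tau -> proper_ordering tau s ->
  closed_simplex p tau x ->
  sorted (fun e f => height x f <= height x e) s ->
  simplex_map (normalize (chain_point s (height x))) = x.
Proof.
move=> nt ps xt ss; have [x0 xs xnz] := closed_simplex_support xt.
have [d0 _] := normalize_link nt ps x0 xs xnz ss.
have [_ _ x1] := xt.
apply/funext => sigma; rewrite /simplex_map /total_weight /normalize.
rewrite vertex_weightZ (vertex_weight_chain_point nt ps xs).
under eq_bigr do rewrite vertex_weightZ (vertex_weight_chain_point nt ps xs).
rewrite -mulr_sumr x1 mulr1 [_^-1 * _]mulrC mulfK // invr_neq0 // gt_eqF //.
by rewrite sqrtr_gt0.
Qed.
End LinkMap.

(** * The homeomorphism *)

Section Topology.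
Local Open Scope classical_set_scope.

(** Over a compact set, the inverse of a continuous injection into a Hausdorff
    space is continuous: it pulls closed sets back to images of compact sets. *)
Lemma compact_inverse_continuous (X Y : topologicalType) (L : set Y) (C : set X)
    (g : Y -> X) (h : X -> Y) :
  hausdorff_space X -> compact L -> {within L, continuous g} ->
  set_fun C L h -> (forall x, C x -> g (h x) = x) -> (forall y, L y -> C (g y)) ->
  (forall y, L y -> h (g y) = y) ->
  {within C, continuous h}.
Proof.
move=> hX cL cg hf gh Cg hg; apply/continuous_closedP => F cF.
apply/closed_subspaceP; exists (g @` (L `&` F)).
  apply: compact_closed => //; apply: continuous_compact; last exact: compact_closedI.
  by apply: continuous_subspaceW cg => y [].
apply/seteqP; split=> x /=.
  by case=> [[y [Ly Fy] <-]] Cgy; split=> //; rewrite /preimage /from_subspace /= hg.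
by case=> Fx Cx; split=> //; exists (h x); rewrite ?gh //; split=> //; apply: hf.
Qed.

(** The product topology is the coarsest that makes the coordinates continuous. *)
Lemma prod_continuous_at (X : topologicalType) (I : Type)
    (K : I -> topologicalType) (F : X -> prod_topology K) (y : X) :
  (forall i, {for y, continuous (fun z => F z i)}) -> {for y, continuous F}.
Proof.
pose ev (i : I) := fun f : (forall i, K i) => f i.
move=> hF; apply/(@cvg_sup _ _ (fun i => Topological.class (initial_topology (ev i)))).
move=> i U /=; rewrite (@nbhsE (initial_topology (ev i))) => -[B [[C oC <-] CF] CU].
by apply: filterS CU _; apply: (hF i); exact: open_nbhs_nbhs.
Qed.

Local Open Scope ring_scope.
Variables (R : realType) (n : nat) (p : 'I_n.+1 -> 'rV[R]_2).
Hypothesis hn : (2 <= n)%N.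
Hypothesis hp : clockwise_convex_polygon p.
Notation H := (hypergraph n).
Implicit Types (tau sigma P Q : H) (x y z : coords R n).

Lemma coords_hausdorff : hausdorff_space (coords R n).
Proof. by apply: hausdorff_product => _; exact: Rhausdorff. Qed.

Lemma coord_continuous P : continuous (fun y : coords R n => y P : R).
Proof. exact: (@proj_continuous _ (fun=> R) P). Qed.

Lemma sum_continuous (I : finType) (D : pred I) (F : I -> coords R n -> R) :
  (forall i, D i -> continuous (F i)) -> continuous (fun y => \sum_(i | D i) F i y).
Proof.
by move=> hF; exact: (@continuous_big _ I _ _ D (@add_continuous R) _ (index_enum I) F hF).
Qed.

Lemma scale_continuous (F : coords R n -> R) (k : R) : continuous F ->
  continuous (fun y => F y * k).
Proof. by move=> cF y; exact: (cvgMr_tmp (b := k) (cF y)). Qed.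

Lemma vertex_weight_continuous sigma : continuous (fun y : coords R n => vertex_weight y sigma).
Proof.
apply: sum_continuous => q _; apply: sum_continuous => P _.
exact/scale_continuous/coord_continuous.
Qed.

Lemma link_dot_continuous : continuous (fun y : coords R n => link_dot y y).
Proof.
apply: sum_continuous => P _; apply: sum_continuous => Q _; apply: scale_continuous.
by move=> y; exact: (cvgM (@coord_continuous P y) (@coord_continuous Q y)).
Qed.

Lemma coords_continuous (F : coords R n -> coords R n) y :
  (forall sigma, {for y, continuous (fun z => F z sigma : R)}) -> {for y, continuous F}.
Proof.
by move=> hF; exact: prod_continuous_at.
Qed.

Lemma link_total_gt0 y : partition_link p y -> 0 < total_weight y.
Proof.
case=> c cp ys; have [cy py] := link_simplex_supported hn hp cp ys; have [_ _ y1] := ys.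
exact: total_weight_gt0 cy py (link_dot_supported y1).
Qed.

Lemma simplex_map_continuous : {within partition_link p, continuous (@simplex_map R n)}.
Proof.
apply: continuous_in_subspaceT => y /set_mem /link_total_gt0 t0.
have ct : continuous (fun z : coords R n => total_weight z).
  by apply: (@sum_continuous _ predT) => s _; apply: vertex_weight_continuous.
apply: coords_continuous => sigma.
have tn : total_weight y != 0 by rewrite gt_eqF.
exact: (cvgM (@vertex_weight_continuous sigma y) (cvgV tn (ct y))).
Qed.

Lemma partition_linkE : partition_link p =
  [set y | [/\ forall P, 0 <= y P, forall P, ~ proper_noncrossing_partition p P -> y P = 0,
     forall P Q, ~~ (refines P Q || refines Q P) -> y P * y Q = 0 & link_dot y y = 1]].
Proof.
apply/seteqP; split=> y /=.
  case=> c [hc cmp] [y0 yc y1]; split=> //.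
    by move=> P nP; apply: yc; apply/negP => /hc.
  move=> P Q nPQ; have [Pc|/yc->] := boolP (P \in c); last by rewrite mul0r.
  have [Qc|/yc->] := boolP (Q \in c); last by rewrite mulr0.
  by rewrite cmp in nPQ.
case=> y0 yp yc y1; exists (enum [pred P | y P != 0]); split=> //.
- move=> P; rewrite mem_enum inE => yP; apply: contrapT => /yp E.
  by rewrite E eqxx in yP.
- move=> P Q; rewrite !mem_enum !inE => yP yQ; apply: contraT => /yc /eqP.
  by rewrite mulf_eq0 (negbTE yP) (negbTE yQ).
- by move=> P; rewrite mem_enum inE negbK => /eqP.
Qed.

Lemma partition_link_closed : closed (partition_link p).
Proof.
rewrite partition_linkE.
have -> : [set y : coords R n | [/\ forall P, 0 <= y P,
     forall P, ~ proper_noncrossing_partition p P -> y P = 0,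
     forall P Q, ~~ (refines P Q || refines Q P) -> y P * y Q = 0 & link_dot y y = 1]] =
  (\bigcap_(P in setT) ((fun y : coords R n => y P) @^-1` [set t : R | 0 <= t])) `&`
  ((\bigcap_(P in [set P | ~ proper_noncrossing_partition p P])
     ((fun y : coords R n => y P) @^-1` [set t : R | t = 0])) `&`
  ((\bigcap_(q in [set q : H * H | ~~ (refines q.1 q.2 || refines q.2 q.1)])
     ((fun y : coords R n => y q.1 * y q.2) @^-1` [set t : R | t = 0])) `&`
  ((fun y : coords R n => link_dot y y) @^-1` [set t : R | t = 1]))).
  apply/seteqP; split=> y /=.
    case=> y0 yp yc y1; split; first by move=> P _; exact: y0.
    split; first by move=> P hP; exact: yp.
    by split=> // -[P Q] /= h; exact: yc.
  by case=> y0 [yp [yc y1]]; split=> // [P|P Q nPQ]; [exact: y0|exact: (yc (P, Q))].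
have cl (F : coords R n -> R) (T : set R) : continuous F -> closed T -> closed (F @^-1` T).
  by move=> cF cT; move/continuous_closedP: cF; apply.
apply: closedI; first by apply: closed_bigI => P _; apply: cl; [exact: coord_continuous|exact: closed_ge].
apply: closedI; first by apply: closed_bigI => P _; apply: cl; [exact: coord_continuous|exact: closed_eq].
apply: closedI; last by apply: cl; [exact: link_dot_continuous|exact: closed_eq].
apply: closed_bigI => q _; apply: cl; last exact: closed_eq.
by move=> y; exact: (cvgM (@coord_continuous q.1 y) (@coord_continuous q.2 y)).
Qed.

(** The diagonal coefficients of the inner product bound every coordinate. *)
Lemma partition_link_bounded y P : partition_link p y ->
  y P <= \sum_(Q : H) (1 + `|(link_vertex_dot R Q Q)^-1|).
Proof.
case=> c cp ys; have [[y0 _ _] py] := link_simplex_supported hn hp cp ys.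
have [_ _ y1] := ys.
have t0 Q : 0 <= 1 + `|(link_vertex_dot R Q Q)^-1| by rewrite addr_ge0.
rewrite (bigD1 P) //= -[y P]addr0 lerD //; last exact: sumr_ge0.
have [->|yP] := eqVneq (y P) 0; first exact: t0.
have pP := py P yP; have k0 : 0 < link_vertex_dot R P P by apply: link_vertex_dot_gt0.
have yP0 : 0 < y P by rewrite lt_def yP y0.
have : y P * y P * link_vertex_dot R P P <= 1.
  rewrite -y1 /link_dot (bigD1 P) //= (bigD1 P) //= -addrA lerDl.
  have ge Q Q' : 0 <= y Q * y Q' * link_vertex_dot R Q Q'.
    have [->|yQ] := eqVneq (y Q) 0; first by rewrite !mul0r.
    have [->|yQ'] := eqVneq (y Q') 0; first by rewrite mulr0 mul0r.
    by rewrite !mulr_ge0 // ltW // link_vertex_dot_gt0 //; apply: py.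
  by apply: addr_ge0; [|apply: sumr_ge0 => Q _]; apply: sumr_ge0.
rewrite -ler_pdivlMr // mul1r => h.
have i0 : 0 < (link_vertex_dot R P P)^-1 by rewrite invr_gt0.
rewrite (gtr0_norm i0).
have [le1|gt1] := leP (y P) 1; first by apply: (le_trans le1); rewrite lerDl ltW.
apply: le_trans (le_trans h _); last by rewrite lerDr.
by rewrite ler_peMr // ltW.
Qed.

Lemma partition_link_compact : compact (partition_link p).
Proof.
pose B := \sum_(Q : H) (1 + `|(link_vertex_dot R Q Q)^-1|).
apply: (subclosed_compact partition_link_closed
  (@tychonoff _ (fun=> R) (fun=> `[0, B]%classic) (fun _ : H => @segment_compact R 0 B))).
move=> y Ly P /=; rewrite in_itv /= partition_link_bounded // andbT.
by move: Ly; rewrite partition_linkE => -[].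
Qed.

Definition link_of x : coords R n := get [set y | partition_link p y /\ simplex_map y = x].

Lemma simplex_map_onto tau x : noncrossing_tree tau -> closed_simplex p tau x ->
  exists2 y, Simplex tau y & simplex_map y = x.
Proof.
move=> nt xt; have [x0 xs xnz] := closed_simplex_support hn hp xt.
have [s [ps ss]] := proper_ordering_exists nt (fun e f => height_mono nt x0 xs).
exists (normalize (chain_point s (height x))).
  by exists s => //; have [] := normalize_link hn hp nt ps x0 xs xnz ss.
exact: (simplex_map_chain_point hn hp nt ps xt ss).
Qed.

Lemma link_ofK x : hypertree_complex p x ->
  partition_link p (link_of x) /\ simplex_map (link_of x) = x.
Proof.
case=> tau /(noncrossing_hypertreeP hn hp) nt xt.
have [y ys yx] := simplex_map_onto nt xt.
have : [set y | partition_link p y /\ simplex_map y = x] y.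
  by split=> //; exact: (Simplex_partition_link hn hp nt ys).
exact: getI.
Qed.

Lemma simplex_map_complex y : partition_link p y -> hypertree_complex p (simplex_map y).
Proof.
move=> /(partition_link_Simplex hn hp)[tau nt ys]; exists tau.
  exact/(noncrossing_hypertreeP hn hp).
exact: (simplex_map_Simplex hn hp nt ys).
Qed.

Lemma link_of_simplex_map y : partition_link p y -> link_of (simplex_map y) = y.
Proof.
move=> Ly; have [L1 E] := link_ofK (simplex_map_complex Ly).
exact: (simplex_map_inj hn hp L1 Ly E).
Qed.

Lemma link_of_homeomorphism :
  homeomorphism_between (hypertree_complex p) (partition_link p) link_of.
Proof.
split.
- split=> [x /link_ofK[]//|x x' /set_mem/link_ofK[_ E] /set_mem/link_ofK[_ E'] h|y Ly].
    by rewrite -E -E' h.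
  exists (simplex_map y); first exact: simplex_map_complex.
  exact: link_of_simplex_map.
- apply: (@compact_inverse_continuous (coords R n) (coords R n) (partition_link p) _ (@simplex_map R n)).
  + exact: coords_hausdorff.
  + exact: partition_link_compact.
  + exact: simplex_map_continuous.
  + by move=> x /link_ofK[].
  + by move=> x /link_ofK[].
  + exact: simplex_map_complex.
  + exact: link_of_simplex_map.
- exists (@simplex_map R n); split; first exact: simplex_map_continuous.
  by move=> x /link_ofK[].
Qed.

Lemma link_of_Simplex tau : noncrossing_tree tau -> link_of @` closed_simplex p tau = Simplex tau.
Proof.
move=> nt; apply/seteqP; split=> [_ [x xt <-]|y ys].
  have [y ys <-] := simplex_map_onto nt xt.
  by rewrite link_of_simplex_map //; exact: (Simplex_partition_link hn hp nt ys).
exists (simplex_map y); first exact: (simplex_map_Simplex hn hp nt ys).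
by apply: link_of_simplex_map; exact: (Simplex_partition_link hn hp nt ys).
Qed.
End Topology.

(** * The metric of the link *)

Section Metric.
Local Open Scope ring_scope.
Variables (R : realType) (n : nat) (p : 'I_n.+1 -> 'rV[R]_2).
Hypothesis hn : (2 <= n)%N.
Hypothesis hp : clockwise_convex_polygon p.
Variable tau : hypergraph n.
Hypothesis nt : noncrossing_tree tau.
Notation V := 'I_n.+1.
Notation H := (hypergraph n).
Notation m := (size (spokes tau)).
Implicit Types (sigma P Q : H) (x y z : coords R n) (a b c : H -> R).
Implicit Types (e f : {set V}) (s : seq {set V}).

Definition center (u : 'rV[R]_m) : 'rV[R]_m := \row_i (u 0 i - (\sum_j u 0 j) / n%:R).

Lemma n_neq0 : n%:R != 0 :> R. Proof. by rewrite pnatr_eq0; case: n hn. Qed.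

Lemma natr_spokes : m%:R = n%:R :> R. Proof. by rewrite (size_spokes nt). Qed.

Lemma center_sum (I : finType) (k : I -> R) (u : I -> 'rV[R]_m) :
  center (\sum_i k i *: u i) = \sum_i k i *: center (u i).
Proof.
apply/rowP => j; rewrite !mxE !summxE.
under eq_bigr do rewrite mxE.
under [X in _ - X / _]eq_bigr do rewrite summxE.
rewrite exchange_big /= mulr_suml -sumrB; apply: eq_bigr => i _.
rewrite !mxE; under eq_bigr do rewrite mxE.
by rewrite -mulr_sumr mulrBr mulrA.
Qed.

Lemma center_const (k : R) (u : 'rV[R]_m) : center (\row_i (u 0 i - k)) = center u.
Proof.
apply/rowP => j; rewrite !mxE; under eq_bigr do rewrite mxE.
rewrite sumrB sumr_const card_ord mulrBl -[k *+ _]mulr_natr natr_spokes mulfK ?n_neq0 //.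
by rewrite opprB addrA subrK.
Qed.

Lemma dot_center (u v : 'rV[R]_m) :
  dotv (center u) (center v) = dotv u v - (\sum_i u 0 i) * (\sum_i v 0 i) / n%:R.
Proof.
rewrite /dotv; set U := \sum_i u 0 i; set W := \sum_i v 0 i.
transitivity (\sum_i (u 0 i * v 0 i - (W / n%:R) * u 0 i - (U / n%:R) * v 0 i + (U / n%:R) * (W / n%:R))).
  by apply: eq_bigr => i _; rewrite !mxE -/U -/W; ring.
rewrite big_split /= !sumrB -!mulr_sumr -/U -/W sumr_const card_ord.
by rewrite -[_ *+ m]mulr_natr natr_spokes; field; rewrite n_neq0.
Qed.

Definition redundancy_vector P : 'rV[R]_m := \row_i (redundant tau P i)%:R.

(** The linear extension of the retraction: a partition goes to the indicator
    vector of its redundant spokes, projected to the sum-zero space. *)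
Definition unfold y : 'rV[R]_m := \sum_P (y P : R) *: center (redundancy_vector P).

Lemma redvec_dot P Q : is_partition P -> is_partition Q -> refines P Q || refines Q P ->
  dotv (center (redundancy_vector P)) (center (redundancy_vector Q)) = link_vertex_dot R P Q.
Proof.
move=> pP pQ cmp.
have sum P' : is_partition P' -> \sum_i redundancy_vector P' 0 i = (rank P')%:R.
  move=> pP'; rewrite -(redundant_count nt pP') natr_sum.
  by apply: eq_bigr => i _; rewrite mxE.
rewrite dot_center !sum // link_vertex_dotE //; congr (_ - _).
wlog rf : P Q pP pQ cmp / refines P Q.
  move=> hw; case/orP: (cmp) => [|rf]; first exact: hw.
  by rewrite dotvC minC; apply: hw; rewrite // orbC.
have le : (rank P <= rank Q)%N.
  rewrite -(redundant_count nt pP) -(redundant_count nt pQ); apply: leq_sum => i _.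
  by have := redundant_mono (tau := tau) (i := i) pP pQ rf; case: redundant => //; case: redundant => // /(_ isT).
rewrite (min_idPl _) ?ler_nat // -sum //; apply: eq_bigr => i _; rewrite !mxE.
have := redundant_mono (tau := tau) (i := i) pP pQ rf; case: (redundant tau P i); last by rewrite mul0r.
by move=> -> //; rewrite mulr1.
Qed.

Lemma unfold_dot y z :
  (forall P Q, y P != 0 -> z Q != 0 -> [/\ is_partition P, is_partition Q & refines P Q || refines Q P]) ->
  dotv (unfold y) (unfold z) = link_dot y z.
Proof.
move=> h; rewrite /unfold /link_dot.
have suml (F : H -> 'rV[R]_m) w : dotv (\sum_P F P) w = \sum_P dotv (F P) w.
  rewrite /dotv exchange_big /=; apply: eq_bigr => i _.
  by rewrite summxE mulr_suml.
rewrite suml; apply: eq_bigr => P _; rewrite dotvC suml; apply: eq_bigr => Q _.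
rewrite dotvC dotvZl dotvZr mulrA.
have [->|yP] := eqVneq (y P) 0; first by rewrite !mul0r.
have [->|zQ] := eqVneq (z Q) 0; first by rewrite !(mulr0, mul0r).
by have [pP pQ cmp] := h P Q yP zQ; rewrite redvec_dot.
Qed.

Lemma unfold_link_simplex cs y z : is_proper_chain p cs ->
  link_simplex cs y -> link_simplex cs z -> dotv (unfold y) (unfold z) = link_dot y z.
Proof.
case=> hc cmp [_ yc _] [_ zc _]; apply: unfold_dot => P Q yP zQ.
have Pc : P \in cs by apply: contraT => /yc E; rewrite E eqxx in yP.
have Qc : Q \in cs by apply: contraT => /zc E; rewrite E eqxx in zQ.
have pp P' : P' \in cs -> is_partition P'.
  by move/hc => /(proper_noncrossing_partitionP hn hp)[[]].
by split; [exact: pp|exact: pp|exact: cmp].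
Qed.

Lemma unfold_unit y : partition_link p y -> dotv (unfold y) (unfold y) = 1.
Proof. by case=> cs cp ys; rewrite (unfold_link_simplex cp ys ys); case: ys. Qed.

(** Being isometric on every simplex, the retraction to the sphere does not
    increase the length of strings. *)
Lemma string_length_ge x (s : seq (coords R n)) y : partition_link p x -> is_string p x s y ->
  partition_link p y /\ acos (dotv (unfold x) (unfold y)) <= string_length x s.
Proof.
elim: s x => [|z s IH] x Lx /=.
  by move=> <-; split=> //; rewrite unfold_unit // acos1.
case=> -[cs cp [xs zs]] zy.
have Lz : partition_link p z by exists cs.
have [Ly le] := IH z Lz zy; split=> //.
rewrite -(unfold_link_simplex cp xs zs).
apply: le_trans (spherical_triangle (unfold_unit Lx) (unfold_unit Lz) (unfold_unit Ly)) _.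
by rewrite lerD2l.
Qed.

Lemma string_cat x (s : seq (coords R n)) y (s' : seq (coords R n)) z : is_string p x s y -> is_string p y s' z ->
  is_string p x (s ++ s') z /\
  string_length x (s ++ s') = string_length x s + string_length y s'.
Proof.
elim: s x => [|w s IH] x /=; first by move=> <- h; rewrite add0r.
by case=> xw wy yz; have [h1 h2] := IH w wy yz; split=> //; rewrite h2 addrA.
Qed.

Definition heights a : 'rV[R]_m := center (\row_i height a (spoke tau i).1).

Definition vertex_heights sigma : 'rV[R]_m :=
  center (\row_i (in_low_half sigma (spoke tau i).1)%:R).

Lemma heightsE a : heights a = \sum_sigma a sigma *: vertex_heights sigma.
Proof.
rewrite -center_sum; congr center; apply/rowP => i; rewrite mxE summxE.
by apply: eq_bigr => sigma _; rewrite !mxE.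
Qed.

(** The projection forgets a common constant, which does not matter because the
    coordinates are differences of heights. *)
Lemma heights_inj a : vertex_support tau a -> heights a = 0 -> a =1 (fun=> 0).
Proof.
move=> sa h0.
have [s [ps _]] := @proper_ordering_exists n R tau (fun=> 0) nt (fun _ _ _ => lexx _).
apply: (height_const nt ps (k := (\sum_(j < m) height a (spoke tau j).1) / n%:R) sa).
move=> e et; have [i im <-] := spoke_of nt et.
have := congr1 (fun u : 'rV[R]_m => u 0 (Ordinal im)) h0; rewrite !mxE /= => /eqP.
rewrite subr_eq0 => /eqP ->; congr (_ / _); apply: eq_bigr => j _; by rewrite mxE.
Qed.

(** For a union S of hyperedges of tau, the redundant spokes are those of the
    hyperedges in S; the sum of the gaps between heights telescopes. *)
Lemma unfold_chain_point s a : proper_ordering tau s ->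
  unfold (chain_point s (height a)) = heights a.
Proof.
move=> ps; have [ms us] := proper_ordering_mem ps.
pose k := height a (nth finset.set0 s (size s).-1).
rewrite /heights -(center_const k) /unfold -center_sum; congr center.
apply/rowP => i; rewrite !mxE summxE.
have [et _ _ _] := spokeP nt (ltn_ord i).
set e := (spoke tau i).1 in et *.
under eq_bigr do rewrite !mxE.
rewrite (sum_chain_point s (height a) (fun P => (redundant tau P i)%:R)).
have es : (index e s < size s)%N by rewrite index_mem ms.
have s0 : (0 < size s)%N by apply: leq_ltn_trans es.
rewrite -(nth_index finset.set0 (_ : e \in s)) ?ms //.
rewrite -(@telescope_window R (fun j => height a (nth finset.set0 s j)) (index e s) (size s).-1 (size s)); last first.
  by apply/andP; split; [rewrite -ltnS|]; rewrite prednK.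
rewrite big_nat [RHS]big_nat; apply: eq_bigr => j /andP[j1 js]; congr (_ * _).
rewrite (redundant_components nt (ltn_ord i) (prefix_sub j ps)) -/e.
have -> : (j <= (size s).-1)%N by rewrite -ltnS prednK.
by rewrite (proper_ordering_prefix _ ps) // andbT.
Qed.

Definition cone a : Prop :=
  [/\ forall sigma, 0 <= a sigma, vertex_support tau a & exists sigma, a sigma != 0].

Definition barycentric a : coords R n := fun sigma => a sigma / \sum_sigma a sigma.

Definition link_point a : coords R n := link_of p (barycentric a).

Lemma cone_sum_gt0 a : cone a -> 0 < \sum_sigma a sigma.
Proof.
case=> a0 _ [sigma as0]; rewrite (bigD1 sigma) //= ltr_pwDl //; last exact: sumr_ge0.
by rewrite lt_def as0 a0.
Qed.

Lemma cone_heights_neq0 a : cone a -> heights a != 0.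
Proof.
case=> _ sa [sigma as0]; apply: contraNneq as0 => h0.
by rewrite (heights_inj sa h0).
Qed.

Lemma link_point_chain a s : cone a -> proper_ordering tau s ->
  sorted (fun e f => height a f <= height a e) s ->
  link_point a = normalize (chain_point s (height a)) /\
  link_simplex (ordering_chain s) (link_point a).
Proof.
move=> ca ps ss; have [a0 sa ex] := ca.
have [d0 ls] := normalize_link hn hp nt ps a0 sa ex ss.
suff E : link_point a = normalize (chain_point s (height a)) by rewrite E.
have Ly : partition_link p (normalize (chain_point s (height a))).
  by exists (ordering_chain s) => //; exact: (ordering_chain_proper hn hp nt ps).
rewrite -[RHS](link_of_simplex_map hn hp Ly); congr (link_of p _).
have k0 : (Num.sqrt (link_dot (chain_point s (height a) : coords R n) (chain_point s (height a))))^-1 != 0.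
  by rewrite invr_neq0 // gt_eqF // sqrtr_gt0.
apply/funext => sigma; rewrite /simplex_map /total_weight /normalize vertex_weightZ (vertex_weight_chain_point nt ps sa).
under [in RHS]eq_bigr do rewrite vertex_weightZ (vertex_weight_chain_point nt ps sa).
by rewrite -mulr_sumr -mulf_div divff // mul1r.
Qed.

Lemma cone_ordering a : cone a -> exists s, proper_ordering tau s /\
  sorted (fun e f => height a f <= height a e) s.
Proof.
case=> a0 sa _; exact: (proper_ordering_exists nt (fun e f => height_mono nt a0 sa)).
Qed.

Lemma unfoldZ (k : R) y : unfold (fun P => k * y P : R) = k *: unfold y.
Proof. by rewrite scaler_sumr; apply: eq_bigr => P _; rewrite scalerA. Qed.

Lemma unfold_link_point a : cone a -> unfold (link_point a) = unitv (heights a).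
Proof.
move=> ca; have [s [ps ss]] := cone_ordering ca.
have [-> _] := link_point_chain ca ps ss; rewrite /normalize unfoldZ unfold_chain_point //.
rewrite /unitv -(unfold_chain_point a ps); congr (_^-1 *: _); congr Num.sqrt.
apply/esym; apply: unfold_dot => P Q /chain_point_support hP /chain_point_support hQ.
split; [exact: ordering_chain_part hP|exact: ordering_chain_part hQ|].
exact: ordering_chain_comparable hP hQ.
Qed.

Lemma link_point_link a : cone a -> partition_link p (link_point a).
Proof.
move=> ca; have [s [ps ss]] := cone_ordering ca; have [_ ls] := link_point_chain ca ps ss.
by exists (ordering_chain s) => //; exact: (ordering_chain_proper hn hp nt ps).
Qed.

Lemma height_comb a b (k l : R) e :
  height (fun sigma => k * a sigma + l * b sigma) e = k * height a e + l * height b e.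
Proof.
rewrite /height !mulr_sumr -big_split /=; apply: eq_bigr => sigma _; ring.
Qed.

Lemma heights_comb a b (k l : R) :
  heights (fun sigma => k * a sigma + l * b sigma) = k *: heights a + l *: heights b.
Proof.
rewrite !heightsE !scaler_sumr -big_split /=; apply: eq_bigr => sigma _.
by rewrite scalerDl !scalerA.
Qed.

Lemma cone_comb a b (k l : R) : 0 < k -> 0 < l -> cone a -> cone b ->
  cone (fun sigma => k * a sigma + l * b sigma).
Proof.
move=> k0 l0 [a0 sa [sigma as0]] [b0 sb _]; split.
- by move=> s; rewrite addr_ge0 // mulr_ge0 // ltW.
- move=> s h; have [/sa//|a0'] := boolP (a s != 0).
  by apply: sb; apply: contraNneq h => ->; move: a0'; rewrite negbK => /eqP ->; rewrite !mulr0 addr0.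
- exists sigma; rewrite gt_eqF // ltr_pwDl ?mulr_ge0 ?(ltW l0) // mulr_gt0 //.
  by rewrite lt_def as0 a0.
Qed.

Definition opposite_pairs a b := [set q : {set V} * {set V} |
  (height a q.1 - height a q.2) * (height b q.1 - height b q.2) < 0]%SET.

(** If no two hyperedges are ordered in opposite ways by the heights of a and b,
    then sorting by the sum of the heights puts both points in one simplex;
    otherwise the segment is cut where two such heights become equal. *)
Lemma geodesic_string a b : cone a -> cone b -> exists s : seq (coords R n),
  is_string p (link_point a) s (link_point b) /\
  string_length (link_point a) s <= acos (dotv (unitv (heights a)) (unitv (heights b))).
Proof.
have [k] := ubnP #|opposite_pairs a b|; elim: k a b => // k IH a b; rewrite ltnS => le ca cb.
have [none|] := eqVneq (opposite_pairs a b) finset.set0.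
  have nop e f : 0 <= (height a e - height a f) * (height b e - height b f).
    rewrite leNgt; apply/negP => lt0.
    have : (e, f) \in opposite_pairs a b by rewrite inE.
    by rewrite none inE.
  have cab := cone_comb ltr01 ltr01 ca cb.
  have [s [ps ss]] := cone_ordering cab.
  have sa : sorted (fun e f => height a f <= height a e) s.
    apply: sub_sorted ss => e f; rewrite !height_comb !mul1r => h.
    by have := nop e f; rewrite leNgt; apply: contraNle => lt; nra.
  have sb : sorted (fun e f => height b f <= height b e) s.
    apply: sub_sorted ss => e f; rewrite !height_comb !mul1r => h.
    by have := nop e f; rewrite leNgt; apply: contraNle => lt; nra.
  have [_ la] := link_point_chain ca ps sa; have [_ lb] := link_point_chain cb ps sb.
  have cp := ordering_chain_proper hn hp nt ps.
  exists [:: link_point b]; split; first by split=> //; exists (ordering_chain s).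
  rewrite /= addr0 -(unfold_link_simplex cp la lb).
  by rewrite !unfold_link_point.
case/set0Pn => -[e f]; rewrite inE /= => lt0.
set A := height a e - height a f in lt0; set B := height b e - height b f in lt0.
have A0 : A != 0 by apply: contraTneq lt0 => ->; rewrite mul0r ltxx.
have B0 : B != 0 by apply: contraTneq lt0 => ->; rewrite mulr0 ltxx.
(* with these weights e and f get equal heights, since the differences of their
   heights for a and for b have opposite signs *)
pose c := fun sigma : H => `|B| * a sigma + `|A| * b sigma.
have nB : 0 < `|B| by rewrite normr_gt0.
have nA : 0 < `|A| by rewrite normr_gt0.
have cc : cone c := cone_comb nB nA ca cb.
have cE : height c e - height c f = 0.
  rewrite !height_comb.
  have -> : `|B| * height a e + `|A| * height b e - (`|B| * height a f + `|A| * height b f)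
     = `|B| * A + `|A| * B by rewrite /A /B; ring.
  move: lt0; have [A1|A1] := ltP 0 A.
    by rewrite pmulr_rlt0 // => B1; rewrite (gtr0_norm A1) (ltr0_norm B1); ring.
  have {}A1 : A < 0 by rewrite lt_def eq_sym A0 A1.
  by rewrite nmulr_rlt0 // => B1; rewrite (ltr0_norm A1) (gtr0_norm B1); ring.
have sub1 : opposite_pairs a c \proper opposite_pairs a b.
  apply/properP; split.
    apply/fintype.subsetP => -[e' f']; rewrite !inE /= !height_comb.
    set X := height a e'; set X' := height a f'; set Y := height b e'; set Y' := height b f'.
    have -> : (X - X') * (`|B| * X + `|A| * Y - (`|B| * X' + `|A| * Y')) =
       `|B| * (X - X') ^+ 2 + `|A| * ((X - X') * (Y - Y')) by ring.
    move=> h; rewrite -(pmulr_rlt0 _ nA).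
    by apply: le_lt_trans h; rewrite lerDr mulr_ge0 ?sqr_ge0 // ltW.
  exists (e, f); rewrite !inE //= cE mulr0 ltxx //.
have sub2 : opposite_pairs c b \proper opposite_pairs a b.
  apply/properP; split.
    apply/fintype.subsetP => -[e' f']; rewrite !inE /= !height_comb.
    set X := height a e'; set X' := height a f'; set Y := height b e'; set Y' := height b f'.
    have -> : (`|B| * X + `|A| * Y - (`|B| * X' + `|A| * Y')) * (Y - Y') =
       `|A| * (Y - Y') ^+ 2 + `|B| * ((X - X') * (Y - Y')) by ring.
    move=> h; rewrite -(pmulr_rlt0 _ nB).
    by apply: le_lt_trans h; rewrite lerDr mulr_ge0 ?sqr_ge0 // ltW.
  exists (e, f); rewrite !inE //= cE mul0r ltxx //.
have [s1 [st1 l1]] := IH a c (leq_trans (proper_card sub1) le) ca cc.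
have [s2 [st2 l2]] := IH c b (leq_trans (proper_card sub2) le) cc cb.
have [st len] := string_cat st1 st2.
exists (s1 ++ s2); split=> //; rewrite len; apply: le_trans (lerD l1 l2) _.
have a1 := unitv_unit (cone_heights_neq0 ca); have b1 := unitv_unit (cone_heights_neq0 cb).
have c1 := unitv_unit (cone_heights_neq0 cc).
have sq (u : 'rV[R]_m) : u != 0 -> 0 < Num.sqrt (dotv u u) by move=> u0; rewrite sqrtr_gt0 dotv_gt0.
have ga := sq (heights a) (cone_heights_neq0 ca); have gb := sq (heights b) (cone_heights_neq0 cb).
have gc := sq (heights c) (cone_heights_neq0 cc).
apply: (@spherical_between _ _ _ _ _
  ((Num.sqrt (dotv (heights c) (heights c)))^-1 * (`|B| * Num.sqrt (dotv (heights a) (heights a))))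
  ((Num.sqrt (dotv (heights c) (heights c)))^-1 * (`|A| * Num.sqrt (dotv (heights b) (heights b))))) => //.
rewrite -!scalerA -scalerDr /unitv; congr (_ *: _).
by rewrite heights_comb !scalerA mulfK ?gt_eqF // mulfK ?gt_eqF // .
Qed.

Lemma link_dist_heights a b : cone a -> cone b ->
  link_dist p (link_point a) (link_point b) =
  (acos (dotv (unitv (heights a)) (unitv (heights b))))%:E.
Proof.
move=> ca cb; apply/eqP; rewrite eq_le; apply/andP; split.
  have [s [st le]] := geodesic_string ca cb.
  apply: (@le_trans _ _ (string_length (link_point a) s)%:E); last by rewrite lee_fin.
  by apply: ereal_inf_lbound; exists s.
apply: le_ereal_inf_tmp => _ [s st <-]; rewrite lee_fin.
have [_] := string_length_ge (link_point_link ca) st.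
by rewrite !unfold_link_point.
Qed.
End Metric.

(** * The spherical simplices *)

Section SphericalSimplex.
Local Open Scope classical_set_scope.
Local Open Scope ring_scope.
Variables (R : realType) (n : nat) (p : 'I_n.+1 -> 'rV[R]_2).
Hypothesis hn : (2 <= n)%N.
Hypothesis hp : clockwise_convex_polygon p.
Variable tau : hypergraph n.
Hypothesis nt : noncrossing_tree tau.
Notation H := (hypergraph n).
Notation m := (size (spokes tau)).
Implicit Types (sigma P Q : H) (x y z : coords R n) (a b c : H -> R).

Lemma refines_trans sigma rho pi : refines (n := n) sigma rho -> refines rho pi -> refines sigma pi.
Proof.
move=> /forallP h1 /forallP h2; apply/forallP => e; apply/implyP => es.
have /implyP/(_ es)/'exists_andP[f [fr ef]] := h1 e.
have /implyP/(_ fr)/'exists_andP[g [gp fg]] := h2 f.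
by apply/'exists_andP; exists g; split=> //; apply: fintype.subset_trans fg.
Qed.

Lemma refines_refl sigma : refines sigma sigma.
Proof. by apply/forallP => e; apply/implyP => es; apply/'exists_andP; exists e. Qed.

Lemma simplex_vertices_sub tau' : refines tau tau' ->
  simplex_vertices p tau' `<=` simplex_vertices p tau.
Proof. by move=> r sigma [h1 h2 h3]; split=> //; apply: refines_trans h3. Qed.

Lemma closed_simplex_cone x : closed_simplex p tau x -> cone tau x.
Proof. by move/(closed_simplex_support hn hp). Qed.

Lemma barycentric_id x : closed_simplex p tau x -> barycentric x = x.
Proof. by case=> _ _ x1; apply/funext => sigma; rewrite /barycentric x1 divr1. Qed.

Lemma vertex_support_of a :
  (forall sigma, ~ simplex_vertices p tau sigma -> a sigma = 0) -> vertex_support tau a.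
Proof.
move=> h sigma as0; apply/(simplex_verticesP hn hp); apply: contrapT => /h E.
by rewrite E eqxx in as0.
Qed.

Definition vertex_point sigma : 'rV[R]_m := unitv (vertex_heights R tau sigma).

Lemma vertex_heights_neq0 sigma : simplex_vertices p tau sigma ->
  vertex_heights R tau sigma != 0.
Proof.
move=> vs; pose a s := (s == sigma)%:R : R.
have sa : vertex_support tau a.
  apply: vertex_support_of => s ns; rewrite /a; case: eqP => // E.
  by case: ns; rewrite E.
apply/eqP => h0; have : heights tau a = 0.
  rewrite heightsE (bigD1 sigma) //= /a eqxx scale1r h0 add0r big1 // => s /negbTE->.
  by rewrite scale0r.
by move/(heights_inj nt sa)/(_ sigma)/eqP; rewrite /a eqxx oner_eq0.
Qed.

Lemma vertex_heights_norm sigma : simplex_vertices p tau sigma ->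
  0 < Num.sqrt (dotv (vertex_heights R tau sigma) (vertex_heights R tau sigma)).
Proof. by move=> vs; rewrite sqrtr_gt0 dotv_gt0 // vertex_heights_neq0. Qed.

Lemma vertex_points_comb a :
  \sum_sigma a sigma *: vertex_point sigma =
  heights tau (fun s => a s *
    (Num.sqrt (dotv (vertex_heights R tau s) (vertex_heights R tau s)))^-1).
Proof. by rewrite heightsE; apply: eq_bigr => s _; rewrite /vertex_point scalerA. Qed.

Lemma vertex_points_independent :
  linearly_independent_on (simplex_vertices p tau) vertex_point.
Proof.
move=> a a0; rewrite vertex_points_comb => h0 sigma.
have [vs|/a0//] := pselect (simplex_vertices p tau sigma).
set b := (fun s => a s * _) in h0.
have sb : vertex_support tau b by apply: vertex_support_of => s /a0 E; rewrite /b E mul0r.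
have /eqP := heights_inj nt sb h0 sigma; rewrite mulf_eq0 invr_eq0.
by rewrite (gt_eqF (vertex_heights_norm vs)) orbF => /eqP.
Qed.

Definition spherical_chart x : 'rV[R]_m := unfold tau (link_of p x).

Lemma spherical_chartE x : closed_simplex p tau x ->
  spherical_chart x = unitv (heights tau x).
Proof.
move=> xt; have := unfold_link_point hn hp nt (closed_simplex_cone xt).
by rewrite /link_point barycentric_id.
Qed.

Lemma heights_cone_comb x : heights tau x =
  \sum_sigma (x sigma * Num.sqrt (dotv (vertex_heights R tau sigma) (vertex_heights R tau sigma)))
     *: vertex_point sigma.
Proof.
rewrite heightsE; apply: eq_bigr => s _; rewrite /vertex_point /unitv scalerA.
have [->|v0] := eqVneq (vertex_heights R tau s) 0; first by rewrite !scaler0.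
by rewrite mulfK // gt_eqF // sqrtr_gt0 dotv_gt0.
Qed.

(** Heights are linear in the coordinates, so that the cone over the closed simplex
    of tau' goes to the cone spanned by the heights of its vertices. *)
Lemma spherical_chart_image tau' : noncrossing_tree tau' -> refines tau tau' ->
  spherical_chart @` closed_simplex p tau' =
  spherical_simplex (simplex_vertices p tau') vertex_point.
Proof.
move=> nt' rf; have sub := simplex_vertices_sub rf.
have csub x : closed_simplex p tau' x -> closed_simplex p tau x.
  by case=> x0 xv x1; split=> // sigma ns; apply: xv => /sub.
apply/seteqP; split=> [_ [x xt' <-]|z [z1 [a [a0 av zE]]]].
  have xt := csub x xt'; have cx := closed_simplex_cone xt.
  have h0 := cone_heights_neq0 nt cx.
  rewrite spherical_chartE //; split; first exact: unitv_unit.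
  have [x0 xv _] := xt'.
  exists (fun s => (Num.sqrt (dotv (heights tau x) (heights tau x)))^-1 *
    (x s * Num.sqrt (dotv (vertex_heights R tau s) (vertex_heights R tau s)))); split.
  - by move=> s; rewrite mulr_ge0 ?invr_ge0 ?sqrtr_ge0 // mulr_ge0 ?sqrtr_ge0.
  - by move=> s ns; rewrite xv // mul0r mulr0.
  - rewrite /unitv [X in _ *: X = _]heights_cone_comb scaler_sumr.
    by apply: eq_bigr => s _; rewrite scalerA.
move: zE; rewrite vertex_points_comb; set b := (fun s => a s * _) => zE.
have b0 s : 0 <= b s by rewrite mulr_ge0 // invr_ge0 sqrtr_ge0.
have bv s : ~ simplex_vertices p tau' s -> b s = 0 by move=> ns; rewrite /b av // mul0r.
have cb : cone tau b.
  split=> //; first by apply: vertex_support_of => s ns; apply: bv => /sub.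
  apply/existsP; apply: contraT; rewrite negb_exists => /forallP h.
  have z0 : z = 0.
    by rewrite zE heightsE big1 // => s _; have := h s; rewrite negbK => /eqP->; rewrite scale0r.
  move: z1; rewrite z0 /dotv big1 => [/eqP|i _]; first by rewrite eq_sym oner_eq0.
  by rewrite mxE mul0r.
have S0 := cone_sum_gt0 cb.
have xt' : closed_simplex p tau' (barycentric b).
  split.
  - by move=> s; rewrite divr_ge0 // ltW.
  - by move=> s ns; rewrite /barycentric bv // mul0r.
  - by rewrite -mulr_suml divff // gt_eqF.
exists (barycentric b) => //; rewrite spherical_chartE; last exact: csub.
have -> : heights tau (barycentric b) = (\sum_s b s)^-1 *: heights tau b.
  by rewrite !heightsE scaler_sumr; apply: eq_bigr => s _; rewrite scalerA mulrC.
by rewrite unitvZ ?invr_gt0 // -zE unitv_id.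
Qed.

Lemma spherical_chart_inj x y : closed_simplex p tau x -> closed_simplex p tau y ->
  spherical_chart x = spherical_chart y -> x = y.
Proof.
move=> xt yt; rewrite !spherical_chartE // /unitv.
have cx := closed_simplex_cone xt; have cy := closed_simplex_cone yt.
have hx := cone_heights_neq0 nt cx; have hy := cone_heights_neq0 nt cy.
set k := Num.sqrt _; set l := Num.sqrt _ => E.
have k0 : 0 < k by rewrite sqrtr_gt0 dotv_gt0.
have l0 : 0 < l by rewrite sqrtr_gt0 dotv_gt0.
have [x0 xv x1] := xt; have [y0 yv y1] := yt.
have h0 : heights tau (fun s => k^-1 * x s + (- l^-1) * y s) = 0.
  by rewrite heights_comb E scaleNr subrr.
have sz : vertex_support tau (fun s => k^-1 * x s + (- l^-1) * y s).
  by apply: vertex_support_of => s ns; rewrite xv // yv // !mulr0 addr0.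
have z s : k^-1 * x s = l^-1 * y s.
  by have /eqP := heights_inj nt sz h0 s; rewrite mulNr subr_eq0 => /eqP.
have kl : k^-1 = l^-1.
  rewrite -[LHS]mulr1 -[RHS]mulr1 -{1}x1 -y1 !mulr_sumr; exact: eq_bigr.
apply/funext => s; have kn : k^-1 != 0 by rewrite invr_eq0 gt_eqF.
by apply: (mulfI kn); rewrite z kl.
Qed.

Lemma link_dist_spherical :
  is_spherical_simplex p (fun x y => link_dist p (link_of p x) (link_of p y)) tau.
Proof.
exists m, vertex_point, spherical_chart; split.
- split; last exact: vertex_points_independent.
  by move=> sigma vs; apply: unitv_unit; apply: vertex_heights_neq0.
- have img := spherical_chart_image nt (refines_refl tau); split.
  + by move=> x xt; rewrite -img; exists x.
  + by move=> x y /set_mem xt /set_mem yt; apply: spherical_chart_inj.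
  + by move=> z; rewrite -img.
- by move=> tau' /(noncrossing_hypertreeP hn hp) nt'; exact: spherical_chart_image.
- move=> x y xt yt; rewrite !spherical_chartE //.
  have := link_dist_heights hn hp nt (closed_simplex_cone xt) (closed_simplex_cone yt).
  by rewrite /link_point !barycentric_id.
Qed.
End SphericalSimplex.

Local Open Scope classical_set_scope.

Theorem theoremA (R : realType) (n : nat) (p : 'I_n.+1 -> 'rV[R]_2)
    (hn : (2 <= n)%N) (hp : clockwise_convex_polygon p) :
  exists h : coords R n -> coords R n,
    [/\ homeomorphism_between (hypertree_complex p) (partition_link p) h,
        forall tau : hypergraph n, noncrossing_hypertree p tau ->
          h @` closed_simplex p tau = Simplex tau
      & forall tau : hypergraph n, noncrossing_hypertree p tau ->
          is_spherical_simplex p (fun x y => link_dist p (h x) (h y)) tau].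
Proof.
exists (link_of p); split; first exact: link_of_homeomorphism.
- by move=> tau /(noncrossing_hypertreeP hn hp); exact: link_of_Simplex.
- by move=> tau /(noncrossing_hypertreeP hn hp); exact: link_dist_spherical.
Qed.
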